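(* Equip $[0,T]\times\mathbb{R}^{\mathcal{A}}$ with the product $\sigma$-algebra. Let $g\colon[0,T]\times\mathbb{R}\times\mathbb{R}^d\to\mathbb{R}$ be measurable with $\int_0^T|g(t,0,0)|^2dt<\infty$ and such that for some constant $[g]_L>0$, for $dt$-a.e. $t$, $|g(t,y_1,z_1)-g(t,y_2,z_2)|\le[g]_L(|y_1-y_2|+|z_1-z_2|)$ for all $(y_1,z_1),(y_2,z_2)\in\mathbb{R}\times\mathbb{R}^d$. Then, for any $\xi\in L^2(\mathcal{F}_T)$, there exist two measurable maps $u\colon[0,T]\times\mathbb{R}^{\mathcal{A}}\to\mathbb{R}$ and $v\colon[0,T]\times\mathbb{R}^{\mathcal{A}}\to\mathbb{R}^d$ such that the solution $(Y,Z)$ of the BSDE $$Y_t=\xi+\int_t^Tg(s,Y_s,Z_s)\,ds-\int_t^TZ_s\cdot dB_s,\quad t\in[0,T],$$ satisfies $Y_t=u(t,X_t)$ and $Z_t=v(t,X_t)$ $dt\otimes\mathbb{P}$-a.e. Moreover, $u$ and $v$ belong to $L^2(\nu)$ for some finite measure $\nu$ on $[0,T]\times\mathbb{R}^{\mathcal{A}}$.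
   Context: $T>0$; $B=(B_t)_{t\in[0,T]}$ is a standard $d$-dimensional Brownian motion on a complete probability space $(\Omega,\mathcal{F},\mathbb{P})$; $(\mathcal{F}_t)_{t\in[0,T]}$ is its natural filtration augmented with the $\mathbb{P}$-null sets; $L^2(\mathcal{F}_T)$ is the space of real square-integrable $\mathcal{F}_T$-measurable random variables. $\mathbb{H}^2_T(\mathbb{R}^n)$ is the space of predictable $\mathbb{R}^n$-valued processes $\varphi$ with $\mathbb{E}\int_0^T|\varphi_t|^2dt<\infty$. Under the stated assumptions the BSDE has a unique solution $(Y,Z)\in\mathbb{H}^2_T(\mathbb{R})\times\mathbb{H}^2_T(\mathbb{R}^d)$ with $Y$ continuous. Hermite polynomials: $H_0(x)=1$, $H_n(x)=\frac{(-1)^n}{n!}e^{x^2/2}\frac{d^n}{dx^n}(e^{-x^2/2})$ for $n\ge1$. $\mathcal{A}$ is the (countable) set of all sequences $a=(a_1,a_2,\dots)$ of non-negative integers with only finitely many nonzero terms; $(h_i)_{i\ge1}$ is an orthonormal basis of $L^2([0,T];\mathbb{R}^d)$. The $\mathbb{R}^{\mathcal{A}}$-valued process $X$ is $X_t^{a}=\prod_{i\ge1}H_{a_i}\big(\int_0^t h_i(s)\cdot dB_s\big)$, $a\in\mathcal{A}$. $\mathbb{R}^{\mathcal{A}}$ carries the product $\sigma$-algebra $\bigotimes_{a\in\mathcal{A}}\mathcal{B}(\mathbb{R})$. *)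

(* Defs.v *)
From HB Require Import structures.
From mathcomp Require Import all_boot all_order all_algebra finmap.
From mathcomp Require Import all_classical all_reals all_analysis.

Set Implicit Arguments.
Unset Strict Implicit.
Unset Printing Implicit Defensive.

Import Order.TTheory GRing.Theory Num.Theory.
Import numFieldNormedType.Exports.

Local Open Scope classical_set_scope.
Local Open Scope ring_scope.

(* [realpow R I] is R^I with the product sigma-algebra of the Borel
   sigma-algebras: it serves both for R^d (I = 'I_d) and for R^A. *)
Definition cylinders (R : realType) (I : Type) : set (set (I -> R)) :=
  [set C | exists i (U : set R), measurable U /\ C = [set x | U (x i)]].

Definition realpow (R : realType) (I : Type) :=
  g_sigma_algebraType (@cylinders R I).

Definition dot (R : realType) (d : nat) (x y : 'I_d -> R) : R :=
  \sum_(k < d) x k * y k.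

(* The Euclidean norm; the library norms on finite products are sup norms. *)
Definition norm2 (R : realType) (d : nat) (x : 'I_d -> R) : R :=
  Num.sqrt (dot x x).

Definition mutually_independent (R : realType) (dO : measure_display)
    (Omega : measurableType dO) (P : probability Omega R)
    (I : finType) (X : I -> Omega -> R) : Prop :=
  forall U : I -> set R, (forall i, measurable (U i)) ->
    P [set w | forall i, U i (X i w)] = (\prod_(i : I) P (X i @^-1` U i))%E.

(* Mutual independence over all pairs (increment, coordinate) covers both the
   independence of the increments and that of the coordinates.  The second
   parameter of [normal_prob] is the standard deviation. *)
Definition brownian_motion (R : realType) (dO : measure_display)
    (Omega : measurableType dO) (P : probability Omega R) (T : R) (d : nat)
    (B : R -> Omega -> realpow R 'I_d) : Prop :=
  [/\ forall t k, t \in `[0, T] -> measurable_fun setT (fun w => B t w k),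
      {ae P, forall w, forall k, B 0 w k = 0},
      {ae P, forall w, forall k,
         {within `[0, T], continuous (fun t => B t w k)}},
      forall (n : nat) (t : nat -> R), 0 <= t 0%N -> t n <= T ->
        (forall j, (j < n)%N -> t j < t j.+1) ->
        mutually_independent P (fun (jk : 'I_n * 'I_d) w =>
          B (t jk.1.+1) w jk.2 - B (t jk.1) w jk.2)
    & forall (s t : R) (k : 'I_d) (U : set R),
        0 <= s -> s < t -> t <= T -> measurable U ->
        P [set w | U (B t w k - B s w k)] =
        normal_prob 0 (Num.sqrt (t - s)) U].

Definition augmented_filtration (R : realType) (dO : measure_display)
    (Omega : measurableType dO) (P : probability Omega R) (d : nat)
    (B : R -> Omega -> realpow R 'I_d) (t : R) : set (set Omega) :=
  <<s [set A | (exists s k (U : set R), [/\ s \in `[0, t], measurable U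
                 & A = [set w | U (B s w k)]])
               \/ P.-negligible A] >>.

Definition measurable_wrt (R : realType) (dO : measure_display)
    (Omega : measurableType dO) (F : set (set Omega)) (xi : Omega -> R) : Prop :=
  forall U : set R, measurable U -> F (xi @^-1` U).

Definition predictable_sets (R : realType) (dO : measure_display)
    (Omega : measurableType dO) (T : R) (F : R -> set (set Omega)) :
    set (set (R * Omega)) :=
  <<s `[0, T] `*` setT,
      [set C | (exists A, F 0 A /\ C = [set 0] `*` A) \/
               (exists s t A, [/\ 0 <= s, s < t, t <= T, F s A
                                & C = `]s, t] `*` A])] >>.

Definition predictable (R : realType) (dO : measure_display)
    (Omega : measurableType dO) (T : R) (F : R -> set (set Omega)) (n : nat)
    (phi : R -> Omega -> realpow R 'I_n) : Prop :=
  forall U : set (realpow R 'I_n), measurable U ->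
    predictable_sets T F
      ((`[0, T] `*` setT) `&` [set p | U (phi p.1 p.2)]).

(* E int_0^T |phi_t|^2 dt *)
Definition H2_sqnorm (R : realType) (dO : measure_display)
    (Omega : measurableType dO) (P : probability Omega R) (T : R) (n : nat)
    (phi : R -> Omega -> realpow R 'I_n) : \bar R :=
  (\int[P]_w \int[lebesgue_measure]_(t in `[0%R, T])
     ((norm2 (phi t w) ^+ 2)%R)%:E)%E.

Definition H2 (R : realType) (dO : measure_display)
    (Omega : measurableType dO) (P : probability Omega R) (T : R)
    (F : R -> set (set Omega)) (n : nat)
    (phi : R -> Omega -> realpow R 'I_n) : Prop :=
  predictable T F phi /\ (H2_sqnorm P T phi < +oo)%E.

(* The process sum_i coef_i * 1_(start_i, stop_i]. *)
Record simple (R : realType) (Omega : Type) (d : nat) := Simple {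
  simple_size : nat;
  simple_start : 'I_simple_size -> R;
  simple_stop : 'I_simple_size -> R;
  simple_coef : 'I_simple_size -> Omega -> realpow R 'I_d
}.

Arguments simple_start {R Omega d} _ _.
Arguments simple_stop {R Omega d} _ _.
Arguments simple_coef {R Omega d} _ _ _.

Definition simple_process (R : realType) (dO : measure_display)
    (Omega : measurableType dO) (T : R) (F : R -> set (set Omega)) (d : nat)
    (e : simple R Omega d) : Prop :=
  forall i,
    [/\ 0 <= simple_start e i, simple_start e i <= simple_stop e i,
        simple_stop e i <= T,
        forall k, measurable_wrt (F (simple_start e i))
                    (fun w => simple_coef e i w k)
      & exists M : R, forall w k, `|simple_coef e i w k| <= M].

Definition simple_value (R : realType) (Omega : Type) (d : nat)
    (e : simple R Omega d) (t : R) (w : Omega) : realpow R 'I_d :=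
  fun k => \sum_i (if simple_start e i < t <= simple_stop e i
                   then simple_coef e i w k else 0).

Definition simple_integral (R : realType) (Omega : Type) (d : nat)
    (B : R -> Omega -> realpow R 'I_d) (e : simple R Omega d)
    (t : R) (w : Omega) : R :=
  \sum_i dot (simple_coef e i w)
    (fun k => B (Num.min (simple_stop e i) t) w k
              - B (Num.min (simple_start e i) t) w k).

(* [M] is a continuous version of the Ito integral (int_0^t phi_s . dB_s)_t,
   obtained as the L^2 limit of integrals of simple processes.  It is a relation
   because such a version is only unique up to indistinguishability. *)
Definition ito_integral (R : realType) (dO : measure_display)
    (Omega : measurableType dO) (P : probability Omega R) (T : R) (d : nat)
    (B : R -> Omega -> realpow R 'I_d) (phi : R -> Omega -> realpow R 'I_d)
    (M : R -> Omega -> R) : Prop :=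
  [/\ forall t, t \in `[0, T] ->
        measurable_wrt (augmented_filtration P B t) (M t),
      {ae P, forall w, {within `[0, T], continuous (fun t => M t w)}}
    & exists e : nat -> simple R Omega d,
        [/\ forall n, simple_process T (augmented_filtration P B) (e n),
            (fun n => H2_sqnorm P T
               (fun t w k => simple_value (e n) t w k - phi t w k))
              @ \oo --> 0%E
          & forall t, t \in `[0, T] ->
              (fun n => \int[P]_w
                 (((simple_integral B (e n) t w - M t w) ^+ 2)%R)%:E)%E
                @ \oo --> 0%E]].

Definition L2vec (R : realType) (T : R) (d : nat)
    (f : R -> realpow R 'I_d) : Prop :=
  measurable_fun `[0, T] f /\
  (\int[lebesgue_measure]_(t in `[0%R, T]) ((norm2 (f t) ^+ 2)%R)%:E < +oo)%E.

(* Orthonormal basis of L^2([0, T]; R^d): an orthonormal family whose linear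
   span is dense.  Indices start at 0 instead of 1. *)
Definition orthonormal_basis (R : realType) (T : R) (d : nat)
    (h : nat -> R -> realpow R 'I_d) : Prop :=
  [/\ forall i, L2vec T (h i),
      forall i j, \int[lebesgue_measure]_(t in `[0, T]) dot (h i t) (h j t) =
                  (i == j)%:R
    & forall f, L2vec T f -> forall eps : R, 0 < eps ->
        exists (n : nat) (c : nat -> R),
          (\int[lebesgue_measure]_(t in `[0%R, T])
             ((norm2 (fun k => f t k - \sum_(i < n) c i * h i t k) ^+ 2)%R)%:E
           < eps%:E)%E].

Definition hermite (R : realType) (n : nat) (x : R) : R :=
  (-1) ^+ n / n`!%:R * expR (x ^+ 2 / 2) *
  derive1n n (fun y => expR (- (y ^+ 2 / 2))) x.

Definition multiindex := {fsfun nat -> nat with 0%N}.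

(* [W i t] stands for int_0^t h_i(s) . dB_s; the factors outside the support of
   [a] are H_0 = 1. *)
Definition chaos_process (R : realType) (Omega : Type)
    (W : nat -> R -> Omega -> R) (t : R) (w : Omega) : realpow R multiindex :=
  fun a => \prod_(i <- finsupp a) hermite (a i) (W i t w).

Definition bsde_solution (R : realType) (dO : measure_display)
    (Omega : measurableType dO) (P : probability Omega R) (T : R) (d : nat)
    (B : R -> Omega -> realpow R 'I_d) (g : R -> R -> realpow R 'I_d -> R)
    (xi : Omega -> R)
    (Y : R -> Omega -> R) (Z : R -> Omega -> realpow R 'I_d) : Prop :=
  [/\ @H2 R _ _ P T (augmented_filtration P B) 1 (fun t w _ => Y t w),
      H2 P T (augmented_filtration P B) Z,
      {ae P, forall w, {within `[0, T], continuous (fun t => Y t w)}}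
    & exists2 M, ito_integral P T B Z M &
        {ae P, forall w, forall t, t \in `[0, T] ->
           Y t w = xi w
             + \int[lebesgue_measure]_(s in `[t, T]) g s (Y s w) (Z s w)
             - (M T w - M t w)}].

(* Main.v *)
(** Let X_t be the vector of all Hermite products of the integrals W^i = int h_i . dB.
    Since H_1(x) = x, the W^i_t are coordinates of X_t, and expanding 1_(0,q] e_k in the
    basis h gives B^k_q = lim_n sum_i c_{n,i} W^i_t in L^2(P) for every t >= q.  Choosing
    expansions with error 2^-n makes this an a.e. limit of a fixed functional of X_t, so,
    up to dt x P-null sets, the rectangles (s, t] x A with A in F_s, and hence all
    predictable sets, are preimages under (t, w) |-> (t, X_t(w)).  A predictable process is
    then recovered from its rational superlevel sets as a measurable function of (t, X_t).

    A solution is therefore of the required form; that (u, v) serves every solution is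
    uniqueness.  The difference (y, z) of two solutions satisfies, when y_b = 0,
    E y_t^2 + E int_t^b |z|^2 = E (int_t^b gamma)^2 <= K (b - t) E int_t^b (y^2 + |z|^2)
    with gamma the difference of the generators; this forces y = z = 0 on short intervals,
    and one steps from T down to 0.  The measure nu is the image of dt x P under
    (t, w) |-> (t, X_t(w)). *)

Require Import Defs.
From HB Require Import structures.
From mathcomp Require Import all_boot all_order all_algebra finmap.
From mathcomp Require Import all_classical all_reals all_analysis.
From mathcomp Require Import measurable_realfun.
From mathcomp Require Import ring lra.

Set Implicit Arguments.
Unset Strict Implicit.
Unset Printing Implicit Defensive.

Import Order.TTheory GRing.Theory Num.Theory.
Import numFieldNormedType.Exports.

Local Open Scope classical_set_scope.
Local Open Scope ring_scope.


(** * The L2 inner product *)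

(** The state X_t is seen only at the current time t and must still know the whole past of B. It
    does because the coefficients expanding 1_(0,q] e_k do not depend on t: by the isometry the
    squared error at any time t is at most the squared norm of the remainder on [0, T], so one
    functional recovers B_q at all t in (q, T] together. This is why rectangles (s, t] x A with A in
    F_s are treated, rather than sections at a fixed time.

    The hypothesis on B speaks of finitely many increments only, whereas the isometry needs
    increments independent of the augmented F_s. A pi-system of events at finitely many times,
    together with the null sets, bridges the gap.

    The pair (u, v) is chosen before the solution, so uniqueness has to be proved. No Ito formula
    enters: when y_b = 0 the equation reads y_t + (N_b - N_t) = int_t^b gamma with N the integral of
    z, and the two terms on the left are orthogonal because y_t is F_t-measurable. The same identity
    shows that y_t is square-integrable for every t, which membership in H^2 gives only for almost
    every t. *)

Section square_integrable.
Context d (S : measurableType d) (R : realType) (mu : {measure set S -> \bar R}).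
Implicit Types f g : S -> R.

Definition sqint f :=
  measurable_fun setT f /\ (\int[mu]_x ((f x ^+ 2)%R)%:E < +oo)%E.

Definition ip f g : R := \int[mu]_x (f x * g x).

Lemma sqint_sqr f : sqint f -> mu.-integrable setT (fun x => ((f x ^+ 2)%R)%:E).
Proof.
move=> [mf foo]; apply/integrableP; split.
  by apply/measurable_EFinP; exact: measurable_funX.
by under eq_integral do rewrite gee0_abs ?lee_fin ?sqr_ge0//.
Qed.

(** The product is dominated by f^2 + g^2. *)
Lemma sqint_mul f g : sqint f -> sqint g ->
  mu.-integrable setT (EFin \o (fun x => f x * g x)).
Proof.
move=> sf sg; have [mf _] := sf; have [mg _] := sg.
apply: (le_integrable measurableT _ _ (integrableD measurableT (sqint_sqr sf) (sqint_sqr sg))).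
  by apply/measurable_EFinP; exact: measurable_funM.
move=> x _ /=; rewrite lee_fin normrM [leRHS]ger0_norm ?addr_ge0 ?sqr_ge0//.
rewrite -(real_normK (num_real (f x))) -(real_normK (num_real (g x))).
have := sqr_ge0 (`|f x| - `|g x|); have := normr_ge0 (f x).
by have := normr_ge0 (g x); nra.
Qed.

Lemma ipE f g : sqint f -> sqint g ->
  (ip f g)%:E = (\int[mu]_x ((f x * g x)%R)%:E)%E.
Proof.
by move=> sf sg; rewrite /ip /Rintegral fineK//; exact/integrable_fin_num/sqint_mul.
Qed.

Lemma ip_sqrE f : sqint f -> (ip f f)%:E = (\int[mu]_x ((f x ^+ 2)%R)%:E)%E.
Proof. by move=> sf; rewrite ipE//; under eq_integral do rewrite -expr2. Qed.

Lemma le_sqint f g : measurable_fun setT f -> sqint g ->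
  (forall x, `|f x| <= `|g x|) -> sqint f.
Proof.
move=> mf [mg goo] fg; split => //; apply: le_lt_trans goo.
apply: ge0_le_integral => //.
- by move=> x _; rewrite lee_fin sqr_ge0.
- by apply/measurable_EFinP; exact: measurable_funX.
- by apply/measurable_EFinP; exact: measurable_funX.
- move=> x _; rewrite lee_fin -(real_normK (num_real (f x))).
  rewrite -(real_normK (num_real (g x))).
  by rewrite lerXn2r// nnegrE.
Qed.

Lemma sqintZ c f : sqint f -> sqint (fun x => c * f x).
Proof.
move=> [mf foo]; split; first exact: measurable_funM.
under eq_integral do rewrite exprMn EFinM.
rewrite ge0_integralZl//; last 3 first.
- by apply/measurable_EFinP; exact: measurable_funX.
- by move=> x _; rewrite lee_fin sqr_ge0.
- by rewrite lee_fin sqr_ge0.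
by rewrite lte_mul_pinfty// lee_fin sqr_ge0.
Qed.

Lemma sqintD f g : sqint f -> sqint g -> sqint (fun x => f x + g x).
Proof.
move=> sf sg; have [mf foo] := sf; have [mg goo] := sg.
split; first exact: measurable_funD.
(* The dominating function is (2 f)^2 + (2 g)^2, which exceeds (f + g)^2. *)
have := integrableD measurableT (sqint_sqr (sqintZ 2 sf)) (sqint_sqr (sqintZ 2 sg)).
move=> /integrableP[mh]; apply: le_lt_trans.
apply: ge0_le_integral => //.
- by move=> x _; rewrite lee_fin sqr_ge0.
- by apply/measurable_EFinP; apply: measurable_funX; exact: measurable_funD.
- exact: measurableT_comp.
- move=> x _ /=; rewrite lee_fin [leRHS]ger0_norm ?addr_ge0 ?sqr_ge0//.
  by have := sqr_ge0 (f x - g x); nra.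
Qed.

Lemma sqintB f g : sqint f -> sqint g -> sqint (fun x => f x - g x).
Proof.
move=> sf /(sqintZ (-1)) sg; have := sqintD sf sg.
by under eq_fun do rewrite mulN1r.
Qed.

Lemma sqint0 : sqint (fun=> 0).
Proof.
split; first exact: measurable_cst.
by under eq_integral do rewrite expr0n/=; rewrite integral0.
Qed.

Lemma sqint_sum (I : Type) (s : seq I) (F : I -> S -> R) :
  (forall i, sqint (F i)) -> sqint (fun x => \sum_(i <- s) F i x).
Proof.
move=> sF; elim: s => [|i s ih].
  by under eq_fun do rewrite big_nil; exact: sqint0.
by under eq_fun do rewrite big_cons; exact: sqintD.
Qed.

Lemma ipC f g : ip f g = ip g f.
Proof. by apply: eq_Rintegral => x _; rewrite mulrC. Qed.

Lemma ipDl f g h : sqint f -> sqint g -> sqint h ->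
  ip (fun x => f x + g x) h = ip f h + ip g h.
Proof.
move=> sf sg sh; rewrite /ip -RintegralD//; [|exact: sqint_mul|exact: sqint_mul].
by apply: eq_Rintegral => x _; rewrite mulrDl.
Qed.

Lemma ipZl c f g : sqint f -> sqint g -> ip (fun x => c * f x) g = c * ip f g.
Proof.
move=> sf sg; rewrite /ip -RintegralZl//; last exact: sqint_mul.
by apply: eq_Rintegral => x _; rewrite mulrA.
Qed.

Lemma ipBl f g h : sqint f -> sqint g -> sqint h ->
  ip (fun x => f x - g x) h = ip f h - ip g h.
Proof.
move=> sf sg sh; rewrite /ip -RintegralB//; [|exact: sqint_mul|exact: sqint_mul].
by apply: eq_Rintegral => x _; rewrite mulrBl.
Qed.

Lemma ipBr f g h : sqint f -> sqint g -> sqint h ->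
  ip h (fun x => f x - g x) = ip h f - ip h g.
Proof. by move=> sf sg sh; rewrite ipC ipBl// ipC [in X in _ - X]ipC. Qed.

Lemma ipDr f g h : sqint f -> sqint g -> sqint h ->
  ip h (fun x => f x + g x) = ip h f + ip h g.
Proof. by move=> sf sg sh; rewrite ipC ipDl// ipC [in X in _ + X]ipC. Qed.

Lemma ipZr c f g : sqint f -> sqint g -> ip g (fun x => c * f x) = c * ip g f.
Proof. by move=> sf sg; rewrite ipC ipZl// ipC. Qed.

Lemma ip0l g : ip (fun=> 0) g = 0.
Proof.
by rewrite /ip /Rintegral; under eq_integral do rewrite mul0r; rewrite integral0.
Qed.

Lemma ip_suml (I : Type) (s : seq I) (F : I -> S -> R) g :
  (forall i, sqint (F i)) -> sqint g ->
  ip (fun x => \sum_(i <- s) F i x) g = \sum_(i <- s) ip (F i) g.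
Proof.
move=> sF sg; elim: s => [|i s ih].
  by under eq_fun do rewrite big_nil; rewrite big_nil ip0l.
under eq_fun do rewrite big_cons.
by rewrite big_cons ipDl ?ih//; exact: sqint_sum.
Qed.

Lemma ip_sumr (I : Type) (s : seq I) (F : I -> S -> R) g :
  (forall i, sqint (F i)) -> sqint g ->
  ip g (fun x => \sum_(i <- s) F i x) = \sum_(i <- s) ip g (F i).
Proof.
by move=> sF sg; rewrite ipC ip_suml//; apply: eq_bigr => i _; rewrite ipC.
Qed.

Lemma ip_ge0 f : 0 <= ip f f.
Proof. by apply: Rintegral_ge0 => x _; rewrite -expr2 sqr_ge0. Qed.

Lemma ip_sqrB c f g : sqint f -> sqint g ->
  ip (fun x => f x - c * g x) (fun x => f x - c * g x) =
  ip f f - 2 * c * ip f g + c ^+ 2 * ip g g.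
Proof.
move=> sf sg; have scg := sqintZ c sg.
rewrite ipBl ?ipBr ?ipZl ?ipZr//; last exact: sqintB.
by rewrite (ipC g f); ring.
Qed.

(** The quadratic polynomial c |-> ||f - c g||^2 is nonnegative. *)
Lemma ip_cauchy_schwarz f g : sqint f -> sqint g ->
  ip f g ^+ 2 <= ip f f * ip g g.
Proof.
move=> sf sg; have ineq c : 0 <= ip f f - 2 * c * ip f g + c ^+ 2 * ip g g.
  by rewrite -ip_sqrB// ip_ge0.
have := ip_ge0 g; have := ip_ge0 f.
move: (ip f f) (ip f g) (ip g g) ineq => a c b ineq a0.
rewrite le_eqVlt => /predU1P[b0|b0].
  rewrite -b0 mulr0; have [->|c0] := eqVneq c 0; first by rewrite expr0n.
  (* When ||g|| = 0 the polynomial is affine in its variable; at this point it equals - a - 2, which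
     is negative. *)
  have := ineq ((a + 1) / c); rewrite -b0 mulr0 addr0.
  by rewrite -mulrA divfK//; lra.
(* The minimiser of the polynomial. *)
have := ineq (c / b).
have -> : a - 2 * (c / b) * c + (c / b) ^+ 2 * b = (a * b - c ^+ 2) / b.
  by field; rewrite gt_eqF.
by rewrite pmulr_lge0 ?invr_gt0// subr_ge0.
Qed.

(** Stated with the extended integral, as in [ito_integral], so that it makes sense before the limit
    is known to be square-integrable; [sqcvg_sqint] then deduces this. *)
Definition sqcvg (F : nat -> S -> R) f :=
  (fun n => (\int[mu]_x (((F n x - f x) ^+ 2)%R)%:E)%E) @ \oo --> 0%E.

Lemma sqcvgP F f : (forall n, sqint (F n)) -> sqint f ->
  sqcvg F f <->
  (fun n => ip (fun x => F n x - f x) (fun x => F n x - f x)) @ \oo --> 0.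
Proof.
move=> sF sf; rewrite /sqcvg.
rewrite (_ : (fun n => _) = EFin \o (fun n => ip (fun x => F n x - f x) (fun x => F n x - f x)));
  last by apply/funext => n /=; rewrite ip_sqrE//; exact: sqintB.
split=> [/fine_cvgP[_ h]|h]; first exact: h.
by apply/fine_cvgP; split => //; exact: nearW.
Qed.

Lemma ip_norm_le f g : sqint f -> sqint g ->
  `|ip f g| <= Num.sqrt (ip f f) * Num.sqrt (ip g g).
Proof.
move=> sf sg; rewrite -sqrtrM ?ip_ge0// -sqrtr_sqr ler_sqrt.
  exact: ip_cauchy_schwarz.
by rewrite mulr_ge0 ?ip_ge0.
Qed.

(** Cauchy-Schwarz bounds each of the three terms in the expansion of the difference. Isometry and
    orthogonality pass from simple processes to their limits through this lemma. *)
Lemma sqcvg_ip F G f g :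
  (forall n, sqint (F n)) -> sqint f -> (forall n, sqint (G n)) -> sqint g ->
  sqcvg F f -> sqcvg G g -> (fun n => ip (F n) (G n)) @ \oo --> ip f g.
Proof.
move=> sF sf sG sg /sqcvgP-/(_ sF sf) cF /sqcvgP-/(_ sG sg) cG.
have sFf n := sqintB (sF n) sf; have sGg n := sqintB (sG n) sg.
pose a n := Num.sqrt (ip (fun x => F n x - f x) (fun x => F n x - f x)).
pose b n := Num.sqrt (ip (fun x => G n x - g x) (fun x => G n x - g x)).
pose u := Num.sqrt (ip f f); pose v := Num.sqrt (ip g g).
have a0 : a @ \oo --> 0.
  by rewrite -[X in _ --> X]sqrtr0; apply: (cvg_comp _ _ cF); exact: sqrt_continuous.
have b0 : b @ \oo --> 0.
  by rewrite -[X in _ --> X]sqrtr0; apply: (cvg_comp _ _ cG); exact: sqrt_continuous.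
have c0 : (fun n => a n * b n + a n * v + u * b n) @ \oo --> 0.
  rewrite [X in _ --> X](_ : _ = 0 * 0 + 0 * v + u * 0); last by ring.
  by apply: cvgD; [apply: cvgD; apply: cvgM => //; exact: cvg_cst|
    apply: cvgM => //; exact: cvg_cst].
apply/subr_cvg0/norm_cvg0P.
apply: (squeeze_cvgr _ _ c0); last exact: cvg_cst.
apply: nearW => n /=; rewrite normr_ge0 /=.
have -> : ip (F n) (G n) - ip f g = ip (fun x => F n x - f x) (fun x => G n x - g x)
    + ip (fun x => F n x - f x) g + ip f (fun x => G n x - g x).
  by rewrite ipBl// !ipBr// ipBl//; ring.
rewrite (le_trans (ler_normD _ _))// lerD ?ip_norm_le//.
by rewrite (le_trans (ler_normD _ _))// lerD ?ip_norm_le.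
Qed.

End square_integrable.

(** * Normal moments and independence *)

Section normal_moments.
Context (R : realType) (s : R) (s_gt0 : 0 < s).
Notation mu := (@lebesgue_measure R).
Notation nu := (normal_prob 0 s).
Notation p := (normal_pdf 0 s).

Let s_neq0 : s != 0. Proof. by rewrite gt_eqF. Qed.

(** The Radon-Nikodym derivative of the normal law agrees almost everywhere with the density [p],
    because both have the same integral over every measurable set. *)
Lemma ge0_integral_normal_prob (f : R -> \bar R) : (forall x, 0 <= f x)%E ->
  measurable_fun setT f ->
  (\int[nu]_x f x = \int[mu]_x (f x * (p x)%:E))%E.
Proof.
move=> f0 mf.
have dom : normal_prob 0 s `<< mu by exact: normal_prob_dominates.
rewrite -(Radon_Nikodym_SigmaFinite.change_of_variables dom f0 measurableT mf).
have if0 := Radon_Nikodym_SigmaFinite.f_integrable dom.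
apply: ae_eq_integral => //.
- apply: emeasurable_funM => //; exact: (measurable_int mu).
- apply: emeasurable_funM => //; apply/measurable_EFinP.
  exact: measurable_normal_pdf.
apply: ae_eqe_mul2l; apply: integral_ae_eq => //.
  by apply/measurable_EFinP; exact: measurable_normal_pdf.
by move=> E _ mE; rewrite -Radon_Nikodym_SigmaFinite.f_integral.
Qed.

Let pE x : p x = normal_peak s * expR (- (x ^+ 2 / (s ^+ 2 *+ 2))).
Proof. by rewrite normal_pdfE// /normal_fun subr0 mulNr. Qed.

Lemma normal_pdf_sym x : p (- x) = p x.
Proof. by rewrite !pE sqrrN. Qed.

Let derive_p (x : R) : is_derive x 1 p (- (x / s ^+ 2) * p x).
Proof.
have h : is_derive x 1 (fun y : R => - (y ^+ 2 / (s ^+ 2 *+ 2))) (- (x / s ^+ 2)).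
  apply: is_derive_eq.
  rewrite ?scaler0 ?add0r /GRing.scale/=.
  by rewrite -mulr_natr; field.
have := is_derive1_comp (is_derive_expR _) h => {}h.
have -> : normal_pdf 0 s = fun y : R => normal_peak s * expR (- (y ^+ 2 / (s ^+ 2 *+ 2))).
  by apply/funext => y; rewrite pE.
apply: is_derive_eq; rewrite /GRing.scale/= .
ring.
Qed.

(** [G] vanishes at 0 and at infinity and has derivative [g], so that int g = 0 on the half-line,
    which says that the second moment is s^2. As [g] changes sign at s, the fundamental theorem is
    applied on [0, s] and on [s, +oo) separately. *)
Let G (x : R) : R := - (x * p x).
Let g (x : R) : R := (x ^+ 2 / s ^+ 2 - 1) * p x.

Let derive_G (x : R) : is_derive x 1 G (g x).
Proof.
have h := derive_p x.
apply: is_derive_eq; rewrite /GRing.scale/= /g.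
by field.
Qed.

Let derivable_G x : derivable G x 1.
Proof. by have [] := derive_G x. Qed.

Let continuous_G : continuous G.
Proof.
by move=> x; apply: differentiable_continuous; exact/derivable1_diffP.
Qed.

Let continuous_p : continuous p. Proof. exact: continuous_normal_pdf. Qed.

Let continuous_g : continuous g.
Proof.
move=> x; apply: cvgM; last exact: continuous_p.
apply: cvgB; last exact: cvg_cst.
apply: cvgM; last exact: cvg_cst.
exact: sqr_continuous.
Qed.

Let cvg_G : G x @[x --> +oo] --> 0.
Proof.
have k0 : 0 < normal_peak s by exact: normal_peak_gt0.
apply/cvgrPdist_lt => eps eps0; near=> x.
have x0 : 0 < x by near: x; exact: nbhs_pinfty_gt.
rewrite sub0r opprK ger0_norm; last by rewrite mulr_ge0 ?normal_pdf_ge0 ?ltW.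
set y := x ^+ 2 / (s ^+ 2 *+ 2).
have y0 : 0 < y by rewrite divr_gt0 ?exprn_gt0// mulrn_wgt0// exprn_gt0.
(* Bounding exp(- y) by 1 / y leaves x p(x) of order 1 / x. *)
have ey : expR (- y) <= y^-1.
  by rewrite expRN lef_pV2 ?posrE ?expR_gt0// (le_trans _ (expR_ge1Dx _))// lerDr.
apply: (@le_lt_trans _ _ (normal_peak s * (s ^+ 2 *+ 2) / x)).
  rewrite pE -/y.
  have -> : normal_peak s * (s ^+ 2 *+ 2) / x = x * (normal_peak s * y^-1).
    rewrite /y -mulr_natr; field.
    by rewrite s_neq0 gt_eqF.
  by rewrite ler_pM2l// ler_pM2l.
rewrite ltr_pdivrMr// -ltr_pdivrMl//.
near: x; apply: nbhs_pinfty_gt; exact: num_real.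
Unshelve. all: by end_near. Qed.

Let mp (A : set R) : measurable_fun A (fun x => (p x)%:E).
Proof.
by apply/measurable_funTS/measurable_EFinP; exact: measurable_normal_pdf.
Qed.

Let mq (A : set R) : measurable_fun A (fun x => (x ^+ 2 / s ^+ 2 * p x)%:E).
Proof.
apply/measurable_EFinP/measurable_funTS/measurable_funM; last exact: measurable_normal_pdf.
by apply: measurable_funM => //; exact: measurable_funX.
Qed.

Let mg (A : set R) : measurable_fun A (fun x => (g x)%:E).
Proof.
apply/measurable_EFinP/measurable_funTS; exact: continuous_measurable_fun.
Qed.

(** The term s p(s) is the boundary value - G(s). It occurs with the opposite role in
    [integral_head], so the two cancel when the pieces are added; the additive form avoids
    subtracting extended reals. *)
Let integral_tail :
  (\int[mu]_(x in `[s, +oo[) (x ^+ 2 / s ^+ 2 * p x)%:E =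
   (s * p s)%:E + \int[mu]_(x in `[s, +oo[) (p x)%:E)%E.
Proof.
have g0 x : x \in `[s, +oo[ -> 0 <= g x.
  rewrite in_itv/= andbT => sx; rewrite mulr_ge0 ?normal_pdf_ge0// subr_ge0.
  by rewrite ler_pdivlMr ?exprn_gt0// mul1r lerXn2r// nnegrE ?ltW// (lt_le_trans s_gt0).
have Ig : (\int[mu]_(x in `[s, +oo[) (g x)%:E = (s * p s)%:E)%E.
  rewrite (ge0_continuous_FTC2y _ _ cvg_G) ?sub0e ?oppeK//.
  - by rewrite -EFinN opprK.
  - by move=> x sx; apply: g0; rewrite in_itv/= sx.
  - exact: continuous_subspaceT.
  - by apply: cvg_at_right_filter; exact: continuous_G.
  - by move=> x _; rewrite derive1E; apply: derive_val.
rewrite -Ig -ge0_integralD//=.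
- by apply: eq_integral => x _; rewrite -EFinD /g; congr (_%:E); ring.
- exact: mg.
- by move=> x _; exact: normal_pdf_ge0.
- exact: mp.
Qed.

Let integral_head :
  (\int[mu]_(x in `[0%R, s]) (p x)%:E =
   (s * p s)%:E + \int[mu]_(x in `[0%R, s]) (x ^+ 2 / s ^+ 2 * p x)%:E)%E.
Proof.
have g0 x : x \in `[0, s] -> 0 <= - g x.
  rewrite in_itv/= => /andP[x0 sx]; rewrite oppr_ge0 mulr_le0_ge0 ?normal_pdf_ge0//.
  by rewrite subr_le0 ler_pdivrMr ?exprn_gt0// mul1r lerXn2r// nnegrE ltW.
have Ig : (\int[mu]_(x in `[0%R, s]) (- g x)%:E = (s * p s)%:E)%E.
  have cG : continuous (fun x => - G x).
    by move=> x; apply: cvgN; exact: continuous_G.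
  rewrite (@continuous_FTC2 _ (fun x => - g x) (fun x => - G x)) ?sub0e ?oppeK//.
  - by rewrite -EFinB /G !opprK mul0r subr0.
  - by apply: continuous_subspaceT => x; apply: cvgN; exact: continuous_g.
  - split.
    + by move=> x _; apply: derivableN; exact: derivable_G.
    + by apply: cvg_at_right_filter; exact: cG.
    + by apply: cvg_at_left_filter; exact: cG.
  - by move=> x _; rewrite derive1E deriveN//; congr (- _); apply: derive_val.
rewrite -Ig -ge0_integralD//=.
- by apply: eq_integral => x _; rewrite -EFinD /g; congr (_%:E); ring.
- by apply/measurable_EFinP/measurableT_comp => //; apply/measurable_EFinP; exact: mg.
- by move=> x _; rewrite lee_fin mulr_ge0 ?normal_pdf_ge0// divr_ge0 ?sqr_ge0.
- exact: mq.
Qed.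

Let itvE : `[0%R, +oo[%classic = `[0%R, s[ `|` `[s, +oo[ :> set R.
Proof. by rewrite -itv_bndbnd_setU// bnd_simp ltW. Qed.

Let integral_half (f : R -> \bar R) : measurable_fun setT f -> (forall x, 0 <= f x)%E ->
  (\int[mu]_(x in `[0%R, +oo[) f x =
   \int[mu]_(x in `[0%R, s]) f x + \int[mu]_(x in `[s, +oo[) f x)%E.
Proof.
move=> mf f0; rewrite itvE ge0_integral_setU//.
- by rewrite integral_itv_bndo_bndc//; exact: measurable_funTS.
- exact: measurable_funTS.
- apply/disj_setPS => x [/=]; rewrite !in_itv/= => /andP[_ xs]; rewrite andbT.
  by rewrite leNgt xs.
Qed.

Let q0 x : (0 <= (x ^+ 2 / s ^+ 2 * p x)%:E)%E.
Proof.
by rewrite lee_fin mulr_ge0 ?normal_pdf_ge0// divr_ge0 ?sqr_ge0.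
Qed.

Lemma normal_prob_sqr : (\int[nu]_x (x ^+ 2)%:E = (s ^+ 2)%:E)%E.
Proof.
rewrite ge0_integral_normal_prob; last 2 first.
- by move=> x; rewrite lee_fin sqr_ge0.
- by apply/measurable_EFinP; exact: measurable_funX.
transitivity (\int[mu]_x ((s ^+ 2)%:E * (x ^+ 2 / s ^+ 2 * p x)%:E))%E.
  apply: eq_integral => x _; rewrite -!EFinM; congr (_%:E).
  by field.
rewrite ge0_integralZl//; [|exact: mq|by rewrite lee_fin sqr_ge0].
rewrite (_ : integral _ _ _ = 1%E) ?mule1// -(integral_normal_pdf 0 s).
rewrite (@ge0_symfun_integralT _ (fun x => x ^+ 2 / s ^+ 2 * p x)); last 3 first.
- by move=> x; have := q0 x; rewrite lee_fin.
- move=> x; apply: cvgM; last exact: continuous_p.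
  by apply: cvgM; [exact: sqr_continuous|exact: cvg_cst].
- by move=> x /=; rewrite sqrrN normal_pdf_sym.
rewrite (@ge0_symfun_integralT _ p); last 3 first.
- by move=> x; exact: normal_pdf_ge0.
- exact: continuous_p.
- by move=> x /=; rewrite normal_pdf_sym.
congr (_ * _)%E; rewrite -set_itvcy !integral_half//.
- by rewrite integral_tail integral_head addeCA addeA.
- by move=> x; rewrite lee_fin normal_pdf_ge0.
Qed.

Lemma normal_prob_id_integrable : nu.-integrable setT (fun x => x%:E).
Proof.
have sq : nu.-integrable setT (fun x => (x ^+ 2)%:E).
  apply/integrableP; split.
    by apply/measurable_EFinP; exact: measurable_funX.
  under eq_integral do rewrite gee0_abs ?lee_fin ?sqr_ge0//.
  by rewrite normal_prob_sqr ltry.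
have c1 : nu.-integrable setT (EFin \o cst 1).
  exact: finite_measure_integrable_cst.
apply: (le_integrable measurableT _ _ (integrableD measurableT c1 sq)).
  by apply/measurable_EFinP; exact: measurable_id.
move=> x _ /=; rewrite lee_fin [leRHS]ger0_norm ?addr_ge0 ?sqr_ge0//.
by rewrite -(real_normK (num_real x)); have := sqr_ge0 (`|x| - 1); nra.
Qed.

Let normal_prob_sym (f : R -> \bar R) :
  measurable_fun setT f -> (forall x, 0 <= f x)%E ->
  (\int[nu]_x f x = \int[nu]_x f (- x)%R)%E.
Proof.
move=> mf f0; have mfN : measurable_fun setT (fun x : R => f (- x)).
  exact: measurableT_comp.
rewrite !ge0_integral_normal_prob//.
have mh : measurable_fun setT (fun x : R => f x * (p x)%:E)%E.
  exact: emeasurable_funM.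
transitivity (\int[pushforward mu (-%R : measurableTypeR R -> measurableTypeR R)]_x
   (f x * (p x)%:E))%E.
  by apply: eq_measure_integral => A mA _; exact/esym/lebesgue_measureN.
have mN : measurable_fun setT (-%R : measurableTypeR R -> measurableTypeR R).
  exact: oppr_measurable.
rewrite (ge0_integral_pushforward mN mu measurableT mh); last first.
  by move=> x _; rewrite mule_ge0// lee_fin normal_pdf_ge0.
by rewrite preimage_setT; apply: eq_integral => x _ /=; rewrite normal_pdf_sym.
Qed.

(** By symmetry the positive and the negative part of x have the same integral, and it is finite. *)
Lemma normal_prob_mean : (\int[nu]_x x%:E = 0)%E.
Proof.
rewrite integralE normal_prob_sym//; last exact: measurable_funepos.
rewrite (_ : integral _ _ _ = \int[nu]_x (fun x => x%:E)^\- x)%E; last first.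
  by apply: eq_integral => x _; rewrite funeposE funenegE EFinN.
rewrite subee//; apply: integrable_neg_fin_num => //.
exact: normal_prob_id_integrable.
Qed.

End normal_moments.

Section independence.
Context d (Omega : measurableType d) (R : realType) (P : probability Omega R).

(** As functions of A both sides are finite measures: P restricted to E, and P scaled by P(E). They
    agree on a pi-system, hence on the sigma-algebra it generates. *)
Lemma indep_pi_system (G : set (set Omega)) (E : set Omega) :
  measurable E -> G `<=` measurable -> setI_closed G -> G setT ->
  (forall A, G A -> P (A `&` E) = (P A * P E)%E) ->
  forall A, <<s G >> A -> P (A `&` E) = (P A * P E)%E.
Proof.
move=> mE Gm GI GT GE A sA.
have PE : (0 <= fine (P E))%R by rewrite fine_ge0.
have PEE : (fine (P E))%:E = P E by rewrite fineK ?fin_num_measure.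
pose m1 := mrestr P mE.
pose m2 := mscale (NngNum PE) P.
suff : m1 A = m2 A.
  by rewrite /m1 /m2 /mrestr /mscale/= PEE muleC.
apply: (g_sigma_algebra_measure_unique G Gm (fun=> setT)) => //.
- by rewrite bigcup_const.
- move=> B GB; rewrite /= /mrestr /mscale/= GE// PEE muleC//.
- move=> k; rewrite /= /mrestr setTI.
  by rewrite (le_lt_trans (probability_le1 _ _))// ltry.
Qed.

(** The joint law agrees with the product of the two laws on rectangles, hence everywhere. Tonelli
    then gives integrability of the product, and Fubini the value. *)
Lemma integrable_indep_mul (X Y : Omega -> R) :
  P.-integrable setT (EFin \o X) -> P.-integrable setT (EFin \o Y) ->
  (forall U V, measurable U -> measurable V ->
    P ((X @^-1` U) `&` (Y @^-1` V)) = (P (X @^-1` U) * P (Y @^-1` V))%E) ->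
  P.-integrable setT (fun w => (X w * Y w)%:E) /\
  (\int[P]_w (X w * Y w) = (\int[P]_w X w) * (\int[P]_w Y w))%R.
Proof.
move=> iX iY XY.
have /measurable_EFinP mX := measurable_int _ iX.
have /measurable_EFinP mY := measurable_int _ iY.
pose X' : {mfun Omega >-> R} := HB.pack X (isMeasurableFun.Build _ _ _ _ _ mX).
pose Y' : {mfun Omega >-> R} := HB.pack Y (isMeasurableFun.Build _ _ _ _ _ mY).
have mXY : measurable_fun setT (fun w => (X w, Y w)) by exact: measurable_fun_pair.
pose Z' : {mfun Omega >-> (R * R)%type} :=
  HB.pack (fun w => (X w, Y w)) (isMeasurableFun.Build _ _ _ _ _ mXY).
pose f (z : R * R) : \bar R := (z.1 * z.2)%:E.
have mf : measurable_fun setT f.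
  by apply/measurable_EFinP; exact: measurable_funM.
pose L := (distribution P X' \x distribution P Y')%E.
have LE A : measurable A -> L A = distribution P Z' A.
  move=> mA; apply: (@product_measure_unique _ _ _ _ _ (distribution P X')
    (distribution P Y') (distribution P Z')) => //.
have LI (h : R * R -> \bar R) :
    (\int[distribution P Z']_z h z = \int[distribution P X' \x distribution P Y']_z h z)%E.
  by apply: eq_measure_integral => A mA _; exact/esym/LE.
have iX' := iX; have iY' := iY.
move/integrableP: iX' => [_ iX']; move/integrableP: iY' => [_ iY'].
have iL : L.-integrable setT f.
  apply/integrable12ltyP => //=.
  have -> : (\int[distribution P X']_x \int[distribution P Y']_y `|f (x, y)| =
     \int[distribution P X']_x (`|x%:E| * \int[P]_w `|(Y w)%:E|))%E.
    apply: eq_integral => x _.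
    rewrite -(@ge0_integral_distribution _ _ _ _ _ P Y' (fun y => `|y%:E|)%E)//.
      by under eq_integral do rewrite /f/= normrM EFinM; rewrite ge0_integralZl//;
        apply: measurableT_comp => //; exact/measurable_EFinP.
    by apply: measurableT_comp => //; exact/measurable_EFinP.
  rewrite ge0_integralZr//; [|exact: measurableT_comp|exact: integral_ge0].
  rewrite ge0_integral_distribution//; last exact: measurableT_comp.
  have ge0X : (0 <= \int[P]_w `|(X w)%:E|)%E by exact: integral_ge0.
  apply: lte_mul_pinfty; [exact: ge0X| |exact: iY'].
  by rewrite ge0_fin_numE; [exact: iX'|exact: ge0X].
have fXY : f \o Z' = (fun w => (X w * Y w)%:E) by [].
have iXY : P.-integrable setT (fun w => (X w * Y w)%:E).
  rewrite -fXY; apply/integrableP; split; first exact: measurableT_comp.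
  move/integrableP: iL => [_]; apply: le_lt_trans.
  by rewrite -LI ge0_integral_distribution//; exact: measurableT_comp.
split => //.
rewrite /Rintegral -fineM ?integrable_fin_num//; congr fine.
rewrite -fXY -(integral_distribution mf)// LI -integral12_prod_meas1// /fubini_F.
have EX : (\int[P]_w (X w)%:E = \int[distribution P X']_x x%:E)%E.
  by rewrite integral_distribution//; exact/measurable_EFinP.
have EY : (\int[P]_w (Y w)%:E = \int[distribution P Y']_x x%:E)%E.
  by rewrite integral_distribution//; exact/measurable_EFinP.
have iYd : (distribution P Y').-integrable setT (fun y => y%:E).
  by apply: integrable_pushforward => //; exact/measurable_EFinP.
rewrite EX -(fineK (integrable_fin_num measurableT iY)) -integralZr//; last first.
  by apply: integrable_pushforward => //; exact/measurable_EFinP.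
apply: eq_integral => x _; rewrite /f.
under eq_integral do rewrite /= EFinM.
by rewrite integralZl// fineK ?EY// integrable_fin_num.
Qed.

End independence.

Section measurable_wrt_theory.
Context (R : realType) (dO : measure_display) (Omega : measurableType dO).
Context (G : set (set Omega)).
Implicit Types f g : Omega -> R.

Lemma measurable_wrtE f :
  measurable_wrt <<s G >> f <-> measurable_fun setT (f : g_sigma_algebraType G -> R).
Proof.
split=> [mf _ U mU|mf U mU]; first by rewrite setTI; exact: mf.
by rewrite -[X in <<s _ >> X]setTI; exact: mf.
Qed.

Lemma measurable_wrt_cst c : measurable_wrt <<s G >> (fun=> c : R).
Proof. by apply/measurable_wrtE; exact: measurable_cst. Qed.

Lemma measurable_wrtD f g : measurable_wrt <<s G >> f -> measurable_wrt <<s G >> g ->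
  measurable_wrt <<s G >> (fun w => f w + g w).
Proof.
move=> /measurable_wrtE mf /measurable_wrtE mg.
by apply/measurable_wrtE; exact: measurable_funD.
Qed.

Lemma measurable_wrtM f g : measurable_wrt <<s G >> f -> measurable_wrt <<s G >> g ->
  measurable_wrt <<s G >> (fun w => f w * g w).
Proof.
move=> /measurable_wrtE mf /measurable_wrtE mg.
by apply/measurable_wrtE; exact: measurable_funM.
Qed.

Lemma measurable_wrtB f g : measurable_wrt <<s G >> f -> measurable_wrt <<s G >> g ->
  measurable_wrt <<s G >> (fun w => f w - g w).
Proof.
move=> /measurable_wrtE mf /measurable_wrtE mg.
by apply/measurable_wrtE; exact: measurable_funB.
Qed.

Lemma measurable_wrt_sum (I : Type) (s : seq I) (f : I -> Omega -> R) :
  (forall i, measurable_wrt <<s G >> (f i)) ->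
  measurable_wrt <<s G >> (fun w => \sum_(i <- s) f i w).
Proof.
move=> mf; elim: s => [|i s ih].
  by under eq_fun do rewrite big_nil; exact: measurable_wrt_cst.
by under eq_fun do rewrite big_cons; exact: measurable_wrtD.
Qed.

(** The preimages under f and g differ within a null set, every subset of which is a generator. It
    serves to rebuild B from its increments, since B_0 = 0 holds only almost surely. *)
Lemma measurable_wrt_ae (P : probability Omega R) f g :
  (forall A, P.-negligible A -> G A) ->
  measurable_wrt <<s G >> f -> {ae P, forall w, f w = g w} ->
  measurable_wrt <<s G >> g.
Proof.
move=> NG mf fg U mU.
pose N := ~` [set w | f w = g w].
have sN A : P.-negligible A -> <<s G >> A by move=> /NG; exact: sub_sigma_algebra.
have -> : g @^-1` U = ((f @^-1` U) `\` N) `|` ((g @^-1` U) `&` N).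
  apply/seteqP; split=> w /=.
    have [fgw|fgw] := pselect (f w = g w) => Ug; [left|right] => //.
    by split; [rewrite /= fgw|move=> /(_ fgw)].
  by move=> [[Uf /contrapT <-]|[]].
have sA : sigma_algebra setT <<s G >> by exact: smallest_sigma_algebra.
pose T' := g_sigma_algebraType G.
apply: (@measurableU _ T'); last first.
  by apply: sN; apply: negligibleS fg; exact: subIsetr.
by apply: (@measurableD _ T'); [exact: mf|exact: sN].
Qed.

End measurable_wrt_theory.

Lemma measurable_wrtS (R : realType) (dO : measure_display) (Omega : measurableType dO)
    (F G : set (set Omega)) (f : Omega -> R) :
  F `<=` G -> measurable_wrt F f -> measurable_wrt G f.
Proof. by move=> FG mf U mU; exact/FG/mf. Qed.

(** * Independence of increments from the augmented filtration *)

Section brownian_filtration.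
Context (R : realType) (T : R) (d : nat).
Context (dO : measure_display) (Omega : measurableType dO).
Context (P : probability Omega R) (P_complete : measure_is_complete P).
Context (B : R -> Omega -> realpow R 'I_d) (B_bm : brownian_motion P T B).

Notation F := (augmented_filtration P B).

Lemma brownian_measurable t k : 0 <= t <= T -> measurable_fun setT (fun w => B t w k).
Proof. by case: B_bm => mB _ _ _ _ tT; apply: mB; rewrite in_itv. Qed.

(** Completeness makes the negligible generators measurable. *)
Lemma augmented_filtration_measurable t : t <= T -> F t `<=` measurable.
Proof.
move=> tT; apply: smallest_sub; first exact: sigma_algebra_measurable.
move=> A [|]; last exact: P_complete.
move=> [s [k [U [+ mU ->]]]]; rewrite in_itv/= => /andP[s0 st].
rewrite -[X in measurable X]setTI; apply: brownian_measurable => //.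
by rewrite s0 (le_trans st).
Qed.

Lemma augmented_filtration_mono s t : s <= t -> F s `<=` F t.
Proof.
move=> st; apply: smallest_sub; first exact: smallest_sigma_algebra.
move=> A GA; apply: sub_sigma_algebra; case: GA => [|nA]; last by right.
move=> [q [k [U [+ mU ->]]]]; rewrite in_itv/= => /andP[q0 qs].
by left; exists q, k, U; split => //; rewrite in_itv/= q0 (le_trans qs).
Qed.

Lemma brownian_adapted s t k : 0 <= s <= t -> measurable_wrt (F t) (fun w => B s w k).
Proof.
move=> st U mU; apply: sub_sigma_algebra; left; exists s, k, U; split => //.
Qed.

Lemma adapted_measurable t f : t <= T -> measurable_wrt (F t) f ->
  measurable_fun setT (f : Omega -> R).
Proof.
move=> tT mf _ U mU; rewrite setTI.
by apply: (augmented_filtration_measurable tT); exact: mf.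
Qed.

Let incr (t : nat -> R) (j : nat) (k : 'I_d) (w : Omega) : R :=
  B (t j.+1) w k - B (t j) w k.

Let rect (t : nat -> R) (n : nat) (U : nat -> 'I_d -> set R) : set Omega :=
  [set w | forall j k, (j < n)%N -> U j k (incr t j k w)].

Let last_incr (s c : R) (V : 'I_d -> set R) : set Omega :=
  [set w | forall k, V k (B c w k - B s w k)].

(** Padded with full sets, the two events and their intersection are all of the form covered by
    mutual independence of the (n + 1) d increments, and the three products match factor by
    factor. *)
Lemma rect_last_incr_indep (n : nat) (t : nat -> R) U V :
  0 <= t 0%N -> t n.+1 <= T -> (forall j, (j < n.+1)%N -> t j < t j.+1) ->
  (forall j k, measurable (U j k)) -> (forall k, measurable (V k)) ->
  P (rect t n U `&` last_incr (t n) (t n.+1) V) =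
  (P (rect t n U) * P (last_incr (t n) (t n.+1) V))%E.
Proof.
move=> t0 tT tlt mU mV; case: B_bm => _ _ _ /(_ n.+1 t t0 tT tlt) ind _.
pose W1 (jk : 'I_n.+1 * 'I_d) := if (jk.1 < n)%N then U jk.1 jk.2 else setT.
pose W2 (jk : 'I_n.+1 * 'I_d) := if (jk.1 < n)%N then setT else V jk.2.
have mW1 jk : measurable (W1 jk) by rewrite /W1; case: ifP.
have mW2 jk : measurable (W2 jk) by rewrite /W2; case: ifP.
have mW jk : measurable (W1 jk `&` W2 jk) by exact: measurableI.
have E1 : rect t n U = [set w | forall jk : 'I_n.+1 * 'I_d, W1 jk (incr t jk.1 jk.2 w)].
  apply/seteqP; split=> w /= h.
    by move=> [j k]; rewrite /W1/=; case: ifP => // jn; exact: h.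
  move=> j k jn; have := h (Ordinal (ltnW jn : (j < n.+1)%N), k).
  by rewrite /W1/= jn.
have E2 : last_incr (t n) (t n.+1) V =
    [set w | forall jk : 'I_n.+1 * 'I_d, W2 jk (incr t jk.1 jk.2 w)].
  apply/seteqP; split=> w /= h.
    move=> [j k]; rewrite /W2/=; case: ifPn => //; rewrite -leqNgt => nj.
    suff -> : nat_of_ord j = n by exact: h.
    by apply/eqP; rewrite eqn_leq nj -ltnS ltn_ord.
  by move=> k; have := h (ord_max, k); rewrite /W2/= ltnn.
have E12 : rect t n U `&` last_incr (t n) (t n.+1) V =
    [set w | forall jk : 'I_n.+1 * 'I_d, (W1 jk `&` W2 jk) (incr t jk.1 jk.2 w)].
  rewrite E1 E2; apply/seteqP; split=> w /=.
    by move=> [h1 h2] jk; split.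
  by move=> h; split=> jk; have [] := h jk.
rewrite E12 E1 E2.
rewrite (ind _ mW) (ind _ mW1) (ind _ mW2) -big_split/=; apply: eq_bigr => jk _.
rewrite /W1 /W2; case: ifP => _.
  by rewrite setIT preimage_setT probability_setT mule1.
by rewrite setTI preimage_setT probability_setT mul1e.
Qed.

(** Events on the first n increments form a pi-system. The null sets are adjoined so that it also
    generates the values of B at the points of the subdivision. *)
Let rect_or_null (t : nat -> R) (n : nat) : set (set Omega) :=
  [set A | (exists2 U, forall j k, measurable (U j k) & A = rect t n U) \/
           P.-negligible A].

Let measurable_rect (n : nat) (t : nat -> R) U :
  (forall j, (j <= n)%N -> 0 <= t j <= T) ->
  (forall j k, measurable (U j k)) -> measurable (rect t n U).
Proof.
move=> tT mU.
have -> : rect t n U =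
    \bigcap_(j in `I_n) \bigcap_(k in [set: 'I_d]) ((incr t j k) @^-1` U j k).
  by apply/seteqP; split=> w h j => [jn k _|k jn]; exact: h.
apply: bigcap_measurableType => j jn; apply: fin_bigcap_measurable => // k _.
rewrite -[X in measurable X]setTI; apply: measurable_funB => //.
- by apply: brownian_measurable; exact: tT.
- by apply: brownian_measurable; apply: tT; exact: ltnW.
Qed.

Let measurable_last_incr s c V : 0 <= s <= T -> 0 <= c <= T ->
  (forall k, measurable (V k)) -> measurable (last_incr s c V).
Proof.
move=> sT cT mV.
have -> : last_incr s c V =
    \bigcap_(k in [set: 'I_d]) ((fun w => B c w k - B s w k) @^-1` V k).
  by apply/seteqP; split=> w h k => [_|]; exact: h.
apply: fin_bigcap_measurable => // k _.
by rewrite -[X in measurable X]setTI; apply: measurable_funB => //;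
  exact: brownian_measurable.
Qed.

Let subdivision_le (n : nat) (t : nat -> R) :
  (forall j, (j < n)%N -> t j < t j.+1) -> forall i j, (i <= j <= n)%N -> t i <= t j.
Proof.
move=> tlt i; elim=> [|j ih] /andP[]; first by rewrite leqn0 => /eqP ->.
rewrite leq_eqVlt => /predU1P[->//|ij jn].
by rewrite (le_trans (ih _)) ?ltW ?tlt//; rewrite -ltnS ij ltnW.
Qed.

Let subdivision_indep (n : nat) (t : nat -> R) V :
  0 <= t 0%N -> t n.+1 <= T -> (forall j, (j < n.+1)%N -> t j < t j.+1) ->
  (forall k, measurable (V k)) -> forall A, <<s rect_or_null t n >> A ->
  P (A `&` last_incr (t n) (t n.+1) V) =
  (P A * P (last_incr (t n) (t n.+1) V))%E.
Proof.
move=> t0 tT tlt mV.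
have tb j : (j <= n.+1)%N -> 0 <= t j <= T.
  move=> jn; rewrite (le_trans t0) ?(subdivision_le tlt)//=.
  by rewrite (le_trans _ tT)// (subdivision_le tlt)// jn leqnn.
apply: indep_pi_system.
- by apply: measurable_last_incr => //; exact: tb.
- move=> A [[U mU ->]|/P_complete//].
  by apply: measurable_rect => // j jn; apply: tb; exact: leqW.
- move=> A A' [[U mU ->]|nA] [[U' mU' ->]|nA']; last 3 first.
  + by right; apply: negligibleS nA'; exact: subIsetr.
  + by right; apply: negligibleS nA; exact: subIsetl.
  + by right; apply: negligibleS nA; exact: subIsetl.
  left; exists (fun j k => U j k `&` U' j k) => [j k|]; first exact: measurableI.
  apply/seteqP; split=> w; first by move=> [h1 h2] j k jn; split; [exact: h1|exact: h2].
  by move=> h; split=> j k jn; have [] := h j k jn.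
- by left; exists (fun _ _ => setT) => //; apply/seteqP; split.
- move=> A [[U mU ->]|nA]; first exact: rect_last_incr_indep.
  have PA := measure_negligible (P_complete nA) nA.
  rewrite [LHS]measure_negligible.
  + by rewrite [P A]PA mul0e.
  + apply: measurableI; first exact: P_complete.
    by apply: measurable_last_incr => //; exact: tb.
  + by apply: negligibleS nA; exact: subIsetl.
Qed.

(** Almost surely B at t_j is the sum of the first j increments, as t_0 = 0 and B_0 = 0. *)
Let brownian_subdivision (n : nat) (t : nat -> R) j k :
  t 0%N = 0 -> (j <= n)%N ->
  measurable_wrt <<s rect_or_null t n >> (fun w => B (t j) w k).
Proof.
move=> t0 jn.
apply: (@measurable_wrt_ae _ _ _ _ P
    (fun w => \sum_(i < n) (if (i < j)%N then incr t i k w else 0))).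
- by move=> A nA; right.
- apply: measurable_wrt_sum => i; case: (i < j)%N; last exact: measurable_wrt_cst.
  move=> U mU; apply: sub_sigma_algebra; left.
  exists (fun j' k' => if (j' == i :> nat) && (k' == k) then U else setT).
    by move=> j' k'; case: ifP.
  apply/seteqP; split=> w h.
    by move=> j' k' _; case: ifP => // /andP[/eqP -> /eqP ->].
  by have := h i k (ltn_ord i); rewrite !eqxx.
- case: B_bm => _ B0 _ _ _; apply: filterS B0 => w B0.
  have -> : B (t j) w k = B (t j) w k - B (t 0%N) w k by rewrite t0 B0 subr0.
  rewrite -(telescope_sumr (fun i => B (t i) w k)) // big_mkord.
  by rewrite -big_mkcond/= (big_ord_narrow jn).
Qed.

Let time_gen (ts : seq R) : set (set Omega) :=
  [set A | (exists q k (U : set R), [/\ q \in ts, measurable U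
              & A = [set w | U (B q w k)]]) \/ P.-negligible A].

(** Sorting the times yields a subdivision whose last step is the increment from s to c. *)
Let time_indep (ts : seq R) s c V : (forall q, q \in ts -> 0 <= q <= s) ->
  0 <= s -> s < c -> c <= T -> (forall k, measurable (V k)) ->
  forall A, <<s time_gen ts >> A ->
  P (A `&` last_incr s c V) = (P A * P (last_incr s c V))%E.
Proof.
move=> tss s0 sc cT mV A sA.
(* With 0 and s adjoined the subdivision starts where B vanishes and has s as its last point. *)
pose l := sort <=%R (undup [:: 0, s & ts]).
have lmem q : q \in l = (q \in [:: 0, s & ts]) by rewrite mem_sort mem_undup.
have lb q : q \in l -> 0 <= q <= s.
  rewrite lmem !inE => /or3P[/eqP ->|/eqP ->|/tss//]; first by rewrite lexx.
  by rewrite s0 lexx.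
have lsorted : sorted <%R l.
  by rewrite lt_sorted_uniq_le sort_uniq undup_uniq sort_le_sorted.
(* The default value c is also the endpoint of the last step: t (n + 1) falls beyond the list. *)
pose t j := nth c l j.
pose n := (size l).-1.
have l0 : 0 \in l by rewrite lmem inE eqxx.
have ls : s \in l by rewrite lmem !inE eqxx orbT.
have szl : (size l = n.+1)%N by rewrite /n prednK//; case: (l) l0.
have tn1 : t n.+1 = c by rewrite /t nth_default// szl.
have tin j : (j <= n)%N -> t j \in l by move=> jn; rewrite mem_nth// szl.
have tlt j : (j < n.+1)%N -> t j < t j.+1.
  rewrite ltnS leq_eqVlt => /predU1P[->|jn].
    by rewrite tn1 (le_lt_trans _ sc)//; have /lb/andP[] := tin n (leqnn _).
  apply: (sorted_ltn_nth lt_trans c lsorted); rewrite ?inE ?szl//.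
  by rewrite ltnW.
have tidx q : q \in l -> exists2 j, (j <= n)%N & q = t j.
  by move=> ql; exists (index q l); rewrite ?/t ?nth_index// -ltnS -szl index_mem.
have t0 : t 0%N = 0.
  have [j jn tj] := tidx _ l0; apply/eqP; rewrite eq_le.
  have /lb/andP[-> _] := tin 0%N isT; rewrite andbT [leRHS]tj.
  by apply: (subdivision_le tlt); rewrite /= leqW.
have tn : t n = s.
  have [j jn tj] := tidx _ ls; apply/eqP; rewrite eq_le.
  have /lb/andP[_ ->] := tin n (leqnn n); rewrite [leLHS]tj.
  by apply: (subdivision_le tlt); rewrite jn leqnSn.
have := @subdivision_indep n t V; rewrite t0 tn tn1; apply => //.
move: A sA; apply: smallest_sub; first exact: smallest_sigma_algebra.
move=> A [|nA]; last by apply: sub_sigma_algebra; right.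
move=> [q [k [U [qts mU ->]]]].
have [j jn ->] : exists2 j, (j <= n)%N & q = t j.
  by apply: tidx; rewrite lmem !inE qts !orbT.
exact: brownian_subdivision.
Qed.

(** All coordinates of the increment are constrained at once, since the isometry involves products
    of two different coordinates. *)
Lemma augmented_filtration_indep (s c : R) (V : 'I_d -> set R) A : 0 <= s -> s < c -> c <= T ->
  (forall k, measurable (V k)) -> F s A ->
  P (A `&` [set w | forall k, V k (B c w k - B s w k)]) =
  (P A * P [set w | forall k, V k (B c w k - B s w k)%R])%E.
Proof.
move=> s0 sc cT mV FA.
have sT : s <= T by rewrite (le_trans (ltW sc)).
have FsT := augmented_filtration_measurable sT.
(* Events depending on finitely many times, together with the null sets, form a
   pi-system that generates [F s]. *)
pose G : set (set Omega) := [set A | exists2 ts : seq R,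
  forall q, q \in ts -> 0 <= q <= s & <<s time_gen ts >> A].
have time_genS ts : (forall q, q \in ts -> 0 <= q <= s) ->
    <<s time_gen ts >> `<=` F s.
  move=> tss; apply: smallest_sub; first exact: smallest_sigma_algebra.
  move=> C [|nC]; last by apply: sub_sigma_algebra; right.
  move=> [q [k [U [/tss qs mU ->]]]].
  by apply: sub_sigma_algebra; left; exists q, k, U; split => //; rewrite in_itv.
apply: (@indep_pi_system _ _ _ P G).
- by apply: measurable_last_incr => //; rewrite ?s0// (le_trans s0 (ltW sc)).
- by move=> C [ts tss sC]; apply: FsT; exact: time_genS sC.
- move=> C C' [ts tss sC] [ts' tss' sC']; exists (ts ++ ts').
    by move=> q; rewrite mem_cat => /orP[/tss|/tss'].
  apply: (@measurableI _ (g_sigma_algebraType (time_gen (ts ++ ts')))).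
    move: sC; apply: sub_smallest2r; first exact: smallest_sigma_algebra.
    move=> D [|]; last by right.
    by move=> [q [k [U [qts mU ->]]]]; left; exists q, k, U; rewrite mem_cat qts.
  move: sC'; apply: sub_smallest2r; first exact: smallest_sigma_algebra.
    move=> D [|]; last by right.
  by move=> [q [k [U [qts mU ->]]]]; left; exists q, k, U; rewrite mem_cat qts orbT.
- by exists [::] => //; exact: (@measurableT _ (g_sigma_algebraType (time_gen [::]))).
- by move=> C [ts tss sC]; exact: time_indep sC.
- move: A FA; apply: sub_smallest2r; first exact: smallest_sigma_algebra.
  move=> C [|nC].
    move=> [q [k [U [+ mU ->]]]]; rewrite in_itv/= => qs.
    exists [:: q]; first by move=> r; rewrite inE => /eqP ->.
    by apply: sub_sigma_algebra; left; exists q, k, U; rewrite inE eqxx.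
  by exists [::] => //; apply: sub_sigma_algebra; right.
Qed.

End brownian_filtration.

(** * The Ito isometry *)

Section brownian_moments.
Context (R : realType) (T : R) (d : nat).
Context (dO : measure_display) (Omega : measurableType dO).
Context (P : probability Omega R) (P_complete : measure_is_complete P).
Context (B : R -> Omega -> realpow R 'I_d) (B_bm : brownian_motion P T B).

Notation F := (augmented_filtration P B).
Notation D s c k := (fun w => B c w k - B s w k).

Let measurable_D s c k : 0 <= s <= T -> 0 <= c <= T -> measurable_fun setT (D s c k).
Proof. by move=> sT cT; apply: measurable_funB; exact: (brownian_measurable B_bm). Qed.

Lemma sqint_cst (c : R) : sqint P (fun=> c).
Proof.
split; first exact: measurable_cst.
rewrite (_ : integral _ _ _ = (c ^+ 2)%:E * P setT)%E; last exact: integral_cst.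
by rewrite [P setT]probability_setT mule1 ltry.
Qed.

Lemma sqint_integrable (X : Omega -> R) : sqint P X -> P.-integrable setT (EFin \o X).
Proof.
move=> sX; have := sqint_mul sX (sqint_cst 1).
by under eq_fun do rewrite mulr1.
Qed.

Lemma sqint_boundedM (M : R) (X Y : Omega -> R) : measurable_fun setT X ->
  (forall w, `|X w| <= M) -> sqint P Y -> sqint P (fun w => X w * Y w).
Proof.
move=> mX XM sY; have [mY _] := sY.
apply: (@le_sqint _ _ _ _ _ (fun w => M * Y w)); last 2 first.
- exact: sqintZ.
- by move=> w; rewrite !normrM ler_wpM2r// (le_trans (XM w))// ler_norm.
exact: measurable_funM.
Qed.

Lemma sqint_bounded (M : R) (X : Omega -> R) : measurable_fun setT X ->
  (forall w, `|X w| <= M) -> sqint P X.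
Proof.
move=> mX XM; have := sqint_boundedM mX XM (sqint_cst 1).
by under eq_fun do rewrite mulr1.
Qed.

Let law_D s c k (f : R -> \bar R) : 0 <= s -> s < c -> c <= T ->
  measurable_fun setT f -> (forall x, 0 <= f x)%E ->
  (\int[P]_w f (D s c k w) = \int[normal_prob 0 (Num.sqrt (c - s))]_x f x)%E.
Proof.
move=> s0 sc cT mf f0.
have mD : measurable_fun setT (D s c k).
  by apply: measurable_D; rewrite ?s0 ?(le_trans (ltW sc))// (le_trans s0 (ltW sc)).
pose D' : {mfun Omega >-> measurableTypeR R} :=
  HB.pack (D s c k : Omega -> measurableTypeR R)
    (isMeasurableFun.Build _ _ _ (measurableTypeR R) _ mD).
transitivity (\int[distribution P D']_x f x)%E.
  by rewrite ge0_integral_distribution.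
apply: eq_measure_integral => A mA _; case: B_bm => _ _ _ _ law.
exact: law s0 sc cT mA.
Qed.

Lemma brownian_increment_sqr s c k : 0 <= s -> s <= c -> c <= T ->
  (\int[P]_w ((D s c k w) ^+ 2)%:E = (c - s)%:E)%E.
Proof.
move=> s0; rewrite le_eqVlt => /predU1P[->|sc] cT.
  under eq_integral do rewrite subrr expr0n/=.
  by rewrite integral0 subrr.
rewrite (@law_D s c k (fun x => (x ^+ 2)%:E))//.
- by rewrite normal_prob_sqr ?sqrtr_gt0 ?subr_gt0// sqr_sqrtr// subr_ge0 ltW.
- by apply/measurable_EFinP; exact: measurable_funX.
- by move=> x; rewrite lee_fin sqr_ge0.
Qed.

Lemma sqint_brownian_increment s c k : 0 <= s -> s <= c -> c <= T -> sqint P (D s c k).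
Proof.
move=> s0 sc cT; split; last by rewrite brownian_increment_sqr// ltry.
by apply: measurable_D; rewrite ?s0 ?(le_trans sc)// (le_trans s0 sc).
Qed.

Lemma brownian_increment_mean s c k : 0 <= s -> s <= c -> c <= T ->
  \int[P]_w (D s c k w) = 0.
Proof.
move=> s0; rewrite le_eqVlt => /predU1P[->|sc] cT.
  by rewrite /Rintegral; under eq_integral do rewrite subrr; rewrite integral0.
have iD := sqint_integrable (sqint_brownian_increment k s0 (ltW sc) cT).
have sg : 0 < Num.sqrt (c - s) by rewrite sqrtr_gt0 subr_gt0.
rewrite /Rintegral integralE.
rewrite (_ : integral _ _ _ =
    \int[normal_prob 0 (Num.sqrt (c - s))]_x (fun x : R => x%:E)^\+ x)%E; last first.
  rewrite -(@law_D s c k (fun x : R => (fun x => x%:E)^\+ x)%E)//.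
    by apply: eq_integral => w _; rewrite !funeposE.
  by apply: measurable_funepos; exact/measurable_EFinP.
rewrite (_ : (\int[_]_(x in _) (EFin \o _)^\- x =
    \int[normal_prob 0 (Num.sqrt (c - s))]_x (fun x : R => x%:E)^\- x)%E); last first.
  rewrite -(@law_D s c k (fun x : R => (fun x => x%:E)^\- x)%E)//.
    by apply: eq_integral => w _; rewrite !funenegE.
  by apply: measurable_funeneg; exact/measurable_EFinP.
by rewrite -integralE normal_prob_mean.
Qed.

Let indep1 s c k A U : 0 <= s -> s < c -> c <= T -> F s A -> measurable U ->
  P (A `&` (D s c k) @^-1` U) = (P A * P ((D s c k) @^-1` U))%E.
Proof.
move=> s0 sc cT FA mU.
pose V k' := if k' == k then U else setT.
have := augmented_filtration_indep P_complete B_bm (V := V) s0 sc cT _ FA.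
have -> : [set w | forall k', V k' (B c w k' - B s w k')] = (D s c k) @^-1` U.
  apply/seteqP; split=> w h; first by have := h k; rewrite /V eqxx.
  by move=> k'; rewrite /V; case: eqP => // ->.
by apply => k'; rewrite /V; case: ifP.
Qed.

Let indep_coord s c k l U V : k != l -> 0 <= s -> s < c -> c <= T ->
  measurable U -> measurable V ->
  P ((D s c k) @^-1` U `&` (D s c l) @^-1` V) =
  (P ((D s c k) @^-1` U) * P ((D s c l) @^-1` V))%E.
Proof.
move=> kl s0 sc cT mU mV.
(* The subdivision with the single step from s to c. *)
pose t (j : nat) := if j is 0%N then s else c.
case: B_bm => _ _ _ /(_ 1%N t s0 cT) ind _.
have {}ind := ind _.
pose W1 (jk : 'I_1 * 'I_d) := if jk.2 == k then U else setT.
pose W2 (jk : 'I_1 * 'I_d) := if jk.2 == l then V else setT.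
have mW1 jk : measurable (W1 jk) by rewrite /W1; case: ifP.
have mW2 jk : measurable (W2 jk) by rewrite /W2; case: ifP.
have mW jk : measurable (W1 jk `&` W2 jk) by exact: measurableI.
have E1 : (D s c k) @^-1` U =
    [set w | forall jk : 'I_1 * 'I_d, W1 jk (B (t jk.1.+1) w jk.2 - B (t jk.1) w jk.2)].
  apply/seteqP; split=> w /= h.
    by move=> [j k']; rewrite /W1/= ord1; case: eqP => // ->.
  by have := h (ord0, k); rewrite /W1/= eqxx.
have E2 : (D s c l) @^-1` V =
    [set w | forall jk : 'I_1 * 'I_d, W2 jk (B (t jk.1.+1) w jk.2 - B (t jk.1) w jk.2)].
  apply/seteqP; split=> w /= h.
    by move=> [j k']; rewrite /W2/= ord1; case: eqP => // ->.
  by have := h (ord0, l); rewrite /W2/= eqxx.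
have E12 : (D s c k) @^-1` U `&` (D s c l) @^-1` V =
    [set w | forall jk : 'I_1 * 'I_d,
      (W1 jk `&` W2 jk) (B (t jk.1.+1) w jk.2 - B (t jk.1) w jk.2)].
  rewrite E1 E2; apply/seteqP; split=> w /=.
    by move=> [h1 h2] jk; split.
  by move=> h; split=> jk; have [] := h jk.
have tlt j : (j < 1)%N -> t j < t j.+1 by case: j.
rewrite E12 E1 E2 (ind tlt _ mW) (ind tlt _ mW1) (ind tlt _ mW2) -big_split/=.
apply: eq_bigr => -[j k'] _; rewrite /W1 /W2/=.
have [->|k'k] := eqVneq k' k.
  by rewrite (negbTE kl) setIT preimage_setT probability_setT mule1.
by rewrite setTI preimage_setT probability_setT mul1e.
Qed.

(** Independence of the vector increment from F_s, combined with that of its coordinates, lets the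
    k-th coordinate be counted as part of the past when the l-th one is integrated. *)
Let indep2 s c k l A U V : k != l -> 0 <= s -> s < c -> c <= T -> F s A ->
  measurable U -> measurable V ->
  P ((A `&` (D s c k) @^-1` U) `&` (D s c l) @^-1` V) =
  (P (A `&` (D s c k) @^-1` U) * P ((D s c l) @^-1` V))%E.
Proof.
move=> kl s0 sc cT FA mU mV.
pose W k' := if k' == k then U else if k' == l then V else setT.
have := augmented_filtration_indep P_complete B_bm (V := W) s0 sc cT _ FA.
have -> : [set w | forall k', W k' (B c w k' - B s w k')] =
    (D s c k) @^-1` U `&` (D s c l) @^-1` V.
  apply/seteqP; split=> w /= h.
    split; first by have := h k; rewrite /W eqxx.
    by have := h l; rewrite /W eq_sym (negbTE kl) eqxx.
  case: h => h1 h2 k'; rewrite /W; case: eqP => [->//|_].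
  by case: eqP => [->|].
rewrite -setIA => -> => [|k']; last by rewrite /W; case: ifP => // _; case: ifP.
by rewrite (indep_coord kl s0 sc cT mU mV) (indep1 k s0 sc cT FA mU) muleA.
Qed.

Lemma adapted_increment_ip s c k (X : Omega -> R) : 0 <= s -> s <= c -> c <= T ->
  measurable_wrt (F s) X -> sqint P X -> ip P X (D s c k) = 0.
Proof.
move=> s0; rewrite le_eqVlt => /predU1P[->|sc] cT FX sX.
  by rewrite ipC; under [X in ip _ X]eq_fun do rewrite subrr; rewrite ip0l.
have sD := sqint_brownian_increment k s0 (ltW sc) cT.
rewrite /ip (integrable_indep_mul (sqint_integrable sX) (sqint_integrable sD) _).2.
  by rewrite brownian_increment_mean ?mulr0// ltW.
by move=> U V mU mV; apply: indep1 => //; exact: FX.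
Qed.

(** If k = l, then X is independent of the squared increment, whose mean is c - s. If not, X times
    the k-th increment is independent of the l-th one, which has mean 0. Boundedness of X keeps the
    product square-integrable. *)
Lemma adapted_increment_ip2 s c k l (X : Omega -> R) (M : R) :
  0 <= s -> s <= c -> c <= T ->
  measurable_wrt (F s) X -> (forall w, `|X w| <= M) ->
  ip P (fun w => X w * D s c k w) (D s c l) = (k == l)%:R * (c - s) * \int[P]_w X w.
Proof.
move=> s0; rewrite le_eqVlt => /predU1P[->|sc] cT FX XM.
  under [X in ip _ X]eq_fun do rewrite subrr mulr0.
  by rewrite ip0l subrr mulr0 mul0r.
have sT : s <= T by rewrite (le_trans (ltW sc)).
have mX := adapted_measurable P_complete B_bm sT FX.
have sX := sqint_bounded mX XM.
have sD m := sqint_brownian_increment m s0 (ltW sc) cT.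
have [<-|kl] := eqVneq k l.
  rewrite mul1r /ip.
  under eq_Rintegral do rewrite -mulrA -expr2.
  rewrite (integrable_indep_mul (sqint_integrable sX) (sqint_sqr (sD k)) _).2.
    by rewrite mulrC; congr (_ * _); rewrite /Rintegral brownian_increment_sqr// ltW.
  move=> U V mU mV.
  apply: (@indep1 s c k (X @^-1` U) ((fun x => x ^+ 2) @^-1` V)) => //.
    exact: FX.
  by rewrite -[X in measurable X]setTI; exact: measurable_funX.
rewrite mul0r mul0r /ip.
have sXD := sqint_boundedM mX XM (sD k).
rewrite (integrable_indep_mul (sqint_integrable sXD) (sqint_integrable (sD l)) _).2.
  by rewrite (brownian_increment_mean l)// ?mulr0// ltW.
move=> U V mU mV.
(* A pi-system generating the information in F_s and in the k-th increment, with respect to which X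
   times that increment is measurable. *)
pose G := [set C | exists A W, [/\ F s A, measurable W & C = A `&` (D s c k) @^-1` W]].
have mD : measurable_fun setT (D s c k) by case: (sD k).
have FT : F s setT by exact: (@measurableT _ (g_sigma_algebraType _)).
have GX : measurable_wrt <<s G >> (fun w => X w * D s c k w).
  apply: measurable_wrtM.
    move=> W mW; apply: sub_sigma_algebra; exists (X @^-1` W), setT; split => //.
      exact: FX.
    by rewrite preimage_setT setIT.
  move=> W mW; apply: sub_sigma_algebra; exists setT, W; split => //.
  by rewrite setTI.
apply: (@indep_pi_system _ _ _ P G); last exact: GX.
- by rewrite -[X in measurable X]setTI; case: (sD l) => + _; apply.
- move=> _ [A [W [FA mW ->]]]; apply: measurableI.
    exact: (augmented_filtration_measurable P_complete B_bm sT).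
  by rewrite -[X in measurable X]setTI; exact: mD.
- move=> _ _ [A [W [FA mW ->]]] [A' [W' [FA' mW' ->]]].
  exists (A `&` A'), (W `&` W'); split.
  + exact: (@measurableI _ (g_sigma_algebraType _)).
  + exact: measurableI.
  + by rewrite preimage_setI setIACA.
- by exists setT, setT; split => //; rewrite preimage_setT setIT.
- by move=> _ [A [W [FA mW ->]]]; exact: indep2.
Qed.

End brownian_moments.

(** * Covariances of increments weighted by past variables *)

Section increments_ip.
Context (R : realType) (T : R) (d : nat).
Context (dO : measure_display) (Omega : measurableType dO).
Context (P : probability Omega R) (P_complete : measure_is_complete P).
Context (B : R -> Omega -> realpow R 'I_d) (B_bm : brownian_motion P T B).

Notation F := (augmented_filtration P B).
Notation D s c k := (fun w => B c w k - B s w k).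

Let adapted_D r s c k : 0 <= s <= r -> 0 <= c <= r -> measurable_wrt (F r) (D s c k).
Proof. by move=> sr cr; apply: measurable_wrtB; exact: brownian_adapted. Qed.

Lemma bounded_increment_sqint r s c k (X : Omega -> R) (M : R) :
  0 <= s -> s <= c -> c <= T -> r <= T ->
  measurable_wrt (F r) X -> (forall w, `|X w| <= M) ->
  sqint P (fun w => X w * D s c k w).
Proof.
move=> s0 sc cT rT FX XM; apply: (sqint_boundedM _ XM).
  exact: (adapted_measurable P_complete B_bm rT).
exact: (sqint_brownian_increment B_bm).
Qed.

(** The longer increment is cut at the earlier endpoint; its excess lies in the future of everything
    else and contributes 0. *)
Let same_start_ip s c e k l (X : Omega -> R) (M : R) :
  0 <= s -> s <= c -> s <= e -> c <= T -> e <= T ->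
  measurable_wrt (F s) X -> (forall w, `|X w| <= M) ->
  ip P (fun w => X w * D s c k w) (D s e l) =
  (k == l)%:R * (Num.min c e - s) * \int[P]_w X w.
Proof.
move=> s0 sc se cT eT FX XM.
have sT : s <= T by rewrite (le_trans sc).
have [ce|/ltW ec] := leP c e.
  have c0 : 0 <= c by exact: le_trans sc.
  have -> : D s e l = fun w => D s c l w + D c e l w.
    by apply/funext => w; ring.
  have sX : sqint P (fun w => X w * D s c k w).
    exact: (bounded_increment_sqint _ _ _ _ _ FX XM).
  have s1 : sqint P (D s c l) by exact: (sqint_brownian_increment B_bm).
  have s2 : sqint P (D c e l) by exact: (sqint_brownian_increment B_bm).
  rewrite ipDr//.
  rewrite (adapted_increment_ip2 P_complete B_bm k l s0 sc cT FX XM).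
  rewrite (adapted_increment_ip P_complete B_bm)//; first by rewrite addr0.
  - apply: measurable_wrtM; last by apply: adapted_D; rewrite ?s0 ?c0/=.
    by apply: measurable_wrtS FX; exact: augmented_filtration_mono.
have e0 : 0 <= e by exact: le_trans se.
have -> : (fun w => X w * D s c k w) =
    fun w => X w * D s e k w + X w * D e c k w.
  by apply/funext => w; ring.
have s1 : sqint P (fun w => X w * D s e k w).
  exact: (bounded_increment_sqint _ _ _ _ _ FX XM).
have s2 : sqint P (fun w => X w * D e c k w).
  exact: (bounded_increment_sqint _ _ _ _ _ FX XM).
have s3 : sqint P (D s e l) by exact: (sqint_brownian_increment B_bm).
rewrite ipDl//.
rewrite (adapted_increment_ip2 P_complete B_bm k l s0 se eT FX XM).
rewrite (_ : ip P (fun w => X w * D e c k w) _ = 0) ?addr0//.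
rewrite -[RHS](@adapted_increment_ip _ _ _ _ _ _ P_complete _ B_bm e c k
  (fun w => X w * D s e l w))//.
- by apply: eq_Rintegral => w _; ring.
- apply: measurable_wrtM; last by apply: adapted_D; rewrite ?s0 ?e0/=.
  by apply: measurable_wrtS FX; exact: augmented_filtration_mono.
- exact: (bounded_increment_sqint _ _ _ _ _ FX XM).
Qed.

(** The part of the first increment before a' belongs to the past of the second one and is
    orthogonal to it. The part after a' starts at the same time as the second one, with X Y as the
    weight. *)
Let increments_ip_le a b a' b' k l (X Y : Omega -> R) (M N : R) :
  0 <= a -> a <= b -> b <= T -> a <= a' -> a' <= b' -> b' <= T ->
  measurable_wrt (F a) X -> (forall w, `|X w| <= M) ->
  measurable_wrt (F a') Y -> (forall w, `|Y w| <= N) ->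
  ip P (fun w => X w * D a b k w) (fun w => Y w * D a' b' l w) =
  (k == l)%:R * Num.max 0 (Num.min b b' - Num.max a a') * ip P X Y.
Proof.
move=> a0 ab bT aa' ab' bT' FX XM FY YN.
have aT : a <= T by exact: le_trans bT.
have a'T : a' <= T by exact: le_trans bT'.
have a'0 : 0 <= a' by exact: le_trans aa'.
have FX' : measurable_wrt (F a') X.
  by apply: measurable_wrtS FX; exact: augmented_filtration_mono.
(* These cut points cover both cases: if b <= a' the piece from a' to c is empty, otherwise the
   interval is cut at a'. *)
pose m := Num.min b a'; pose c := Num.max b a'.
have am : a <= m by rewrite le_min ab.
have mT : m <= T by rewrite ge_min bT.
have ma' : m <= a' by rewrite ge_min lexx orbT.
have a'c : a' <= c by rewrite le_max lexx orbT.
have cT : c <= T by rewrite ge_max bT.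
have XYM w : `|X w * Y w| <= M * N by rewrite normrM ler_pM.
have FXY := measurable_wrtM FX' FY.
have -> : (fun w => X w * D a b k w) =
    fun w => X w * D a m k w + X w * D a' c k w.
  apply/funext => w; rewrite -mulrDr; congr (_ * _); rewrite /m /c.
  by have [ba'|/ltW ba'] := leP b a'; rewrite ?subrr ?addr0//; ring.
have s1 : sqint P (fun w => X w * D a m k w) by exact: (bounded_increment_sqint _ _ _ _ _ FX XM).
have s2 : sqint P (fun w => X w * D a' c k w) by exact: (bounded_increment_sqint _ _ _ _ _ FX XM).
have s3 : sqint P (fun w => Y w * D a' b' l w) by exact: (bounded_increment_sqint _ _ _ _ _ FY YN).
rewrite ipDl//.
have -> : ip P (fun w => X w * D a m k w) (fun w => Y w * D a' b' l w) = 0.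
  rewrite -[RHS](@adapted_increment_ip _ _ _ _ _ _ P_complete _ B_bm a' b' l
    (fun w => Y w * (X w * D a m k w)))//.
  - by apply: eq_Rintegral => w _; ring.
  - do 2 (apply: measurable_wrtM => //).
    by apply: adapted_D; rewrite ?a0//= (le_trans a0).
  - apply: (sqint_boundedM _ YN) => //.
    exact: (adapted_measurable P_complete B_bm a'T).
have -> : ip P (fun w => X w * D a' c k w) (fun w => Y w * D a' b' l w) =
    ip P (fun w => (X w * Y w) * D a' c k w) (D a' b' l).
  by apply: eq_Rintegral => w _; ring.
rewrite (same_start_ip _ _ a'0 a'c ab' cT bT' FXY XYM) add0r.
congr (_ * _ * _); rewrite (max_idPr aa') /c.
have [ba'|/ltW ba'] := leP b a'.
  rewrite (min_idPl ab') subrr; apply/esym/max_idPl.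
  by rewrite subr_le0 ge_min ba'.
by apply/esym/max_idPr; rewrite subr_ge0 le_min ba'.
Qed.

(** The value is the length of the overlap times E(X Y), exactly what [box_ip] finds for the
    corresponding functions of (t, w). The isometry is this agreement, summed over terms. *)
Lemma increments_ip a b a' b' k l (X Y : Omega -> R) (M N : R) :
  0 <= a -> a <= b -> b <= T -> 0 <= a' -> a' <= b' -> b' <= T ->
  measurable_wrt (F a) X -> (forall w, `|X w| <= M) ->
  measurable_wrt (F a') Y -> (forall w, `|Y w| <= N) ->
  ip P (fun w => X w * D a b k w) (fun w => Y w * D a' b' l w) =
  (k == l)%:R * Num.max 0 (Num.min b b' - Num.max a a') * ip P X Y.
Proof.
move=> a0 ab bT a'0 ab' bT' FX XM FY YN.
case/orP: (le_total a a') => [aa'|a'a].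
  exact: (increments_ip_le k l a0 ab bT aa' ab' bT' FX XM FY YN).
rewrite ipC (increments_ip_le l k a'0 ab' bT' a'a ab bT FY YN FX XM).
by rewrite eq_sym (minC b' b) (maxC a' a) (ipC P Y X).
Qed.

End increments_ip.

(** * The matching inner products on time x Omega *)

Section box_ip.
Context (R : realType) (dO : measure_display) (Omega : measurableType dO).
Context (P : probability Omega R).
Notation mu := (lebesgue_measure \x P)%E.
Notation box a b X := (fun p : R * Omega => if a < p.1 <= b then X p.2 else 0 : R).

Let integral_indic_oc (a b : R) :
  (\int[lebesgue_measure]_x (\1_(`]a, b]%classic : set R) x)%:E =
   (Num.max 0 (b - a))%:E)%E.
Proof.
rewrite integral_indic// setIT; transitivity (lebesgue_measure (`]a, b]%classic : set R)) => //.
rewrite lebesgue_measure_itv/= lte_fin; case: ltP => ab; first by rewrite max_r ?subr_ge0 ?ltW.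
by rewrite max_l// subr_le0.
Qed.

Let boxE a b (X : Omega -> R) p : box a b X p = \1_`]a, b] p.1 * X p.2.
Proof.
rewrite indicE mem_setE in_itv/=; case: ifP => _; first by rewrite mul1r.
by rewrite mul0r.
Qed.

Lemma measurable_box a b (X : Omega -> R) : measurable_fun setT X ->
  measurable_fun setT (box a b X).
Proof.
move=> mX; rewrite (_ : (fun p => _) = fun p => \1_`]a, b] p.1 * X p.2); last first.
  by apply/funext => p; rewrite boxE.
by apply: measurable_funM; apply: measurableT_comp.
Qed.

Lemma sqint_box a b (X : Omega -> R) : sqint P X -> sqint mu (box a b X).
Proof.
move=> sX; have [mX X2] := sX; split; first exact: measurable_box.
rewrite fubini_tonelli1//=; last 2 first.
- by apply/measurable_EFinP; apply: measurable_funX; exact: measurable_box.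
- by move=> p; rewrite lee_fin sqr_ge0.
rewrite /fubini_F/=.
rewrite (_ : integral _ _ _ = \int[lebesgue_measure]_x
    ((\1_`]a, b] x)%:E * \int[P]_w ((X w) ^+ 2)%:E))%E; last first.
  apply: eq_integral => t _; rewrite -ge0_integralZl//.
  - apply: eq_integral => w _; have /= -> := boxE a b X (t, w).
    by rewrite exprMn EFinM indicE; case: (_ \in _); rewrite ?expr1n ?expr0n.
  - by apply/measurable_EFinP; exact: measurable_funX.
  - by move=> w _; rewrite lee_fin sqr_ge0.
rewrite ge0_integralZr//; last 2 first.
- exact/measurable_EFinP.
- by apply: integral_ge0 => w _; rewrite lee_fin sqr_ge0.
rewrite integral_indic_oc lte_mul_pinfty//.
by rewrite lee_fin le_max lexx.
Qed.

Lemma box_ip a b a' b' (X Y : Omega -> R) : sqint P X -> sqint P Y ->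
  ip mu (box a b X) (box a' b' Y) =
  Num.max 0 (Num.min b b' - Num.max a a') * ip P X Y.
Proof.
move=> sX sY.
have := sqint_mul (sqint_box a b sX) (sqint_box a' b' sY) => iXY.
rewrite {1}/ip /Rintegral -integral12_prod_meas1//= /fubini_F/=.
rewrite (_ : integral _ _ _ = \int[lebesgue_measure]_x
    ((\1_`]Num.max a a', Num.min b b'] x)%:E * (ip P X Y)%:E))%E; last first.
  apply: eq_integral => t _; rewrite ipE// -integralZl//; last exact: sqint_mul.
  apply: eq_integral => w _.
  have /= -> := boxE a b X (t, w); have /= -> := boxE a' b' Y (t, w).
  rewrite -EFinM mulrACA; congr ((_ * _)%:E).
  rewrite !indicE !mem_setE !in_itv/= gt_max le_min.
  by case: (a < t); case: (a' < t); case: (t <= b); case: (t <= b');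
    rewrite /= ?mulr0 ?mul0r ?mulr1.
rewrite integralZr//; last exact: integrable_indic_itv.
by rewrite integral_indic_oc.
Qed.

End box_ip.

(** * Simple processes: isometry, orthogonality, restriction and linear combination *)

Section simple_processes.
Context (R : realType) (T : R) (d : nat).
Context (dO : measure_display) (Omega : measurableType dO).
Context (P : probability Omega R) (P_complete : measure_is_complete P).
Context (B : R -> Omega -> realpow R 'I_d) (B_bm : brownian_motion P T B).

Implicit Types e : simple R Omega d.

Notation F := (augmented_filtration P B).
Notation D s c k := (fun w => B c w k - B s w k).
Notation mu := (lebesgue_measure \x P)%E.

Let integral_term (e : simple R Omega d) (ik : 'I_(simple_size e) * 'I_d) w : R :=
  simple_coef e ik.1 w ik.2 * D (simple_start e ik.1) (simple_stop e ik.1) ik.2 w.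

Let simple_integralE e : simple_process T F e ->
  simple_integral B e T = fun w => \sum_ik integral_term (e := e) ik w.
Proof.
move=> he; apply/funext => w.
transitivity (\sum_i \sum_k integral_term (e := e) (i, k) w); last first.
  by rewrite pair_bigA/=; apply: eq_bigr => -[].
apply: eq_bigr => i _; apply: eq_bigr => k _; have [_ ab bT _ _] := he i.
by rewrite !min_l// (le_trans ab).
Qed.

Let sqint_term e ik : simple_process T F e -> sqint P (integral_term (e := e) ik).
Proof.
move=> he; have [a0 ab bT FX [M XM]] := he ik.1.
apply: (bounded_increment_sqint P_complete B_bm _ a0 ab bT _ (FX ik.2)) => //.
by rewrite (le_trans ab).
Qed.

Let sqint_coef (e : simple R Omega d) i k : simple_process T F e ->
  sqint P (fun w => simple_coef e i w k).
Proof.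
move=> he; have [a0 ab bT FX [M XM]] := he i; apply: (@sqint_bounded _ _ _ _ M) => //.
by apply: (adapted_measurable P_complete B_bm _ (FX k)); rewrite (le_trans ab).
Qed.

Lemma sqint_simple_integral e : simple_process T F e -> sqint P (simple_integral B e T).
Proof.
by move=> he; rewrite simple_integralE//; apply: sqint_sum => ik; exact: sqint_term.
Qed.

Lemma sqint_simple_value e k : simple_process T F e ->
  sqint mu (fun p => simple_value e p.1 p.2 k).
Proof.
by move=> he; apply: sqint_sum => i; exact: (sqint_box _ _ (sqint_coef i k he)).
Qed.

(** Both squares expand into double sums over the terms of e, which agree by [increments_ip] and
    [box_ip]; products of distinct coordinates vanish. *)
Lemma simple_isometry e : simple_process T F e ->
  ip P (simple_integral B e T) (simple_integral B e T) =
  \sum_k ip mu (fun p => simple_value e p.1 p.2 k) (fun p => simple_value e p.1 p.2 k).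
Proof.
move=> he; rewrite simple_integralE//.
have sJ ik := sqint_term ik he.
rewrite ip_suml//; last exact: sqint_sum.
under eq_bigr do rewrite ip_sumr//.
pose ov i j := Num.max 0 (Num.min (simple_stop e i) (simple_stop e j) -
                          Num.max (simple_start e i) (simple_start e j)).
transitivity (\sum_k \sum_i \sum_j ov i j *
    ip P (fun w => simple_coef e i w k) (fun w => simple_coef e j w k)); last first.
  apply: eq_bigr => k _.
  have sb i := sqint_box (simple_start e i) (simple_stop e i) (sqint_coef i k he).
  rewrite /simple_value ip_suml//; last exact: sqint_sum.
  apply: eq_bigr => i _; rewrite ip_sumr//; apply: eq_bigr => j _.
  by have := box_ip (simple_start e i) (simple_stop e i) (simple_start e j)
    (simple_stop e j) (sqint_coef i k he) (sqint_coef j k he) => ->.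
transitivity (\sum_i \sum_k \sum_j ov i j *
    ip P (fun w => simple_coef e i w k) (fun w => simple_coef e j w k)); last first.
  by rewrite [RHS]exchange_big.
transitivity (\sum_i \sum_k \sum_jl ip P (integral_term (e := e) (i, k))
    (integral_term (e := e) jl)).
  by rewrite [RHS]pair_bigA/=; apply: eq_bigr => -[].
apply: eq_bigr => i _; apply: eq_bigr => k _.
transitivity (\sum_j \sum_l ip P (integral_term (e := e) (i, k))
    (integral_term (e := e) (j, l))).
  by rewrite [RHS]pair_bigA/=; apply: eq_bigr => -[].
apply: eq_bigr => j _.
have [a0 ab bT FX [M XM]] := he i; have [a0' ab' bT' FY [N YN]] := he j.
rewrite (bigD1 k)//= big1 => [|l lk].
  rewrite /integral_term/= (increments_ip P_complete B_bm _ _ a0 ab bT a0' ab' bT' (FX k)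
    (XM ^~ k) (FY k) (YN ^~ k))//.
  by rewrite eqxx mul1r addr0.
rewrite /integral_term/= (increments_ip P_complete B_bm _ _ a0 ab bT a0' ab' bT' (FX k)
    (XM ^~ k) (FY l) (YN ^~ l))//.
by rewrite eq_sym (negbTE lk) !mul0r.
Qed.

(** In each term X times the coefficient is known when the interval starts, so the increment over it
    is orthogonal to that product. *)
Lemma simple_orthogonal e a X : simple_process T F e -> 0 <= a <= T ->
  (forall i, a <= simple_start e i) -> measurable_wrt (F a) X -> sqint P X ->
  ip P X (simple_integral B e T) = 0.
Proof.
move=> he /andP[a0 aT] ae FX sX; rewrite simple_integralE// ip_sumr//; last first.
  by move=> ik; exact: sqint_term.
apply: big1 => -[i k] _; have [s0 sc cT FY [M YM]] := he i.
have sT : simple_start e i <= T by rewrite (le_trans sc).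
rewrite -[RHS](@adapted_increment_ip _ _ _ _ _ _ P_complete _ B_bm (simple_start e i)
  (simple_stop e i) k (fun w => simple_coef e i w k * X w))//.
- by apply: eq_Rintegral => w _; rewrite /integral_term/=; ring.
- apply: measurable_wrtM; first exact: FY.
  by apply: measurable_wrtS FX; exact: augmented_filtration_mono.
- apply: (@sqint_boundedM _ _ _ _ M) => //.
  by apply: (adapted_measurable P_complete B_bm sT); exact: FY.
Qed.

(** The restriction of e to (a, b]. An interval that starts at b or later is clamped to the single
    time b, where its coefficient may fail to be F_b-measurable; such coefficients are therefore set
    to 0. *)
Definition simple_clip (a b : R) (e : simple R Omega d) : simple R Omega d :=
  Simple (fun i => Num.max a (Num.min (simple_start e i) b))
         (fun i => Num.max a (Num.min (simple_stop e i) b))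
         (fun i w k => if simple_start e i < b then simple_coef e i w k else 0).

Lemma simple_clip_process a b e : 0 <= a -> a <= b -> b <= T ->
  simple_process T F e -> simple_process T F (simple_clip a b e).
Proof.
move=> a0 ab bT he i; have [s0 sc cT FX [M XM]] := he i; split => /=.
- by rewrite le_max a0.
- rewrite ge_max le_max lexx/= le_max; apply/orP; right.
  by rewrite le_min !ge_min sc lexx orbT.
- by rewrite ge_max (le_trans ab bT)/= ge_min bT orbT.
- move=> k; have [sb|_] := ltP (simple_start e i) b; last exact: measurable_wrt_cst.
  apply: measurable_wrtS (FX k); apply: augmented_filtration_mono.
  by rewrite le_max lexx orbT.
- exists M => w k; case: ifP => _; first exact: XM.
  by rewrite normr0 (le_trans _ (XM w k)).
Qed.

Lemma simple_clip_value a b e t w k : a <= b ->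
  simple_value (simple_clip a b e) t w k =
  if a < t <= b then simple_value e t w k else 0.
Proof.
move=> ab; rewrite /simple_value/=.
have [tab|tab] := boolP (a < t <= b); last first.
  apply: big1 => i _; case: ifP => // /andP[].
  rewrite gt_max => /andP[at_ _]; rewrite le_max le_min leNgt at_/= => /andP[_ tb].
  by move: tab; rewrite at_ tb.
case/andP: tab => at_ tb; apply: eq_bigr => i _.
rewrite gt_max at_ le_max leNgt at_/= le_min tb andbT.
have [sb|bs] := ltP (simple_start e i) b; first by [].
by rewrite if_same ltNge (le_trans tb bs).
Qed.

Lemma simple_clip_integral a b e w : a <= b -> b <= T -> simple_process T F e ->
  simple_integral B (simple_clip a b e) T w =
  simple_integral B e b w - simple_integral B e a w.
Proof.
move=> ab bT he; rewrite /simple_integral -sumrB; apply: eq_bigr => i _.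
rewrite /dot -sumrB; apply: eq_bigr => k _ /=.
have [s0 sc cT _ _] := he i.
have clampT x : Num.min (Num.max a (Num.min x b)) T = Num.max a (Num.min x b).
  by apply/min_idPl; rewrite ge_max (le_trans ab bT)/= ge_min bT orbT.
(* Clamping an endpoint to [a, b] splits B there into the values stopped at b and at a; the term B_a
   cancels between the two endpoints of an interval. *)
have clampE x : B (Num.max a (Num.min x b)) w k =
    B (Num.min x b) w k - B (Num.min x a) w k + B a w k.
  case/orP: (le_total x a) => xa.
    have xb : x <= b by exact: le_trans ab.
    by rewrite (min_idPl xa) (min_idPl xb) (max_idPl xa) subrr add0r.
  rewrite (min_idPr xa) subrK; congr (B _ w k); apply/max_idPr.
  by rewrite le_min xa.
rewrite !clampT !clampE; have [sb|bs] := ltP (simple_start e i) b; first by ring.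
have bc : b <= simple_stop e i by exact: le_trans sc.
have as_ : a <= simple_start e i by exact: le_trans bs.
have ac : a <= simple_stop e i by exact: le_trans bc.
rewrite ?(min_idPr bs) ?(min_idPr bc) ?(min_idPr as_) ?(min_idPr ac).
by ring.
Qed.

Definition simple_lin (c : R) (e1 e2 : simple R Omega d) : simple R Omega d :=
  @Simple _ _ _ (simple_size e1 + simple_size e2)
    (fun i => match fintype.split i with
              | inl j => simple_start e1 j | inr j => simple_start e2 j end)
    (fun i => match fintype.split i with inl j => simple_stop e1 j | inr j => simple_stop e2 j end)
    (fun i w k => match fintype.split i with
       inl j => c * simple_coef e1 j w k | inr j => simple_coef e2 j w k end).

Lemma simple_lin_process c e1 e2 : simple_process T F e1 -> simple_process T F e2 ->
  simple_process T F (simple_lin c e1 e2).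
Proof.
move=> h1 h2 i; rewrite /simple_lin/=; case: (fintype.split i) => j.
  have [s0 sc cT FX [M XM]] := h1 j; split => //.
    by move=> k; apply: measurable_wrtM (FX k); exact: measurable_wrt_cst.
  by exists (`|c| * M) => w k; rewrite normrM ler_wpM2l.
by have [s0 sc cT FX [M XM]] := h2 j; split => //; exists M.
Qed.

Let split_lshift m n (i : 'I_m) : fintype.split (lshift n i) = inl i.
Proof. exact: (unsplitK (inl i)). Qed.

Let split_rshift m n (i : 'I_n) : fintype.split (rshift m i) = inr i.
Proof. exact: (unsplitK (inr i)). Qed.

Lemma simple_lin_value c e1 e2 t w k :
  simple_value (simple_lin c e1 e2) t w k =
  c * simple_value e1 t w k + simple_value e2 t w k.
Proof.
rewrite /simple_value big_split_ord/= mulr_sumr; congr (_ + _); apply: eq_bigr => i _.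
  by rewrite split_lshift; case: ifP; rewrite ?mulr0.
by rewrite split_rshift.
Qed.

Lemma simple_lin_integral c e1 e2 t w :
  simple_integral B (simple_lin c e1 e2) t w =
  c * simple_integral B e1 t w + simple_integral B e2 t w.
Proof.
rewrite /simple_integral big_split_ord/= mulr_sumr; congr (_ + _); apply: eq_bigr => i _.
  by rewrite split_lshift /dot mulr_sumr; apply: eq_bigr => k _; rewrite mulrA.
by rewrite split_rshift.
Qed.

End simple_processes.

Section square_integrable_convergence.
Context d (S : measurableType d) (R : realType) (mu : {measure set S -> \bar R}).
Implicit Types f g : S -> R.

Lemma le_sqcvg (F G : nat -> S -> R) f g :
  (forall n, measurable_fun setT (F n)) -> measurable_fun setT f ->
  (forall n, measurable_fun setT (G n)) -> measurable_fun setT g ->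
  (forall n x, `|F n x - f x| <= `|G n x - g x|) ->
  sqcvg mu G g -> sqcvg mu F f.
Proof.
move=> mF mf mG mg FG cG.
apply: (squeeze_cvge _ (cvg_cst 0%E) cG); apply: nearW => n; apply/andP; split.
  by apply: integral_ge0 => x _; rewrite lee_fin sqr_ge0.
apply: ge0_le_integral => //.
- by move=> x _; rewrite lee_fin sqr_ge0.
- by apply/measurable_EFinP; apply: measurable_funX; exact: measurable_funB.
- by apply/measurable_EFinP; apply: measurable_funX; exact: measurable_funB.
- move=> x _; rewrite lee_fin -(real_normK (num_real (F n x - f x))).
  rewrite -(real_normK (num_real (G n x - g x))).
  by rewrite lerXn2r// nnegrE.
Qed.

(** For N large the distance from F_N to f is finite, and f = F_N - (F_N - f). *)
Lemma sqcvg_sqint (F : nat -> S -> R) f : (forall n, sqint mu (F n)) ->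
  measurable_fun setT f -> sqcvg mu F f -> sqint mu f.
Proof.
move=> sF mf /fine_cvgP[[N _ fin] _].
have sD : sqint mu (fun x => F N x - f x).
  split; first by have [mF _] := sF N; exact: measurable_funB.
  by have := fin N (leqnn N); rewrite fin_numElt => /andP[].
have := sqintB (sF N) sD.
by under eq_fun do rewrite opprB addrC subrK.
Qed.

Lemma sqcvg_lin c (F G : nat -> S -> R) f g :
  (forall n, sqint mu (F n)) -> sqint mu f -> (forall n, sqint mu (G n)) -> sqint mu g ->
  sqcvg mu F f -> sqcvg mu G g ->
  sqcvg mu (fun n x => c * F n x + G n x) (fun x => c * f x + g x).
Proof.
move=> sF sf sG sg cF cG.
have sFf n := sqintB (sF n) sf; have sGg n := sqintB (sG n) sg.
have cF0 : sqcvg mu (fun n x => F n x - f x) (fun=> 0).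
  by rewrite /sqcvg; under eq_fun do under eq_integral do rewrite subr0.
have cG0 : sqcvg mu (fun n x => G n x - g x) (fun=> 0).
  by rewrite /sqcvg; under eq_fun do under eq_integral do rewrite subr0.
have s0 := sqint0 mu.
(* Continuity of the inner product at the zero limit disposes of all three terms in the expansion of
   the squared norm. *)
have FF := sqcvg_ip sFf s0 sFf s0 cF0 cF0.
have FG := sqcvg_ip sFf s0 sGg s0 cF0 cG0.
have GG := sqcvg_ip sGg s0 sGg s0 cG0 cG0.
rewrite ip0l in FF FG GG.
apply/sqcvgP.
- by move=> n; apply: sqintD => //; exact: sqintZ.
- by apply: sqintD => //; exact: sqintZ.
rewrite (_ : (fun n => _) = fun n =>
   ip mu (fun x => G n x - g x) (fun x => G n x - g x)
   + 2 * c * ip mu (fun x => F n x - f x) (fun x => G n x - g x)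
   + c ^+ 2 * ip mu (fun x => F n x - f x) (fun x => F n x - f x)); last first.
  apply/funext => n; have := ip_sqrB (- c) (sGg n) (sFf n).
  rewrite (ipC mu (fun x => G n x - g x) (fun x => F n x - f x)).
  rewrite sqrrN mulrN mulNr opprK => <-.
  by apply: eq_Rintegral => x _; ring.
rewrite [X in _ --> X](_ : _ = 0 + 2 * c * 0 + c ^+ 2 * 0); last by ring.
by apply: cvgD; [apply: cvgD => //|]; apply: cvgM => //; exact: cvg_cst.
Qed.

End square_integrable_convergence.

(** * The Ito integral as an L2 limit *)

Section L2_ito.
Context (R : realType) (T : R) (T_gt0 : 0 < T) (d : nat).
Context (dO : measure_display) (Omega : measurableType dO).
Context (P : probability Omega R) (P_complete : measure_is_complete P).
Context (B : R -> Omega -> realpow R 'I_d) (B_bm : brownian_motion P T B).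

Notation F := (augmented_filtration P B).
Notation mu := (lebesgue_measure \x P)%E.
Implicit Types (phi psi : R -> Omega -> realpow R 'I_d) (M N : R -> Omega -> R).

(** Extension by 0 makes the process a function on all of R x Omega, so that the L2 theory above
    applies to dt x P. The interval is half-open to match those of simple processes. *)
Definition slice (a b : R) phi (k : 'I_d) (p : R * Omega) : R :=
  if a < p.1 <= b then phi p.1 p.2 k else 0.

Lemma sliceS a b a' b' phi k p : a' <= a -> b <= b' ->
  slice a b phi k p = (if a < p.1 <= b then 1 else 0) * slice a' b' phi k p.
Proof.
move=> a'a bb'; rewrite /slice; case: ifPn => [/andP[ap pb]|_]; last by rewrite mul0r.
by rewrite mul1r (le_lt_trans a'a ap) (le_trans pb bb').
Qed.

Lemma measurable_slice a b a' b' phi k : a' <= a -> b <= b' ->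
  measurable_fun setT (slice a' b' phi k) -> measurable_fun setT (slice a b phi k).
Proof.
move=> aa bb mphi.
rewrite (_ : slice a b phi k = fun p =>
  (if a < p.1 <= b then 1 else 0) * slice a' b' phi k p).
  apply: measurable_funM => //.
  by have := @measurable_box R dO Omega a b (fun=> 1) (measurable_cst _).
by apply/funext => p; exact: sliceS.
Qed.

Lemma slice_norm_le a b a' b' phi psi k p : a' <= a -> b <= b' ->
  `|slice a b phi k p - slice a b psi k p| <=
  `|slice a' b' phi k p - slice a' b' psi k p|.
Proof.
move=> aa bb; rewrite (sliceS phi k p aa bb) (sliceS psi k p aa bb) -mulrBr normrM.
by case: ifP => _; rewrite ?normr1 ?normr0 ?mul1r ?mul0r.
Qed.

Lemma sqint_slice a b a' b' phi k : a' <= a -> b <= b' ->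
  sqint mu (slice a' b' phi k) -> sqint mu (slice a b phi k).
Proof.
move=> aa bb sphi; apply: (le_sqint _ sphi).
  by apply: measurable_slice aa bb _; case: sphi.
move=> p; rewrite (sliceS phi k p aa bb) normrM.
by case: ifP => _; rewrite ?normr1 ?normr0 ?mul1r ?mul0r.
Qed.

(** The L2 content of [ito_integral]: path continuity is forgotten, and convergence is stated
    coordinate by coordinate for dt x P. *)
Definition L2_ito phi M :=
  [/\ forall k, sqint mu (slice 0 T phi k),
      forall t, 0 <= t <= T -> measurable_wrt (F t) (M t)
    & exists e : nat -> simple R Omega d,
       [/\ forall n, simple_process T F (e n),
           forall k, sqcvg mu (fun n => slice 0 T (simple_value (e n)) k) (slice 0 T phi k)
         & forall t, 0 <= t <= T -> sqcvg P (fun n => simple_integral B (e n) t) (M t)]].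

Lemma slice_simple a b (e : simple R Omega d) k : a <= b ->
  slice a b (simple_value e) k = fun p => simple_value (simple_clip a b e) p.1 p.2 k.
Proof. by move=> ab; apply/funext => p; rewrite simple_clip_value. Qed.

Let simple_increment a b (e : simple R Omega d) : a <= b -> b <= T ->
  simple_process T F e ->
  (fun w => simple_integral B e b w - simple_integral B e a w) =
  simple_integral B (simple_clip a b e) T.
Proof. by move=> ab bT he; apply/funext => w; rewrite (simple_clip_integral w ab bT he). Qed.

Lemma sqint_slice_simple a b (e : simple R Omega d) k : 0 <= a -> a <= b -> b <= T ->
  simple_process T F e -> sqint mu (slice a b (simple_value e) k).
Proof.
move=> a0 ab bT he; rewrite slice_simple//.
by apply: (sqint_simple_value P_complete B_bm); exact: simple_clip_process.
Qed.

Lemma sqint_simple_integral_at t (e : simple R Omega d) : 0 <= t <= T ->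
  simple_process T F e -> sqint P (simple_integral B e t).
Proof.
move=> /andP[t0 tT] he.
have e0 w : simple_integral B e 0 w = 0.
  apply: big1 => i _; have [s0 sc _ _ _] := he i.
  rewrite /dot big1// => k _; rewrite (min_idPr s0) (min_idPr (le_trans s0 sc)).
  by rewrite subrr mulr0.
have -> : simple_integral B e t =
    fun w => simple_integral B e t w - simple_integral B e 0 w.
  by apply/funext => w; rewrite e0 subr0.
rewrite simple_increment//.
by apply: (sqint_simple_integral P_complete B_bm); exact: simple_clip_process.
Qed.

Lemma L2_ito_sqint phi M t : 0 <= t <= T -> L2_ito phi M -> sqint P (M t).
Proof.
move=> tT [_ FM [e [he _ cM]]].
apply: (@sqcvg_sqint _ _ _ _ (fun n => simple_integral B (e n) t)).
- by move=> n; exact: sqint_simple_integral_at.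
- by apply: (adapted_measurable P_complete B_bm _ (FM t tT)); case/andP: tT.
- exact: cM.
Qed.

Let L2_ito_increment_cvg (e : nat -> simple R Omega d) M a b :
  0 <= a <= T -> 0 <= b <= T ->
  (forall n, simple_process T F (e n)) -> sqint P (M a) -> sqint P (M b) ->
  (forall t, 0 <= t <= T -> sqcvg P (fun n => simple_integral B (e n) t) (M t)) ->
  sqcvg P (fun n w => simple_integral B (e n) b w - simple_integral B (e n) a w)
          (fun w => M b w - M a w).
Proof.
move=> aT bT he sa sb cM.
have := @sqcvg_lin _ _ _ P (-1) _ _ _ _
  (fun n => sqint_simple_integral_at aT (he n)) sa
  (fun n => sqint_simple_integral_at bT (he n)) sb (cM a aT) (cM b bT).
rewrite /sqcvg; under eq_fun do under eq_integral => w _ do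
  rewrite !mulN1r ![- _ + _]addrC.
by [].
Qed.

(** Both sides are limits of the same identity for the approximating simple processes clipped to (a,
    b]; clipping does not increase the distance to phi. *)
Lemma L2_ito_isometry phi M a b : 0 <= a -> a <= b -> b <= T -> L2_ito phi M ->
  ip P (fun w => M b w - M a w) (fun w => M b w - M a w) =
  \sum_k ip mu (slice a b phi k) (slice a b phi k).
Proof.
move=> a0 ab bT ito.
have aT : 0 <= a <= T by rewrite a0 (le_trans ab).
have bT' : 0 <= b <= T by rewrite (le_trans a0 ab).
have sa := L2_ito_sqint aT ito; have sb := L2_ito_sqint bT' ito.
have [sphi FM [e [he ce cM]]] := ito.
have cI := L2_ito_increment_cvg aT bT' he sa sb cM.
have sI n : sqint P (fun w => simple_integral B (e n) b w - simple_integral B (e n) a w).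
  by apply: sqintB; exact: sqint_simple_integral_at.
have sM : sqint P (fun w => M b w - M a w) by exact: sqintB.
have L := sqcvg_ip sI sM sI sM cI cI.
have sS k := @sqint_slice a b 0 T phi k a0 bT (sphi k).
have sSn n k := sqint_slice_simple k a0 ab bT (he n).
have cS k : sqcvg mu (fun n => slice a b (simple_value (e n)) k) (slice a b phi k).
  apply: (le_sqcvg _ _ _ _ _ (ce k)).
  - by move=> n; case: (sSn n k).
  - by case: (sS k).
  - move=> n; have [] // := @sqint_slice_simple 0 T (e n) k (lexx _) (ltW T_gt0) (lexx _) (he n).
  - by case: (sphi k).
  - by move=> n p; exact: slice_norm_le.
apply: (cvg_unique _ L) => //.
rewrite (_ : (fun n => _) = fun n =>
   \sum_k ip mu (slice a b (simple_value (e n)) k) (slice a b (simple_value (e n)) k)).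
  apply: cvg_big => [|k _]; first exact: add_continuous.
  exact: (sqcvg_ip (sSn ^~ k) (sS k) (sSn ^~ k) (sS k)).
apply/funext => n; rewrite simple_increment// (simple_isometry P_complete B_bm).
  by apply: eq_bigr => k _; rewrite slice_simple.
exact: simple_clip_process.
Qed.

(** The martingale property in L2 form. It holds exactly for clipped simple integrals and passes to
    the limit. *)
Lemma L2_ito_orthogonal phi M X a b : 0 <= a -> a <= b -> b <= T -> L2_ito phi M ->
  measurable_wrt (F a) X -> sqint P X -> ip P X (fun w => M b w - M a w) = 0.
Proof.
move=> a0 ab bT ito FX sX.
have aT : 0 <= a <= T by rewrite a0 (le_trans ab).
have bT' : 0 <= b <= T by rewrite (le_trans a0 ab).
have sa := L2_ito_sqint aT ito; have sb := L2_ito_sqint bT' ito.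
have [sphi FM [e [he ce cM]]] := ito.
have cI := L2_ito_increment_cvg aT bT' he sa sb cM.
have sI n : sqint P (fun w => simple_integral B (e n) b w - simple_integral B (e n) a w).
  by apply: sqintB; exact: sqint_simple_integral_at.
have sM : sqint P (fun w => M b w - M a w) by exact: sqintB.
have cX : sqcvg P (fun=> X) X.
  rewrite /sqcvg; under eq_fun do under eq_integral do rewrite subrr expr0n/=.
  by under eq_fun do rewrite integral0; exact: cvg_cst.
have L := sqcvg_ip (fun=> sX) sX sI sM cX cI.
apply: (cvg_unique _ L) => //.
rewrite (_ : (fun n => _) = fun=> 0); first exact: cvg_cst.
apply/funext => n; rewrite simple_increment//.
apply: (simple_orthogonal P_complete B_bm _ aT _ FX sX).
  exact: simple_clip_process.
by move=> i /=; rewrite le_max lexx.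
Qed.

Lemma L2_ito_lin c phi psi M N : L2_ito phi M -> L2_ito psi N ->
  L2_ito (fun t w k => c * phi t w k + psi t w k) (fun t w => c * M t w + N t w).
Proof.
move=> itoM itoN; have sM t tT := @L2_ito_sqint phi M t tT itoM.
have sN t tT := @L2_ito_sqint psi N t tT itoN.
have [sphi FM [e [he ce cM]]] := itoM; have [spsi FN [f [hf cf cN]]] := itoN.
have sliceE x y k : slice 0 T (fun t w k => c * x t w k + y t w k) k =
    fun p => c * slice 0 T x k p + slice 0 T y k p.
  by apply/funext => p; rewrite /slice; case: ifP => // _; rewrite mulr0 addr0.
split.
- by move=> k; rewrite sliceE; apply: sqintD => //; exact: sqintZ.
- move=> t tT; apply: measurable_wrtD; last exact: FN.
  by apply: measurable_wrtM; [exact: measurable_wrt_cst|exact: FM].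
exists (fun n => simple_lin c (e n) (f n)); split.
- by move=> n; exact: simple_lin_process.
- move=> k; rewrite sliceE.
  rewrite (_ : (fun n => _) = fun n p =>
    c * slice 0 T (simple_value (e n)) k p + slice 0 T (simple_value (f n)) k p).
    apply: sqcvg_lin => //.
    + by move=> n; apply: sqint_slice_simple => //; exact: ltW.
    + by move=> n; apply: sqint_slice_simple => //; exact: ltW.
  apply/funext => n; apply/funext => p; rewrite /slice; case: ifP => _.
    by rewrite simple_lin_value.
  by rewrite mulr0 addr0.
- move=> t tT; rewrite (_ : (fun n => _) = fun n w =>
    c * simple_integral B (e n) t w + simple_integral B (f n) t w).
    apply: sqcvg_lin => //.
    + by move=> n; exact: sqint_simple_integral_at.
    + exact: sM.
    + by move=> n; exact: sqint_simple_integral_at.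
    + exact: sN.
    + exact: cM.
    + exact: cN.
  by apply/funext => n; apply/funext => w; rewrite simple_lin_integral.
Qed.

End L2_ito.

(** * Predictable processes *)

Section realpow_measurability.
Context (R : realType) (I : Type) (d : measure_display) (S : measurableType d).

Lemma measurable_coord (i : I) : measurable_fun setT (fun x : realpow R I => x i).
Proof.
by move=> _ U mU; rewrite setTI; apply: sub_sigma_algebra; exists i, U.
Qed.

Lemma measurable_realpow (D : set S) (f : S -> realpow R I) :
  (forall i, measurable_fun D (fun x => f x i)) -> measurable_fun D f.
Proof.
move=> mf mD; suff : measurable_fun D f by exact.
apply: (@measurability _ _ S (realpow R I) D f (@cylinders R I)) => //.
by move=> _ [_ [i [U [mU ->]]] <-]; exact: mf.
Qed.

End realpow_measurability.

(** * Measurability, adaptedness and norms of predictable processes *)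

Section H2_processes.
Context (R : realType) (T : R) (T_gt0 : 0 < T) (d : nat).
Context (dO : measure_display) (Omega : measurableType dO).
Context (P : probability Omega R) (P_complete : measure_is_complete P).
Context (B : R -> Omega -> realpow R 'I_d) (B_bm : brownian_motion P T B).

Notation F := (augmented_filtration P B).
Notation mu := (lebesgue_measure \x P)%E.

Lemma predictable_sets_measurable C : predictable_sets T F C -> measurable C.
Proof.
have mD : measurable (`[0, T] `*` [set: Omega] : set (R * Omega)) by exact: measurableX.
move: C; apply: smallest_sub.
  split => [|A mA|A mA]; [exact: measurable0|exact: measurableD|].
  exact: bigcup_measurable.
have FT t : t <= T -> F t `<=` measurable.
  exact: (augmented_filtration_measurable P_complete B_bm).
move=> C [[A [FA ->]]|[s [t [A [s0 st tT FA ->]]]]].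
  by apply: measurableX => //; apply: (FT 0) => //; exact: ltW.
by apply: measurableX => //; apply: (FT s) => //; rewrite (le_trans (ltW st)).
Qed.

(** The sections at time t of the generating rectangles are empty or belong to F_t. Adaptedness of Y
    is what makes Y_t orthogonal to later increments. *)
Lemma predictable_sets_adapted C t : 0 <= t <= T -> predictable_sets T F C ->
  F t [set w | C (t, w)].
Proof.
move=> /andP[t0 tT]; move: C; apply: smallest_sub.
  pose FT := g_sigma_algebraType
    [set A | (exists s k (U : set R), [/\ s \in `[0, t], measurable U
       & A = [set w | U (B s w k)]]) \/ P.-negligible A].
  split => [|A mA|A mA].
  - exact: (@measurable0 _ FT).
  - rewrite (_ : [set w | _] = ~` [set w | A (t, w)]); first exact: (@measurableC _ FT).
    apply/seteqP; split=> w /=; first by case.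
    by move=> Aw; split => //; split => //=; rewrite in_itv/= t0.
  - rewrite (_ : [set w | _] = \bigcup_k [set w | A k (t, w)]).
      by apply: (@bigcup_measurable _ FT) => k _; exact: mA.
    by apply/seteqP; split=> w [k _ ?]; exists k.
move=> C [[A [FA ->]]|[s [q [A [s0 sq qT FA ->]]]]].
- have [->|tn0] := eqVneq t 0.
    by rewrite (_ : [set w | _] = A)//; apply/seteqP; split=> w //= -[].
  rewrite (_ : [set w | _] = set0); first exact: (@measurable0 _ (g_sigma_algebraType _)).
  by apply/seteqP; split=> w //= -[/= t00]; rewrite t00 eqxx in tn0.
- have [tsq|tsq] := boolP (t \in `]s, q]).
    rewrite (_ : [set w | _] = A).
      apply: augmented_filtration_mono FA.
      by move: tsq; rewrite in_itv/= => /andP[/ltW].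
    by apply/seteqP; split=> w //= -[].
  rewrite (_ : [set w | _] = set0); first exact: (@measurable0 _ (g_sigma_algebraType _)).
  by apply/seteqP; split=> w //= -[/= t00]; rewrite t00 in tsq.
Qed.

Let coord_preimage n (U : set R) (k : 'I_n) : measurable U ->
  measurable [set x : realpow R 'I_n | U (x k)].
Proof. by move=> mU; apply: sub_sigma_algebra; exists k, U. Qed.

Lemma predictable_measurable n (phi : R -> Omega -> realpow R 'I_n) k :
  predictable T F phi -> measurable_fun (`[0, T] `*` setT) (fun p : R * Omega => phi p.1 p.2 k).
Proof.
move=> pphi _ U mU; apply: predictable_sets_measurable.
exact: (pphi _ (coord_preimage k mU)).
Qed.

Lemma predictable_adapted n (phi : R -> Omega -> realpow R 'I_n) k t :
  0 <= t <= T -> predictable T F phi -> measurable_wrt (F t) (fun w => phi t w k).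
Proof.
move=> tT pphi U mU.
have := predictable_sets_adapted tT (pphi _ (coord_preimage k mU)).
congr (F t _); apply/seteqP; split=> w /=; first by case.
by split => //; split => //; rewrite /= in_itv.
Qed.

Lemma measurable_slice_fun n (phi : R -> Omega -> realpow R 'I_n) k :
  measurable_fun (`[0, T] `*` setT) (fun p : R * Omega => phi p.1 p.2 k) ->
  measurable_fun setT (slice 0 T phi k).
Proof.
move=> mphi.
have mD : measurable (`]0, T] `*` [set: Omega] : set (R * Omega)) by exact: measurableX.
have {}mphi : measurable_fun (`]0, T] `*` setT) (fun p : R * Omega => phi p.1 p.2 k).
  apply: measurable_funS mphi; first exact: measurableX.
  by move=> p /= [p0T _]; split => //; move: p0T; rewrite !in_itv/= => /andP[/ltW -> ->].
rewrite (_ : slice 0 T phi k =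
    (fun p : R * Omega => phi p.1 p.2 k) \_ (`]0, T] `*` setT)).
  exact/(measurable_restrictT _ mD).
apply/funext => p; rewrite /slice /patch; case: ifPn => [pT|pT].
  by rewrite mem_set//; split => //=; rewrite in_itv.
by rewrite memNset// => -[/=]; rewrite in_itv/= (negbTE pT).
Qed.

Lemma norm2_sqr n (x : 'I_n -> R) : norm2 x ^+ 2 = \sum_k x k ^+ 2.
Proof.
rewrite /norm2 sqr_sqrtr /dot; last by apply: sumr_ge0 => k _; rewrite -expr2 sqr_ge0.
by apply: eq_bigr => k _; rewrite expr2.
Qed.

Lemma measurable_section (f : R * Omega -> R) w : measurable_fun setT f ->
  measurable_fun setT (fun t => f (t, w)).
Proof.
move=> mf; apply: (measurableT_comp mf).
by apply: measurable_fun_pair; [exact: measurable_id|exact: measurable_cst].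
Qed.

Lemma integral_slice_section n (phi : R -> Omega -> realpow R 'I_n) a b w :
  (forall k, measurable_fun setT (slice a b phi k)) ->
  (\int[lebesgue_measure]_(t in `[a, b]) ((norm2 (phi t w) ^+ 2)%R)%:E =
   \int[lebesgue_measure]_t (\sum_k slice a b phi k (t, w) ^+ 2)%:E)%E.
Proof.
move=> mphi.
have ms : measurable_fun setT (fun t => (\sum_k slice a b phi k (t, w) ^+ 2)%:E).
  apply/measurable_EFinP; apply: measurable_sum => k; apply: measurable_funX.
  exact: measurable_section.
have eqs t : t \in `]a, b] ->
    \sum_k slice a b phi k (t, w) ^+ 2 = norm2 (phi t w) ^+ 2.
  rewrite in_itv/= => tT; rewrite norm2_sqr; apply: eq_bigr => k _.
  by rewrite /slice/= tT.
rewrite -integral_itv_obnd_cbnd; last first.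
  apply: (eq_measurable_fun (fun t => (\sum_k slice a b phi k (t, w) ^+ 2)%:E)).
    by move=> t; rewrite inE => tT; rewrite eqs.
  exact: measurable_funTS.
rewrite integral_mkcond; apply: eq_integral => t _; rewrite patchE.
case: ifPn; rewrite ?inE => tT; first by rewrite eqs.
rewrite big1// => k _; rewrite /slice/=; case: ifPn => //.
  by move=> tab; case/negP: tT; rewrite inE /= in_itv.
by rewrite expr0n.
Qed.

(** Tonelli; the closed interval and the half-open slice differ by a null set of times. *)
Lemma H2_sqnormE n (phi : R -> Omega -> realpow R 'I_n) :
  (forall k, measurable_fun setT (slice 0 T phi k)) ->
  H2_sqnorm P T phi = (\sum_k \int[mu]_p (slice 0 T phi k p ^+ 2)%:E)%E.
Proof.
move=> mphi; rewrite /H2_sqnorm.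
under eq_integral do rewrite integral_slice_section//.
rewrite -ge0_integral_sum//; last 2 first.
- by move=> k; apply/measurable_EFinP; exact: measurable_funX (mphi k).
- by move=> k p _; rewrite lee_fin sqr_ge0.
have msum : measurable_fun setT (fun p => \sum_k (slice 0 T phi k p ^+ 2)%:E)%E.
  apply: emeasurable_sum => k; apply/measurable_EFinP.
  exact: measurable_funX (mphi k).
have sum_ge0 p : (0 <= \sum_k (slice 0 T phi k p ^+ 2)%:E)%E.
  by apply: sume_ge0 => k _; rewrite lee_fin sqr_ge0.
apply: (etrans _ (esym (@fubini_tonelli2 _ _ _ _ _ lebesgue_measure P _ msum sum_ge0))).
apply: eq_integral => w _; rewrite /fubini_G; apply: eq_integral => t _.
by rewrite sumEFin.
Qed.

Lemma sqint_slice_H2 n (phi : R -> Omega -> realpow R 'I_n) :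
  (forall k, measurable_fun setT (slice 0 T phi k)) ->
  (H2_sqnorm P T phi < +oo)%E -> forall k, sqint mu (slice 0 T phi k).
Proof.
move=> mphi; rewrite H2_sqnormE// => fin k; split; first exact: mphi.
apply: le_lt_trans fin; rewrite (bigD1 k)//= leeDl//.
apply: sume_ge0 => j _; apply: integral_ge0 => p _.
by rewrite lee_fin sqr_ge0.
Qed.

Lemma ito_integral_L2_ito phi M : (forall k, sqint mu (slice 0 T phi k)) ->
  ito_integral P T B phi M -> L2_ito T P B phi M.
Proof.
move=> sphi [FM _ [e [he ce cM]]]; split => //.
exists e; split => // k.
have se n j : sqint mu (slice 0 T (simple_value (e n)) j).
  by apply: (sqint_slice_simple P_complete B_bm) => //; exact: ltW.
have sliceB n j : slice 0 T (fun t w k => simple_value (e n) t w k - phi t w k) j =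
    fun p => slice 0 T (simple_value (e n)) j p - slice 0 T phi j p.
  by apply/funext => p; rewrite /slice; case: ifP; rewrite ?subr0.
apply: (squeeze_cvge _ (cvg_cst 0%E) ce); apply: nearW => n; apply/andP; split.
  by apply: integral_ge0 => x _; rewrite lee_fin sqr_ge0.
rewrite H2_sqnormE => [|j]; last first.
  by rewrite sliceB; apply: measurable_funB; [case: (se n j)|case: (sphi j)].
rewrite (bigD1 k)//= sliceB leeDl//.
apply: sume_ge0 => j _; apply: integral_ge0 => p _.
by rewrite lee_fin sqr_ge0.
Qed.

End H2_processes.

(** * Representation of predictable processes *)

Section ae_product.
Context (R : realType) (dO : measure_display) (Omega : measurableType dO).
Context (P : probability Omega R).
Notation mu := (lebesgue_measure \x P)%E.

Lemma ae_snd (Q : Omega -> Prop) : {ae P, forall w, Q w} ->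
  {ae mu, forall p : R * Omega, Q p.2}.
Proof.
move=> [N [mN N0 QN]]; exists (setT `*` N); split.
- exact: measurableX.
- by rewrite product_measure1E// [X in (_ * X)%E]N0 mule0.
- by move=> p /= nQ; split => //; exact: QN.
Qed.

Lemma ae_fst_neq (t : R) : {ae mu, forall p : R * Omega, p.1 <> t}.
Proof.
exists ([set t] `*` setT); split.
- exact: measurableX.
- rewrite product_measure1E//.
  rewrite [X in (X * _)%E](_ : _ = 0%E) ?mul0e//.
  exact: lebesgue_measure_set1.
- by move=> p /= /contrapT.
Qed.

End ae_product.

Section fast_convergence.
Context d (S : measurableType d) (R : realType) (mu : {measure set S -> \bar R}).

(** The sum of the squares has a finite integral, so it is finite almost everywhere and its terms
    tend to 0. With such a rate no subsequence has to be extracted. *)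
Lemma ae_cvg0_sqr_summable (F : nat -> S -> R) (C : R) :
  (forall n, measurable_fun setT (F n)) ->
  (forall n, (\int[mu]_x (F n x ^+ 2)%:E <= (C / (2 ^ (n + 1))%:R)%:E)%E) ->
  {ae mu, forall x, F ^~ x @ \oo --> (0 : R)}.
Proof.
move=> mF FC.
have m2 n : measurable_fun setT (fun x => (F n x ^+ 2)%:E).
  by apply/measurable_EFinP; exact: measurable_funX.
have F2 n x : (0 <= (F n x ^+ 2)%:E)%E by rewrite lee_fin sqr_ge0.
pose g x := (\sum_(n <oo) (F n x ^+ 2)%:E)%E.
have g0 x : (0 <= g x)%E by exact: nneseries_ge0.
have mg : measurable_fun setT g by exact: ge0_emeasurable_sum.
have sumC : (\int[mu]_x g x < +oo)%E.
  rewrite integral_nneseries//.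
  apply: (@le_lt_trans _ _ (\sum_(n <oo) (C / (2 ^ (n + 1))%:R)%:E)%E).
    by apply: lee_nneseries => [n _ _|n _]; [apply: integral_ge0 => x _; exact: F2|exact: FC].
  by have /cvg_lim -> := @cvg_geometric_eseries_half R C 0; rewrite ?ltry.
have ig : mu.-integrable setT g.
  by apply/integrableP; split => //; under eq_integral do rewrite gee0_abs//.
apply: filterS (integrable_ae measurableT ig) => x /(_ I) gx.
have gy : (g x < +oo)%E by rewrite -ge0_fin_numE.
have tail := nneseries_tail_cvg gy (fun k _ => F2 k x).
have {tail}sq0 : (fun n => (F n x ^+ 2)%:E) @ \oo --> 0%E.
  apply: (squeeze_cvge _ (cvg_cst 0%E) tail).
  apply: nearW => n; rewrite F2/=.
  apply: le_trans (nneseries_lim_ge (u_ := fun k => (F k x ^+ 2)%:E) n.+1 _) => //.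
  by rewrite big_nat1.
move/fine_cvgP: sq0 => [_ sq0].
have {}sq0 : (fun n => Num.sqrt (F n x ^+ 2)) @ \oo --> (0 : R).
  by rewrite -[X in _ --> X]sqrtr0; apply: (cvg_comp _ _ sq0); exact: sqrt_continuous.
by apply/norm_cvg0P; under eq_fun do rewrite -sqrtr_sqr.
Qed.

End fast_convergence.

Section continuous_version.
Context (R : realType) (T : R).
Context (dO : measure_display) (Omega : measurableType dO).
Context (P : probability Omega R).
Notation mu := (lebesgue_measure \x P)%E.

(** Rounding down keeps the grid time in [0, t], so it never leaves [0, T]. *)
Let grid (n : nat) (t : R) : R := (Num.truncn (t * n.+1%:R))%:R / n.+1%:R.

Let grid_itv n t : 0 <= t -> t - n.+1%:R^-1 <= grid n t <= t.
Proof.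
move=> t0; have n0 : 0 < n.+1%:R :> R by rewrite ltr0n.
have /truncn_itv/andP[h1 h2] : 0 <= t * n.+1%:R by rewrite mulr_ge0.
rewrite /grid; apply/andP; split; last by rewrite ler_pdivrMr.
rewrite ler_pdivlMr// mulrBl mulVf ?gt_eqF// lerBlDr.
by rewrite (le_trans (ltW h2))// -natr1.
Qed.

Let cvg_grid t : 0 <= t -> grid ^~ t @ \oo --> t.
Proof.
move=> t0; have h : (fun n => t - n.+1%:R^-1) @ \oo --> t.
  rewrite -[X in _ --> X]subr0; apply: cvgB; first exact: cvg_cst.
  exact: cvg_harmonic.
apply: (squeeze_cvgr _ h (cvg_cst t)).
by apply: nearW => n; exact: grid_itv.
Qed.

(** Sampling M on the grid gives a process that is jointly measurable, being constant in time on
    each grid cell, and it converges to M wherever the path is continuous. *)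
Lemma ae_continuous_measurable (M : R -> Omega -> R) :
  (forall t, 0 <= t <= T -> measurable_fun setT (M t)) ->
  {ae P, forall w, {within `[0, T], continuous (fun t => M t w)}} ->
  exists2 N : set Omega, measurable N /\ P N = 0%E &
    measurable_fun (`[0, T] `*` ~` N) (fun p : R * Omega => M p.1 p.2).
Proof.
move=> mM [N [mN N0 cN]]; exists N => //.
have mD : measurable (`[0, T] `*` ~` N : set (R * Omega)).
  by apply: measurableX => //; exact: measurableC.
apply: (@measurable_fun_cvg _ _ _ _ (fun n p => M (grid n p.1) p.2)).
  move=> n _ U mU.
  pose I j : set R := `[j%:R / n.+1%:R, j.+1%:R / n.+1%:R[%classic.
  have n0 : 0 < n.+1%:R :> R by rewrite ltr0n.
  have IE j t : 0 <= t -> I j t <-> Num.truncn (t * n.+1%:R) = j.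
    move=> t0; rewrite /I /= in_itv/= ler_pdivrMr// ltr_pdivlMr//.
    rewrite -truncn_eq ?mulr_ge0//; split=> [/eqP//|->]; exact: eqxx.
  have -> : (`[0, T] `*` ~` N) `&` (fun p : R * Omega => M (grid n p.1) p.2) @^-1` U =
      \bigcup_j ((`[0, T] `*` ~` N) `&` (I j `*`
        [set w | (0 <= (j%:R / n.+1%:R : R) <= T) /\ U (M (j%:R / n.+1%:R) w)])).
    apply/seteqP; split=> -[t w].
      move=> [[/= tT nNw] MU]; exists (Num.truncn (t * n.+1%:R)) => //.
      move: (tT); rewrite in_itv/= => /andP[t0 tT'].
      split=> //; split; first exact/IE.
      have /andP[_ gt] := grid_itv n t0; rewrite /= -/(grid n t) (le_trans gt tT') andbT.
      by rewrite divr_ge0.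
    move=> [j _ [[/= tT nNw] [/= Ij [_ MU]]]]; split=> //=.
    move: (tT); rewrite in_itv/= => /andP[t0 tT'].
    by rewrite /grid ((IE j t t0).1 Ij).
  apply: bigcup_measurable => j _; apply: measurableI => //.
  apply: measurableX; first exact: measurable_itv.
  (* M is known to be measurable only at times of [0, T]; at any other grid time the guard in the
     set makes it empty. *)
  have [jT|jT] := boolP (0 <= (j%:R / n.+1%:R : R) <= T); last first.
    by rewrite [X in measurable X](_ : _ = set0)//; apply/seteqP; split=> // w [jT' _];
      exact: (negP jT).
  rewrite [X in measurable X](_ : _ = M (j%:R / n.+1%:R) @^-1` U).
    by rewrite -[X in measurable X]setTI; exact: mM.
  by apply/seteqP; split=> w //= -[].
move=> [t w] [/= tT nNw]; have {}cN : {within `[0, T], continuous (fun t => M t w)}.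
  by apply: contrapT => nc; apply: nNw; exact: cN.
move: (tT); rewrite in_itv/= => /andP[t0 tT'].
have {cN} := (subspace_continuousP _ _).1 cN t tT.
apply: cvg_trans => V /=.
rewrite /fmap/= /within/= => nV; have := cvg_grid t0 nV.
move=> [m _ mV]; exists m => // n mn; apply: mV => //.
have /andP[_ gt] := grid_itv n t0.
by rewrite in_itv/= (le_trans gt tT') andbT divr_ge0.
Qed.

End continuous_version.

Section chaos_coordinates.
Context (R : realType).

Lemma hermite1 (x : R) : hermite 1 x = x.
Proof.
rewrite /hermite expr1 divr1 mulN1r derive1n1 derive1E.
have h : is_derive x 1 (fun y : R => - (y ^+ 2 / 2)) (- x).
  by apply: is_derive_eq; rewrite ?scaler0 ?add0r /GRing.scale/=; field.
have /@derive_val := is_derive1_comp (is_derive_expR _) h.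
rewrite /comp => ->.
by rewrite mulrN mulrNN mulrA -expRD subrr expR0 mul1r.
Qed.

Definition unit_multiindex (i : nat) : multiindex := [fsfun [fsfun] with i |-> 1%N].

Lemma chaos_process_unit (Omega : Type) (W : nat -> R -> Omega -> R) t w i :
  chaos_process W t w (unit_multiindex i) = W i t w.
Proof.
rewrite /chaos_process /unit_multiindex finsupp_with/= finsupp0 fsetU0 big_seq_fset1.
by rewrite fsfun_withE eqxx hermite1.
Qed.

End chaos_coordinates.

Section L2_ito_bounds.
Context (R : realType) (T : R) (T_gt0 : 0 < T) (d : nat).
Context (dO : measure_display) (Omega : measurableType dO).
Context (P : probability Omega R) (P_complete : measure_is_complete P).
Context (B : R -> Omega -> realpow R 'I_d) (B_bm : brownian_motion P T B).

Notation F := (augmented_filtration P B).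
Notation mu := (lebesgue_measure \x P)%E.

Lemma simple_integral_L2_ito (e : simple R Omega d) : simple_process T F e ->
  L2_ito T P B (simple_value e) (simple_integral B e).
Proof.
move=> he; have s k := sqint_slice_simple P_complete B_bm k (lexx 0) (ltW T_gt0) (lexx T) he.
split => //.
- move=> t /andP[t0 tT]; apply: measurable_wrt_sum => i; apply: measurable_wrt_sum => k.
  have [a0 ab bT FX _] := he i.
  (* A term that starts after t has a coefficient that F_t need not know, but its increment stopped
     at t is 0. *)
  have [at_|ta] := leP (simple_start e i) t; last first.
    rewrite (_ : (fun w => _) = fun=> 0); first exact: measurable_wrt_cst.
    apply/funext => w; rewrite (min_idPr (le_trans (ltW ta) ab)) subrr mulr0 //.
  apply: measurable_wrtM.
    by apply: measurable_wrtS (FX k); exact: augmented_filtration_mono.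
  apply: measurable_wrtB; apply: brownian_adapted.
    by rewrite le_min (le_trans a0 ab) t0 ge_min lexx orbT.
  by rewrite a0.
- exists (fun=> e); split => //.
  + move=> k; rewrite /sqcvg; under eq_fun do under eq_integral do rewrite subrr expr0n/=.
    by under eq_fun do rewrite integral0; exact: cvg_cst.
  + move=> t _; rewrite /sqcvg; under eq_fun do under eq_integral do rewrite subrr expr0n/=.
    by under eq_fun do rewrite integral0; exact: cvg_cst.
Qed.

(** M_0 is the L2 limit of integrals that vanish at time 0. Being only a version, M need not vanish
    there pointwise. *)
Lemma L2_ito_at0 phi M : L2_ito T P B phi M -> ip P (M 0) (M 0) = 0.
Proof.
move=> ito; have T0 : 0 <= (0 : R) <= T by rewrite lexx ltW.
have sM := L2_ito_sqint P_complete B_bm T0 ito.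
have [_ _ [e [he _ cM]]] := ito.
have sI n := sqint_simple_integral_at P_complete B_bm T0 (he n).
have L := sqcvg_ip sI sM sI sM (cM 0 T0) (cM 0 T0).
apply/esym; apply: (cvg_unique _ _ L) => //.
rewrite (_ : (fun n => _) = fun=> 0); first exact: cvg_cst.
apply/funext => n; rewrite (_ : simple_integral _ _ _ = fun=> 0) ?ip0l//.
apply/funext => w; apply: big1 => i _; have [s0 sc _ _ _] := he n i.
by rewrite /dot big1// => k _; rewrite (min_idPr s0) (min_idPr (le_trans s0 sc)) subrr mulr0.
Qed.

(** The bound does not depend on r, so a single sequence of coefficients approximates B_q well at
    all later times. *)
Lemma L2_ito_sqr_le phi M r : 0 <= r <= T -> L2_ito T P B phi M ->
  (\int[P]_w (M r w ^+ 2)%:E <= H2_sqnorm P T phi)%E.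
Proof.
move=> rT ito; have T0 : 0 <= (0 : R) <= T by rewrite lexx ltW.
have sr := L2_ito_sqint P_complete B_bm rT ito.
have s0 := L2_ito_sqint P_complete B_bm T0 ito.
have M0 := L2_ito_at0 ito.
have r0 : ip P (M r) (M 0) = 0.
  apply/eqP; rewrite -sqrf_eq0 eq_le sqr_ge0 andbT.
  by rewrite (le_trans (ip_cauchy_schwarz sr s0))// M0 mulr0.
have [sphi _ _] := ito; case/andP: (rT) => r0' rT'.
rewrite -ip_sqrE// H2_sqnormE => [|k]; last by case: (sphi k).
have := L2_ito_isometry T_gt0 P_complete B_bm (lexx 0) r0' rT' ito.
have := ip_sqrB 1 sr s0; under eq_fun do rewrite mul1r.
move=> -> E; rewrite M0 r0 !mulr0 subr0 addr0 in E; rewrite E.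
rewrite -sumEFin; apply: lee_sum => k _; have [mphi phi2] := sphi k.
have sk := sqint_slice (lexx 0) rT' (sphi k).
rewrite ip_sqrE//; apply: ge0_le_integral => //.
- by move=> p _; rewrite lee_fin sqr_ge0.
- by apply/measurable_EFinP; apply: measurable_funX; case: sk.
- by apply/measurable_EFinP; exact: measurable_funX.
- move=> p _; rewrite lee_fin (sliceS phi k p (lexx 0) rT').
  by case: ifP => _; rewrite ?mul1r// mul0r expr0n sqr_ge0.
Qed.

End L2_ito_bounds.

(** * Recovering past values of B from the current state *)

Section brownian_representation.
Context (R : realType) (T : R) (T_gt0 : 0 < T) (d : nat).
Context (dO : measure_display) (Omega : measurableType dO).
Context (P : probability Omega R) (P_complete : measure_is_complete P).
Context (B : R -> Omega -> realpow R 'I_d) (B_bm : brownian_motion P T B).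
Context (h : nat -> R -> realpow R 'I_d) (h_basis : orthonormal_basis T h).
Context (W : nat -> R -> Omega -> R).
Context (W_ito : forall i, ito_integral P T B (fun t _ => h i t) (W i)).

Notation F := (augmented_filtration P B).
Notation mu := (lebesgue_measure \x P)%E.

Lemma L2vec_slice_measurable (f : R -> realpow R 'I_d) k : L2vec T f ->
  measurable_fun setT (slice 0 T (fun t (_ : Omega) => f t) k).
Proof.
move=> [mf _]; apply: measurable_slice_fun.
have mfk : measurable_fun `[0, T] (fun t => f t k).
  exact: (measurableT_comp (measurable_coord (R := R) k) mf).
apply: (measurable_comp _ _ mfk) => //.
- by move=> _ [p [pT _] <-].
- by apply: measurable_funTS; exact: measurable_fst.
Qed.

Lemma H2_sqnorm_deterministic (f : R -> realpow R 'I_d) :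
  H2_sqnorm P T (fun t _ => f t) =
  (\int[lebesgue_measure]_(t in `[0%R, T]) ((norm2 (f t) ^+ 2)%R)%:E)%E.
Proof.
rewrite /H2_sqnorm; pose c : \bar R :=
  (\int[lebesgue_measure]_(t in `[0%R, T]) ((norm2 (f t) ^+ 2)%R)%:E)%E.
transitivity (c * P setT)%E; first exact: (@integral_cst _ _ _ P setT measurableT c).
by rewrite [P setT]probability_setT mule1.
Qed.

Lemma basis_L2_ito i : L2_ito T P B (fun t _ => h i t) (W i).
Proof.
have [hL2 _ _] := h_basis.
apply: (ito_integral_L2_ito T_gt0 P_complete B_bm) => //.
apply: sqint_slice_H2 => [k|]; first exact: L2vec_slice_measurable.
by rewrite H2_sqnorm_deterministic; case: (hL2 i).
Qed.

Lemma combination_L2_ito phi M (c : nat -> R) n : L2_ito T P B phi M ->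
  L2_ito T P B (fun t w k => phi t w k - \sum_(i < n) c i * h i t k)
               (fun t w => M t w - \sum_(i < n) c i * W i t w).
Proof.
move=> ito; elim: n => [|n ih].
  rewrite (_ : (fun t w k => _) = phi); last first.
    by apply/funext => t; apply/funext => w; apply/funext => k; rewrite big_ord0 subr0.
  rewrite (_ : (fun t w => _) = M)//.
  by apply/funext => t; apply/funext => w; rewrite big_ord0 subr0.
have := L2_ito_lin T_gt0 P_complete B_bm (- c n) (basis_L2_ito n) ih.
congr (L2_ito _ _ _ _ _).
  apply/funext => t; apply/funext => w; apply/funext => k.
  by rewrite big_ord_recr/=; ring.
by apply/funext => t; apply/funext => w; rewrite big_ord_recr/=; ring.
Qed.

Let coord_indicator (q : R) (k : 'I_d) (t : R) : realpow R 'I_d :=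
  fun j => if 0 < t <= q then (j == k)%:R else 0.

Let coord_simple (q : R) (k : 'I_d) : simple R Omega d :=
  @Simple _ _ _ 1 (fun=> 0) (fun=> q) (fun _ _ j => (j == k)%:R).

Let coord_simple_process q k : 0 <= q <= T -> simple_process T F (coord_simple q k).
Proof.
move=> /andP[q0 qT] i; split => //=.
- by move=> j; exact: measurable_wrt_cst.
- by exists 1 => _ j; case: (j == k); rewrite ?normr1 ?normr0.
Qed.

Let coord_simple_value q k : simple_value (coord_simple q k) = fun t _ => coord_indicator q k t.
Proof.
apply/funext => t; apply/funext => w; apply/funext => j.
by rewrite /simple_value big_ord1.
Qed.

Let coord_simple_integral q k r w : 0 <= q -> q <= r ->
  simple_integral B (coord_simple q k) r w = B q w k - B 0 w k.
Proof.
move=> q0 qr; rewrite /simple_integral big_ord1 /dot/= (bigD1 k)//= eqxx mul1r.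
rewrite (min_idPl qr) (min_idPl (le_trans q0 qr)) big1 ?addr0// => j jk.
by rewrite (negbTE jk) mul0r.
Qed.

Let coord_indicator_L2vec (q : R) k : 0 <= q <= T -> L2vec T (coord_indicator q k).
Proof.
move=> qT; split.
  apply: measurable_realpow => j.
  rewrite (_ : (fun t => _) = fun t => (j == k)%:R * \1_(`]0, q]%classic : set R) t); last first.
    apply/funext => t; rewrite indicE mem_setE in_itv/= /coord_indicator.
    by case: ifP; rewrite ?mulr1 ?mulr0.
  by apply: measurable_funM.
rewrite -H2_sqnorm_deterministic -coord_simple_value.
have s j := sqint_slice_simple P_complete B_bm j (lexx 0) (ltW T_gt0) (lexx T)
  (@coord_simple_process q k qT).
rewrite H2_sqnormE => [|j]; last by case: (s j).
by apply: lte_sum_pinfty => j _; case: (s j).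
Qed.

Lemma ito_family_measurable : exists N : set Omega, [/\ measurable N, P N = 0%E &
  forall i, measurable_fun (`[0, T] `*` ~` N) (fun p : R * Omega => W i p.1 p.2)].
Proof.
have /choice[N NW] i : exists Ni : set Omega, [/\ measurable Ni, P Ni = 0%E &
    measurable_fun (`[0, T] `*` ~` Ni) (fun p : R * Omega => W i p.1 p.2)].
  have [FW cW _] := W_ito i.
  have [t tT|Ni [mN N0] mW] := @ae_continuous_measurable R T dO Omega P (W i) _ cW.
    apply: (adapted_measurable P_complete B_bm _ (FW t _)); first by case/andP: tT.
    by rewrite in_itv.
  by exists Ni.
have mN : measurable (\bigcup_i N i) by apply: bigcup_measurable => i _; case: (NW i).
exists (\bigcup_i N i); split => //.
  apply/negligibleP => //; apply: negligible_bigcup => i; have [mNi Ni0 _] := NW i.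
  exact/negligibleP.
move=> i; have [mNi _ mWi] := NW i; apply: measurable_funS mWi.
  by apply: measurableX => //; exact: measurableC.
by move=> p /= [pT pN]; split=> //= Np; apply: pN; exists i.
Qed.

Lemma brownian_repr q k : 0 <= q <= T ->
  exists2 f : realpow R multiindex -> R, measurable_fun setT f &
    {ae mu, forall p : R * Omega, q < p.1 <= T ->
       f (chaos_process W p.1 p.2) = B q p.2 k}.
Proof.
move=> qT; have /andP[q0 qT'] := qT.
have [_ _ /(_ _ (coord_indicator_L2vec k qT)) dense] := h_basis.
(* Errors that decay geometrically, as [ae_cvg0_sqr_summable] requires. *)
have eps0 n : 0 < 1 / (2 ^ (n + 1))%:R :> R by rewrite divr_gt0// ltr0n expn_gt0.
have /choice[Nc Ncn] n : exists Nc : nat * (nat -> R),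
    (H2_sqnorm P T (fun t (_ : Omega) j => (coord_indicator q k t j -
        \sum_(i < Nc.1) Nc.2 i * h i t j)%R) < (1 / (2 ^ (n + 1))%:R)%:E)%E.
  have [N [c Nc]] := dense _ (eps0 n); exists (N, c).
  by rewrite (H2_sqnorm_deterministic (fun t j => coord_indicator q k t j -
        \sum_(i < N) c i * h i t j)).
pose S n (x : nat -> R) := \sum_(i < (Nc n).1) (Nc n).2 i * x i.
have itoS n : L2_ito T P B (fun t (_ : Omega) j => coord_indicator q k t j -
        \sum_(i < (Nc n).1) (Nc n).2 i * h i t j)
    (fun t w => simple_integral B (coord_simple q k) t w - S n (fun i => W i t w)).
  have := combination_L2_ito (Nc n).2 (Nc n).1 (simple_integral_L2_ito T_gt0
    P_complete B_bm (@coord_simple_process q k qT)).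
  by rewrite coord_simple_value.
have [N [mN N0 mW]] := ito_family_measurable.
pose D : set (R * Omega) := `]q, T] `*` ~` N.
have mD : measurable D by apply: measurableX => //; exact: measurableC.
have mWD i : measurable_fun D (fun p => W i p.1 p.2).
  apply: measurable_funS (mW i); first by apply: measurableX => //; exact: measurableC.
  move=> p /= [pT pN]; split=> //=; move: pT; rewrite !in_itv/= => /andP[qp pT].
  by apply/andP; split=> //; exact: le_trans q0 (ltW qp).
have mB t : 0 <= t <= T -> measurable_fun setT (fun p : R * Omega => B t p.2 k).
  by move=> tT; apply: (measurableT_comp (brownian_measurable B_bm k tT)).
(* The error of the n-th combination. It is cut to [D], where all the W^i are jointly measurable;
   B_0 stays in the formula because it vanishes only almost surely. *)
pose E n (p : R * Omega) := B q p.2 k - B 0 p.2 k - S n (fun i => W i p.1 p.2).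
have mE n : measurable_fun setT (E n \_ D).
  apply/(measurable_restrictT _ mD); apply: measurable_funB.
    by apply: measurable_funTS; apply: measurable_funB; apply: mB; rewrite // lexx ltW.
  by apply: measurable_sum => i; exact: (measurable_funM (measurable_cst _) (mWD i)).
(* At each t in (q, T] the second moment of the error is at most the squared norm of the remainder;
   integration over time costs a factor T. *)
have intE n : (\int[mu]_p ((E n \_ D) p ^+ 2)%:E <= (T / (2 ^ (n + 1))%:R)%:E)%E.
  rewrite fubini_tonelli1//=; last 2 first.
  - by apply/measurable_EFinP; exact: measurable_funX (mE n).
  - by move=> p; rewrite lee_fin sqr_ge0.
  apply: (@le_trans _ _ (\int[lebesgue_measure]_(t in `]0%R, T])
      (1 / (2 ^ (n + 1))%:R)%:E)%E); last first.
    rewrite integral_cst// [X in (_ * X)%E](_ : _ = T%:E).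
      by rewrite -EFinM mulrC mul1r.
    transitivity (lebesgue_measure (`]0, T]%classic : set R)) => //.
    by rewrite lebesgue_measure_itv/= lte_fin T_gt0 -EFinB subr0.
  rewrite [leRHS]integral_mkcond; apply: ge0_le_integral => //.
  - by move=> t _; apply: integral_ge0 => w _; rewrite lee_fin sqr_ge0.
  - apply: measurable_fun_fubini_tonelli_F => //.
      by apply/measurable_EFinP; exact: measurable_funX (mE n).
    by move=> p; rewrite lee_fin sqr_ge0.
  - by apply/(measurable_restrictT _ (measurable_itv _)); exact: measurable_cst.
  - move=> t _; rewrite /fubini_F patchE.
    have [qt|qt] := boolP (q < t <= T); last first.
      rewrite (_ : integral _ _ _ = 0%E); last first.
        apply: integral0_eq => w _; rewrite patchE memNset ?expr0n//.
        by move=> -[/=]; rewrite in_itv/= (negbTE qt).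
      by case: ifP => _; rewrite lee_fin// ltW.
    have tT0 : 0 <= t <= T by move/andP: qt => [/ltW/(le_trans q0) -> ->].
    rewrite mem_set; last by rewrite /= in_itv/=; case/andP: qt => /(le_lt_trans q0) -> ->.
    apply: le_trans (ltW (Ncn n)).
    apply: le_trans (L2_ito_sqr_le T_gt0 P_complete B_bm tT0 (itoS n)).
    have [mM _] := L2_ito_sqint P_complete B_bm tT0 (itoS n).
    apply: ge0_le_integral => //.
    + by move=> w _; rewrite lee_fin sqr_ge0.
    + apply/measurable_EFinP; apply: measurable_funX.
      apply: (measurableT_comp (mE n)).
      by apply: measurable_fun_pair; [exact: measurable_cst|exact: measurable_id].
    + by apply/measurable_EFinP; exact: measurable_funX.
    + move=> w _; rewrite lee_fin patchE; case: ifPn => _; last by rewrite expr0n sqr_ge0.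
      rewrite /E/= (coord_simple_integral k w q0)//.
      by case/andP: qt => /ltW.
have E0 := @ae_cvg0_sqr_summable _ _ R mu (fun n => E n \_ D) T mE intE.
(* The limit superior is a measurable functional defined everywhere. *)
pose u (x : realpow R multiindex) : \bar R :=
  limn_esup (fun n => (S n (fun i => x (unit_multiindex i)))%:E).
have mu' : measurable_fun setT u.
  apply: measurable_fun_limn_esup => n; apply/measurable_EFinP.
  apply: measurable_sum => i; apply: measurable_funM => //.
  exact: measurable_coord.
exists (fine \o u); first exact: measurableT_comp.
have aeN : {ae P, forall w, ~ N w} by exists N; split => // w /= /contrapT.
have aeB : {ae P, forall w, forall k, B 0 w k = 0} by case: B_bm.
apply: filterS3 E0 (ae_snd aeN) (ae_snd aeB) => p E0 nN B0 qpT.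
have SB : (fun n => S n (fun i => W i p.1 p.2)) @ \oo --> B q p.2 k.
  have Dp : p \in D by rewrite mem_set//; split=> //=; rewrite in_itv.
  have -> : (fun n => S n (fun i => W i p.1 p.2)) = (fun n => B q p.2 k - (E n \_ D) p).
    by apply/funext => n; rewrite patchE Dp /E B0; ring.
  by rewrite -[X in _ --> X]subr0; apply: cvgB => //; exact: cvg_cst.
rewrite /u /=.
under eq_fun do under eq_fun do rewrite chaos_process_unit.
have {}SB : (fun n => (S n (fun i => W i p.1 p.2))%:E) @ \oo --> (B q p.2 k)%:E.
  by apply/fine_cvgP; split; [exact: nearW|exact: SB].
by rewrite (cvg_limn_einf_sup SB).2.
Qed.

End brownian_representation.

#[local] Instance ae_product_filter (R : realType) (dO : measure_display)
    (Omega : measurableType dO) (P : probability Omega R) :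
  Filter (nbhs (almost_everywhere (lebesgue_measure \x P)%E)).
Proof. exact: ae_filter_ringOfSetsType. Qed.

(** * Predictable sets and functions in terms of the state *)

Section state_representation.
Context (R : realType) (T : R) (T_gt0 : 0 < T) (d : nat).
Context (dO : measure_display) (Omega : measurableType dO).
Context (P : probability Omega R) (P_complete : measure_is_complete P).
Context (B : R -> Omega -> realpow R 'I_d) (B_bm : brownian_motion P T B).
Context (h : nat -> R -> realpow R 'I_d) (h_basis : orthonormal_basis T h).
Context (W : nat -> R -> Omega -> R).
Context (W_ito : forall i, ito_integral P T B (fun t _ => h i t) (W i)).

Notation F := (augmented_filtration P B).
Notation mu := (lebesgue_measure \x P)%E.

Let state (p : R * Omega) : R * realpow R multiindex := (p.1, chaos_process W p.1 p.2).

(** The sets that are preimages under the state up to null sets, as far as times in [0, T] are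
    concerned. They are closed under countable unions and relative complements, so generators
    suffice. *)
Definition state_set (C : set (R * Omega)) :=
  exists2 D : set (R * realpow R multiindex), measurable D &
    {ae mu, forall p, p.1 \in `[0, T] -> (C p <-> D (state p))}.

Lemma state_set0 : state_set set0.
Proof. by exists set0 => //; exact: aeW. Qed.

Lemma state_set_bigcup (C : (set (R * Omega))^nat) :
  (forall n, state_set (C n)) -> state_set (\bigcup_n C n).
Proof.
move=> hC; have /choice[D hD] n : exists D, measurable D /\
    {ae mu, forall p, p.1 \in `[0, T] -> (C n p <-> D (state p))}.
  by have [D mD CD] := hC n; exists D.
exists (\bigcup_n D n); first by apply: bigcup_measurable => n _; case: (hD n).
have : {ae mu, forall p, forall n, p.1 \in `[0, T] -> (C n p <-> D n (state p))}.
  by apply: ae_foralln => n; case: (hD n).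
move=> H; apply: filterS H => p CD pT; split=> -[n _ Cp]; exists n => //.
  exact/(CD n pT).
exact/(CD n pT).
Qed.

(** With the strip (s, t] fixed, the property is propagated through the sigma-algebra F_s. A
    generator involves B_q with q <= s, and q lies strictly before every time in the strip, as
    [brownian_repr] demands. *)
Lemma state_set_rect s t A : 0 <= s -> s < t -> t <= T -> F s A ->
  state_set (`]s, t] `*` A).
Proof.
move=> s0 st tT; move: A; apply: smallest_sub.
  split => [|A hA|A hA].
  - by rewrite setX0; exact: state_set0.
  - have [D mD CD] := hA; exists ((`]s, t] `*` setT) `\` D).
      by apply: measurableD => //; exact: measurableX.
    apply: filterS CD => p CD /CD{}CD; split=> -[/= pt nA].
      by split => // /CD[_ Ap]; case: nA.
    by case: pt => pt _; split => //; split => // Ap; apply: nA; apply/CD.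
  - rewrite (_ : `]s, t] `*` _ = \bigcup_k (`]s, t] `*` A k)).
      by apply: state_set_bigcup => n; exact: hA.
    apply/seteqP; split=> p; first by move=> [pt [k _ Ak]]; exists k.
    by move=> [k _ [pt Ak]]; split => //; exists k.
move=> A [[q [k [U [+ mU ->]]]]|nA].
- rewrite in_itv/= => /andP[q0 qs].
  have qT : 0 <= q <= T by rewrite q0 (le_trans qs)// (le_trans (ltW st)).
  have [f mf fB] := brownian_repr T_gt0 P_complete B_bm h_basis W_ito k qT.
  exists ((`]s, t] `*` (f @^-1` U))).
    by apply: measurableX => //; rewrite -[X in measurable X]setTI; exact: mf.
  apply: filterS fB => p fB _.
  have {}fB : p.1 \in `]s, t] -> f (chaos_process W p.1 p.2) = B q p.2 k.
    rewrite in_itv/= => /andP[sp pt]; apply: fB.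
    by rewrite (le_lt_trans qs sp) (le_trans pt tT).
  split=> -[/= pt UB]; split => //=; first by rewrite fB.
  by rewrite -fB.
(* A negligible generator is represented by the empty set. *)
- exists set0 => //.
  have : {ae P, forall w, ~ A w} by apply: negligibleS nA => w /= /contrapT.
  move=> /ae_snd H; apply: filterS H => p nAp _.
  by split=> // -[_ /nAp].
Qed.

Lemma state_set_predictable C : predictable_sets T F C -> state_set C.
Proof.
move: C; apply: smallest_sub.
  split => [|C hC|C hC]; [exact: state_set0| |by apply: state_set_bigcup => n; exact: hC].
  have [D mD CD] := hC; exists (~` D); first exact: measurableC.
  apply: filterS CD => p CD pT; have {}CD := CD pT; split.
    by move=> [_ nC] /CD.
  by move=> nD; split => // /CD.
move=> C [[A [FA ->]]|[s [t [A [s0 st tT FA ->]]]]]; last exact: state_set_rect.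
(* Rectangles at time 0 are null for dt x P. *)
exists set0 => //; apply: filterS (ae_fst_neq P 0) => p p0 _; split=> // -[/= pz _].
exact: p0.
Qed.

(** An enumeration of the rationals; the default 0 is itself rational. *)
Let rational_seq (n : nat) : R := if @choice.unpickle rat n is Some q then ratr q else 0.

Lemma state_fun (phi : R * Omega -> R) :
  (forall U, measurable U -> state_set ((`[0, T] `*` setT) `&` (phi @^-1` U))) ->
  exists2 u : R * realpow R multiindex -> R, measurable_fun setT u &
    {ae mu, forall p, p.1 \in `[0, T] -> phi p = u (state p)}.
Proof.
move=> hphi; have /choice[D hD] n : exists D : set (R * realpow R multiindex),
    measurable D /\ {ae mu, forall p, p.1 \in `[0, T] ->
      (rational_seq n < phi p <-> D (state p))}.
  have [//|D mD CD] := hphi (`]rational_seq n, +oo[%classic).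
  exists D; split => //; apply: filterS CD => p CD pT; rewrite -(CD pT).
  split=> [lt|[_ /=]]; last by rewrite in_itv/= andbT.
  by split => //=; rewrite in_itv/= lt.
(* The value -oo leaves the supremum over n unaffected. *)
pose v n (z : R * realpow R multiindex) : \bar R :=
  if `[< D n z >] then (rational_seq n)%:E else -oo%E.
have mv n : measurable_fun setT (v n).
  apply: measurable_fun_ifT => //; apply: (measurable_fun_bool true).
  rewrite setTI (_ : _ @^-1` _ = D n); first by case: (hD n).
  by apply/seteqP; split=> z /= /asboolP.
(* [phi] is the supremum of the rationals below it. *)
exists (fun z => fine (esups (v ^~ z) 0%N)).
  by apply: measurableT_comp => //; exact: measurable_fun_esups.
have : {ae mu, forall p, forall n, p.1 \in `[0, T] ->
    (rational_seq n < phi p <-> D n (state p))}.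
  by apply: ae_foralln => n; case: (hD n).
move=> H; apply: filterS H => p CD pT.
suff -> : esups (v ^~ (state p)) 0%N = (phi p)%:E by [].
apply/eqP; rewrite eq_le; apply/andP; split.
  apply: ge_ereal_sup => _ [n _ <-]; rewrite /v; case: asboolP => [|_]; last exact: leNye.
  by move=> /(CD n pT)/ltW; rewrite lee_fin.
apply/lee_addgt0Pr => e e0.
have [q] : exists q : rat, ratr q \in `]phi p - e, phi p[.
  by apply: rat_in_itvoo; rewrite ltrBlDr ltrDl.
rewrite in_itv/= => /andP[qe qp].
have qn : rational_seq (choice.pickle q) = ratr q by rewrite /rational_seq choice.pickleK.
apply: (@le_trans _ _ ((ratr q)%:E + e%:E)%E).
  by rewrite -EFinD lee_fin -lerBlDr ltW.
apply: leeD => //; apply: ereal_sup_ubound; exists (choice.pickle q) => //.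
rewrite /v; case: asboolP => [_|]; first by rewrite qn.
by case; apply/(CD (choice.pickle q) pT); rewrite qn.
Qed.

End state_representation.

(** * Uniqueness for the backward equation *)

Section uniqueness.
Context (R : realType) (T : R) (T_gt0 : 0 < T) (d : nat).
Context (dO : measure_display) (Omega : measurableType dO).
Context (P : probability Omega R) (P_complete : measure_is_complete P).
Context (B : R -> Omega -> realpow R 'I_d) (B_bm : brownian_motion P T B).

Notation F := (augmented_filtration P B).
Notation mu := (lebesgue_measure \x P)%E.

Notation lift f := (fun t w (_ : 'I_1) => f t w).
Notation sl a b f := (slice a b (lift f) ord0).

Lemma sqint_section (f : R * Omega -> R) : sqint mu f ->
  {ae P, forall w, sqint lebesgue_measure (fun t => f (t, w))}.
Proof.
move=> sf; have [mf _] := sf.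
apply: filterS (ae_integrable2 (sqint_sqr sf)) => w /integrableP[mfw foo].
split; first exact: measurable_section.
apply: le_lt_trans foo; apply: ge0_le_integral => //.
- by move=> t _; rewrite lee_fin sqr_ge0.
- exact: measurableT_comp.
- by move=> t _; exact: lee_abs.
Qed.

(** Cauchy-Schwarz against the indicator of (a, b]. *)
Lemma sqr_integral_slice a b (f : R -> Omega -> R) w : a <= b ->
  sqint lebesgue_measure (fun t => sl a b f (t, w)) ->
  ((\int[lebesgue_measure]_(s in `]a, b]) f s w)%:E ^+ 2 <=
   (b - a)%:E * \int[lebesgue_measure]_t (sl a b f (t, w) ^+ 2)%:E)%E.
Proof.
move=> ab sf; have [msf _] := sf.
pose I : R -> R := \1_(`]a, b]%classic : set R).
have mI : measurable_fun setT I by exact: measurable_indic.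
have Isq : (\int[lebesgue_measure]_t (I t ^+ 2)%:E = (b - a)%:E)%E.
  transitivity (\int[lebesgue_measure]_t (I t)%:E)%E.
    by apply: eq_integral => t _; rewrite /I indicE; case: (_ \in _); rewrite ?expr1n ?expr0n.
  rewrite integral_indic// setIT.
  transitivity (lebesgue_measure (`]a, b]%classic : set R)) => //.
  rewrite lebesgue_measure_itv/= lte_fin; case: ltP => // ba.
  by rewrite (_ : a = b) ?subrr//; apply/eqP; rewrite eq_le ab ba.
have sI : sqint lebesgue_measure I by split; [exact: mI|rewrite Isq ltry].
have := ip_cauchy_schwarz sf sI.
rewrite -lee_fin [leRHS]EFinM (ip_sqrE sf) (ip_sqrE sI) Isq muleC; apply: le_trans.
rewrite -EFin_expe lee_fin le_eqVlt; apply/orP; left; apply/eqP; congr (_ ^+ 2).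
rewrite Rintegral_mkcond; apply: eq_Rintegral => t _.
rewrite patchE /I indicE /slice/= mem_setE in_itv/=.
by case: ifP => _; rewrite ?mulr1 ?mulr0.
Qed.

Lemma ip_le d' (S : measurableType d') (m : {measure set S -> \bar R}) (f g : S -> R) :
  sqint m f -> sqint m g -> (forall x, `|f x| <= `|g x|) -> ip m f f <= ip m g g.
Proof.
move=> sf sg fg; have [mf _] := sf; have [mg _] := sg.
rewrite -lee_fin !ip_sqrE//; apply: ge0_le_integral => //.
- by move=> x _; rewrite lee_fin sqr_ge0.
- by apply/measurable_EFinP; exact: measurable_funX.
- by apply/measurable_EFinP; exact: measurable_funX.
- move=> x _; rewrite lee_fin -(real_normK (num_real (f x))) -(real_normK (num_real (g x))).
  by rewrite lerXn2r// nnegrE.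
Qed.

Lemma ip_eq0_ae d' (S : measurableType d') (m : {measure set S -> \bar R}) (f : S -> R) :
  sqint m f -> ip m f f = 0 -> {ae m, forall x, f x = 0}.
Proof.
move=> sf f0; have [mf _] := sf.
have : (\int[m]_x `|(f x ^+ 2)%:E| = 0)%E.
  rewrite -[RHS]/(0%:E) -f0 ip_sqrE//; apply: eq_integral => x _.
  by rewrite gee0_abs// lee_fin sqr_ge0.
move/(ae_eq_integral_abs m measurableT) => h.
have {h} : ae_eq m setT (fun x => (f x ^+ 2)%:E) (cst 0%E).
  by apply: h; apply/measurable_EFinP; exact: measurable_funX.
by apply: filterS => x /(_ I) [] /eqP; rewrite sqrf_eq0 => /eqP.
Qed.

Lemma slice_sqr_le a b C (f : R -> Omega -> R) : a <= b -> 0 <= C ->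
  sqint mu (sl a b f) ->
  (forall t, a < t <= b -> (\int[P]_w (f t w ^+ 2)%:E <= C%:E)%E) ->
  ip mu (sl a b f) (sl a b f) <= (b - a) * C.
Proof.
move=> ab C0 sf fC; have [mf _] := sf.
rewrite -lee_fin ip_sqrE// fubini_tonelli1//=; last 2 first.
- by apply/measurable_EFinP; exact: measurable_funX mf.
- by move=> p; rewrite lee_fin sqr_ge0.
apply: (@le_trans _ _ (\int[lebesgue_measure]_(t in `]a, b]) C%:E)%E); last first.
  rewrite integral_cst// [X in (_ * X)%E](_ : _ = (b - a)%:E).
    by rewrite -EFinM mulrC.
  transitivity (lebesgue_measure (`]a, b]%classic : set R)) => //.
  rewrite lebesgue_measure_itv/= lte_fin; case: ltP => // ba.
  by rewrite (_ : a = b) ?subrr//; apply/eqP; rewrite eq_le ab ba.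
rewrite [leRHS]integral_mkcond; apply: ge0_le_integral => //.
- by move=> t _; apply: integral_ge0 => w _; rewrite lee_fin sqr_ge0.
- apply: measurable_fun_fubini_tonelli_F => //.
    by apply/measurable_EFinP; exact: measurable_funX mf.
  by move=> p; rewrite lee_fin sqr_ge0.
- by apply/(measurable_restrictT _ (measurable_itv _)); exact: measurable_cst.
- move=> t _; rewrite /fubini_F patchE.
  have [tab|tab] := boolP (a < t <= b).
    rewrite mem_set/= ?in_itv//; apply: le_trans (fC t tab); rewrite le_eqVlt; apply/orP; left.
    by apply/eqP/eq_integral => w _; rewrite /slice/= tab.
  rewrite memNset/= ?in_itv/=; last exact/negP.
  rewrite (_ : integral _ _ _ = 0%E)//; apply: integral0_eq => w _.
  by rewrite /slice/= (negbTE tab) expr0n.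
Qed.

(** * Energy estimate for the difference of two solutions *)

Section core.
Context (y gamma N : R -> Omega -> R) (z : R -> Omega -> realpow R 'I_d) (K : R).
Context (K_ge0 : 0 <= K).
Context (y_adapted : forall t, 0 <= t <= T -> measurable_wrt (F t) (y t)).
Context (sy : sqint mu (sl 0 T y)).
Context (sgamma : sqint mu (sl 0 T gamma)).
Context (ito : L2_ito T P B z N).
Context (gamma_le : {ae mu, forall p : R * Omega, 0 < p.1 <= T ->
  gamma p.1 p.2 ^+ 2 <= K * (y p.1 p.2 ^+ 2 + \sum_k z p.1 p.2 k ^+ 2)}).
Context (equation : forall a b, 0 <= a -> a <= b -> b <= T -> {ae P, forall w,
  y a w - y b w = \int[lebesgue_measure]_(s in `]a, b]) gamma s w - (N b w - N a w)}).

Let IY a b := ip mu (sl a b y) (sl a b y).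
Let IZ a b := \sum_k ip mu (slice a b z k) (slice a b z k).

Let sz k : sqint mu (slice 0 T z k). Proof. by case: ito. Qed.

Let gamma_energy a b : 0 <= a -> a <= b -> b <= T ->
  (\int[mu]_p (sl a b gamma p ^+ 2)%:E <= (K * (IY a b + IZ a b))%:E)%E.
Proof.
move=> a0 ab bT.
have s1 := sqint_slice a0 bT sy; have [m1 _] := s1.
have s2 k := sqint_slice a0 bT (sz k).
have [mg _] := sqint_slice a0 bT sgamma.
have m2 k : measurable_fun setT (fun p => (slice a b z k p ^+ 2)%:E).
  by have [m2 _] := s2 k; apply/measurable_EFinP; exact: measurable_funX m2.
have my : measurable_fun setT (fun p => (sl a b y p ^+ 2)%:E).
  by apply/measurable_EFinP; exact: measurable_funX m1.
have ge0 x : (0 <= (x ^+ 2 : R)%:E)%E by rewrite lee_fin sqr_ge0.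
have -> : (K * (IY a b + IZ a b))%:E =
    (\int[mu]_p (K%:E * ((sl a b y p ^+ 2)%:E + \sum_k (slice a b z k p ^+ 2)%:E)))%E.
  have ms : measurable_fun setT (fun p => \sum_k (slice a b z k p ^+ 2)%:E)%E.
    by apply: emeasurable_sum => k; exact: m2.
  rewrite ge0_integralZl//; last 2 first.
  - exact: emeasurable_funD.
  - by move=> p _; rewrite adde_ge0// sume_ge0.
  rewrite ge0_integralD//; last by move=> p _; rewrite sume_ge0.
  rewrite ge0_integral_sum// EFinM EFinD -sumEFin ip_sqrE//.
  by congr (_ * (_ + _))%E; apply: eq_bigr => k _; rewrite ip_sqrE.
apply: ae_ge0_le_integral => //.
- by apply/measurable_EFinP; exact: measurable_funX mg.
- by move=> p _; rewrite mule_ge0// adde_ge0// sume_ge0.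
- apply: measurable_funeM; apply: emeasurable_funD => //.
  by apply: emeasurable_sum => k; exact: m2.
apply: filterS gamma_le => p gp _; rewrite sumEFin -EFinD -EFinM lee_fin /slice.
case: ifPn => [/andP[ap pb]|_]; last first.
  by rewrite expr0n/= mulr_ge0// addr_ge0// sumr_ge0// => k _; rewrite sqr_ge0.
by apply: gp; rewrite (le_lt_trans a0 ap) (le_trans pb bT).
Qed.

Let IY_ge0 a b : 0 <= IY a b. Proof. exact: ip_ge0. Qed.

Let IZ_ge0 a b : 0 <= IZ a b. Proof. by apply: sumr_ge0 => k _; exact: ip_ge0. Qed.

Let IY_mono a t b : 0 <= a -> a <= t -> b <= T -> IY t b <= IY a b.
Proof.
move=> a0 at_ bT; apply: ip_le.
- exact: (sqint_slice (le_trans a0 at_) bT sy).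
- exact: (sqint_slice a0 bT sy).
- move=> p; rewrite (sliceS _ _ p at_ (lexx b)) normrM.
  by case: ifP => _; rewrite ?normr1 ?mul1r// normr0 mul0r.
Qed.

(** [V], the sum of y_t and the increment of N, equals int_t^b gamma almost surely, so
    Cauchy-Schwarz in time bounds its second moment. Hence [V], and then y_t, is square-integrable;
    now orthogonality and the isometry turn the second moment of [V] into the left-hand side. *)
Let energy t b : 0 <= t -> t <= b -> b <= T -> {ae P, forall w, y b w = 0} ->
  sqint P (y t) /\
  ip P (y t) (y t) + IZ t b <= (b - t) * (K * (IY t b + IZ t b)).
Proof.
move=> t0 tb bT yb0.
have tT : 0 <= t <= T by rewrite t0 (le_trans tb).
have bT' : 0 <= b <= T by rewrite (le_trans t0 tb).
have sNt := L2_ito_sqint P_complete B_bm tT ito.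
have sNb := L2_ito_sqint P_complete B_bm bT' ito.
have sN : sqint P (fun w => N b w - N t w) by exact: sqintB.
have my : measurable_fun setT (y t).
  by apply: (adapted_measurable P_complete B_bm _ (y_adapted tT)); case/andP: tT.
pose V w := y t w + (N b w - N t w).
have mV : measurable_fun setT V by apply: measurable_funD => //; case: sN.
have sg := sqint_slice t0 bT sgamma; have [mg _] := sg.
have mg2 : measurable_fun setT (fun p => (sl t b gamma p ^+ 2)%:E).
  by apply/measurable_EFinP; exact: measurable_funX mg.
have g2 p : (0 <= (sl t b gamma p ^+ 2)%:E)%E by rewrite lee_fin sqr_ge0.
have V2 : (\int[P]_w (V w ^+ 2)%:E <= ((b - t) * (K * (IY t b + IZ t b)))%:E)%E.
  apply: (@le_trans _ _ ((b - t)%:E * \int[mu]_p (sl t b gamma p ^+ 2)%:E)%E); last first.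
    by rewrite [leRHS]EFinM lee_wpmul2l ?lee_fin ?subr_ge0// gamma_energy.
  rewrite fubini_tonelli2// -ge0_integralZl//; last 3 first.
  - exact: measurable_fun_fubini_tonelli_G.
  - by move=> w _; exact: integral_ge0.
  - by rewrite lee_fin subr_ge0.
  apply: ae_ge0_le_integral => //.
  - by move=> w _; rewrite lee_fin sqr_ge0.
  - by apply/measurable_EFinP; exact: measurable_funX.
  - move=> w _; rewrite mule_ge0 ?lee_fin ?subr_ge0//; exact: integral_ge0.
  - by apply: measurable_funeM; exact: measurable_fun_fubini_tonelli_G.
  apply: filterS3 (equation t0 tb bT) yb0 (sqint_section sg) => w eqw yw sw _.
  apply: le_trans (sqr_integral_slice tb sw).
  rewrite -EFin_expe lee_fin le_eqVlt; apply/orP; left; apply/eqP; congr (_ ^+ 2).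
  by move: eqw; rewrite /V yw subr0 => ->; rewrite subrK.
have sV : sqint P V by split => //; rewrite (le_lt_trans V2)// ltry.
have yE : y t = fun w => V w - (N b w - N t w).
  by apply/funext => w; rewrite /V addrK.
have syt : sqint P (y t) by rewrite yE; exact: sqintB.
split => //.
have orth := L2_ito_orthogonal P_complete B_bm t0 tb bT ito (y_adapted tT) syt.
have iso := L2_ito_isometry T_gt0 P_complete B_bm t0 tb bT ito.
rewrite -lee_fin; apply: le_trans V2; rewrite -ip_sqrE// lee_fin.
rewrite /V in sV *; rewrite (ipDl syt sN sV) (ipDr syt sN syt) (ipDr syt sN sN).
by rewrite orth ipC orth iso addr0 add0r.
Qed.

(** The bound on (b - a) K lets half of the z-energy be absorbed, so E y_t^2 <= (1/2) IY(a, b) for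
    all t in (a, b]. Integrated over an interval of length at most 1 this gives IY <= IY / 2, hence
    IY = 0; the estimate at t = a then kills z and y_a. *)
Let step a b : 0 <= a -> a <= b -> b <= T -> b - a <= 1 -> (b - a) * K <= 1 / 2 ->
  {ae P, forall w, y b w = 0} ->
  {ae P, forall w, y a w = 0} /\
  {ae mu, forall p : R * Omega, a < p.1 <= b ->
     y p.1 p.2 = 0 /\ forall k, z p.1 p.2 k = 0}.
Proof.
move=> a0 ab bT ba1 baK yb0.
have en t : a <= t <= b -> sqint P (y t) /\
    ip P (y t) (y t) + IZ t b <= 1 / 2 * (IY a b + IZ t b).
  move=> /andP[at_ tb]; have [syt h] := energy (le_trans a0 at_) tb bT yb0.
  split => //; apply: (le_trans h); rewrite mulrA.
  have iy := IY_mono a0 at_ bT; have := IY_ge0 t b; have := IZ_ge0 t b => iz0 iy0.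
  apply: (@le_trans _ _ (1 / 2 * (IY t b + IZ t b))); last by rewrite ler_wpM2l// lerD2r.
  rewrite ler_wpM2r ?addr_ge0//; apply: le_trans baK.
  by rewrite ler_wpM2r// lerD2l lerN2.
have sy' := sqint_slice a0 bT sy.
have IY0 : IY a b = 0.
  have := @slice_sqr_le a b (1 / 2 * IY a b) y ab _ sy' _.
  rewrite -/(IY a b) => h; have := IY_ge0 a b.
  suff : IY a b <= (b - a) * (1 / 2 * IY a b).
    move: (IY a b) => x; have : 0 <= b - a by rewrite subr_ge0.
    by move=> ?; nra.
  apply: h; first by rewrite mulr_ge0.
  move=> t /andP[at_ tb]; have tab : a <= t <= b by rewrite (ltW at_).
  have [syt ent] := en t tab.
  rewrite -ip_sqrE// lee_fin; have := IZ_ge0 t b; lra.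
have aab : a <= a <= b by rewrite lexx.
have [sya ena] := en a aab.
have ya := ip_ge0 P (y a); have iz := IZ_ge0 a b.
have IZ0 : IZ a b = 0 by rewrite IY0 in ena; lra.
have ya0 : ip P (y a) (y a) = 0 by rewrite IY0 in ena; lra.
split; first exact: ip_eq0_ae.
have aez : {ae mu, forall p, forall k, slice a b z k p = 0}.
  apply: filter_forall => k; apply: ip_eq0_ae; first exact: (sqint_slice a0 bT (sz k)).
  have /eqP := IZ0; rewrite psumr_eq0 => [|j _]; last exact: ip_ge0.
  by move=> /allP/(_ k (mem_index_enum _))/implyP/(_ isT)/eqP.
apply: filterS2 (ip_eq0_ae sy' IY0) aez => p yp zp pab; split.
  by move: yp; rewrite /slice pab.
by move=> k; move: (zp k); rewrite /slice pab.
Qed.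

Lemma backward_uniqueness : {ae P, forall w, y T w = 0} ->
  {ae mu, forall p : R * Omega, p.1 \in `[0, T] ->
     y p.1 p.2 = 0 /\ forall k, z p.1 p.2 k = 0}.
Proof.
move=> yT0.
(* More than T (1 + 2 K) steps, so the mesh T / m is at most 1 and its product with K is at most
   1/2. *)
pose m := (Num.truncn (T * (1 + 2 * K))).+1.
have mgt : T * (1 + 2 * K) < m%:R by exact: truncnS_gt.
have m0 : 0 < m%:R :> R by rewrite ltr0n.
(* The subdivision runs backwards, from t 0 = T to t m = 0. *)
pose t j : R := T - T * j%:R / m%:R.
have step_size j : t j - t j.+1 = T / m%:R.
  by rewrite /t -natr1; field; rewrite gt_eqF.
have t_ge0 j : (j <= m)%N -> 0 <= t j.
  move=> jm; rewrite subr_ge0 ler_pdivrMr// ler_wpM2l ?ler_nat//; exact: ltW.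
have t_leT j : t j <= T by rewrite gerBl divr_ge0// mulr_ge0// ltW.
have claim j : (j <= m)%N -> {ae P, forall w, y (t j) w = 0} /\
    {ae mu, forall p : R * Omega, t j < p.1 <= T ->
      y p.1 p.2 = 0 /\ forall k, z p.1 p.2 k = 0}.
  elim: j => [_|j ih jm].
    rewrite /t mulr0 mul0r subr0; split => //; apply: aeW => p /andP[Tp pT].
    by move: (lt_le_trans Tp pT); rewrite ltxx.
  have [yj zj] := ih (ltnW jm).
  have sj : t j.+1 <= t j by rewrite -subr_ge0 step_size divr_ge0// ltW.
  have T1 : T * 1 <= T * (1 + 2 * K).
    by apply: ler_wpM2l; [exact: ltW | rewrite lerDl mulr_ge0].
  have [] := step (t_ge0 _ jm) sj (t_leT j) _ _ yj.
  - by rewrite step_size ler_pdivrMr// mul1r -(mulr1 T) (le_trans T1)// ltW.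
  - rewrite step_size mulrAC ler_pdivrMr//; move: mgt; have := T_gt0; have := K_ge0; nra.
  move=> yj1 zj1; split => //.
  apply: filterS2 zj zj1 => p zp zp1 /andP[tp pT].
  by have [ptj|tjp] := leP p.1 (t j); [apply: zp1; rewrite tp|apply: zp; rewrite tjp].
have [_ H] := claim m (leqnn m).
have tm : t m = 0 by rewrite /t mulfK ?gt_eqF// subrr.
(* The induction reaches only times p.1 > 0; time 0 is a null set. *)
apply: filterS2 H (ae_fst_neq P 0) => p H p0; rewrite in_itv/= => /andP[p0' pT].
apply: H; rewrite tm pT andbT lt_neqAle p0' andbT; apply/eqP => p00; exact: p0.
Qed.

End core.

End uniqueness.

(** * From two solutions of the equation to the energy estimate *)

Section bsde_uniqueness.
Context (R : realType) (T : R) (T_gt0 : 0 < T) (d : nat).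
Context (dO : measure_display) (Omega : measurableType dO).
Context (P : probability Omega R) (P_complete : measure_is_complete P).
Context (B : R -> Omega -> realpow R 'I_d) (B_bm : brownian_motion P T B).
Context (g : R -> R -> realpow R 'I_d -> R).
Context (g_meas : measurable_fun (`[0, T] `*` setT)
  (fun p : R * (R * realpow R 'I_d) => g p.1 p.2.1 p.2.2)).
Context (g_L2 : (\int[lebesgue_measure]_(t in `[0%R, T])
  ((`|g t 0%R (fun=> 0%R)| ^+ 2)%R)%:E < +oo)%E).
Context (Lg : R) (Lg_gt0 : 0 < Lg).
Context (g_lip : {ae lebesgue_measure, forall t, t \in `[0, T] ->
  forall (y1 y2 : R) (z1 z2 : realpow R 'I_d),
    `|g t y1 z1 - g t y2 z2| <= Lg * (`|y1 - y2| + norm2 (fun k => z1 k - z2 k))}).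

Notation F := (augmented_filtration P B).
Notation mu := (lebesgue_measure \x P)%E.

Notation lift f := (fun t w (_ : 'I_1) => f t w).
Notation sl a b f := (slice a b (lift f) ord0).

Lemma ae_fst (Q : R -> Prop) : {ae lebesgue_measure, forall t, Q t} ->
  {ae mu, forall p : R * Omega, Q p.1}.
Proof.
move=> [N [mN N0 QN]]; exists (N `*` setT); split.
- exact: measurableX.
- by rewrite product_measure1E// [X in (X * _)%E]N0 mul0e.
- by move=> p /= nQ; split => //; exact: QN.
Qed.

Lemma norm2_le_sum n (x : 'I_n -> R) : norm2 x <= \sum_k `|x k|.
Proof.
have s0 : 0 <= \sum_k `|x k| by apply: sumr_ge0.
rewrite -(ger0_norm s0) -sqrtr_sqr /norm2 ler_wsqrtr// /dot expr2 mulr_suml.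
apply: ler_sum => k _; rewrite -expr2 -(real_normK (num_real (x k))) expr2.
by apply: ler_wpM2l => //; rewrite (bigD1 k)//= lerDl sumr_ge0.
Qed.

Let g_lip_mu : {ae mu, forall p : R * Omega, 0 < p.1 <= T ->
  forall (y1 y2 : R) (z1 z2 : realpow R 'I_d),
    `|g p.1 y1 z1 - g p.1 y2 z2| <= Lg * (`|y1 - y2| + norm2 (fun k => z1 k - z2 k))}.
Proof.
apply: filterS (ae_fst g_lip) => p gp /andP[p0 pT]; apply: gp.
by rewrite in_itv/= (ltW p0).
Qed.

Let sqint_abs d' (S : measurableType d') (m : {measure set S -> \bar R}) (f : S -> R) :
  sqint m f -> sqint m (fun x => `|f x|).
Proof.
move=> sf; have [mf _] := sf; apply: le_sqint sf _.
  exact: measurableT_comp.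
by move=> x; rewrite normr_id.
Qed.

Let measurable_generator (y : R * Omega -> R) (z : R * Omega -> realpow R 'I_d) :
  measurable_fun (`[0, T] `*` setT) y ->
  (forall k, measurable_fun (`[0, T] `*` setT) (fun p => z p k)) ->
  measurable_fun (`[0, T] `*` setT) (fun p => g p.1 (y p) (z p)).
Proof.
move=> my mz.
have mD : measurable (`[0, T] `*` setT : set (R * Omega)) by exact: measurableX.
(* Extension by 0 outside [0, T] gives a map measurable everywhere, which can be composed with g,
   measurable only over [0, T]. *)
pose z' p k := ((fun p => z p k) \_ (`[0, T] `*` setT)) p.
pose f p : R * (R * realpow R 'I_d) := (p.1, ((y \_ (`[0, T] `*` setT)) p, z' p)).
have mf : measurable_fun setT f.
  apply: measurable_fun_pair => //; apply: measurable_fun_pair.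
    exact/(measurable_restrictT _ mD).
  apply: measurable_realpow => k.
  by apply/(measurable_restrictT (fun p => z p k) mD); exact: mz.
apply: (@eq_measurable_fun _ _ _ _ _
  ((fun q : R * (R * realpow R 'I_d) => g q.1 q.2.1 q.2.2) \o f)).
  move=> p pD; rewrite /f /= /patch pD; congr g; apply/funext => k.
  by rewrite /z' patchE pD.
apply: (measurable_comp _ _ g_meas (measurable_funTS mf)); first exact: measurableX.
by move=> _ [p [pT _] <-].
Qed.

Let sqint_slice_origin : sqint mu (sl 0 T (fun t _ => g t 0 (fun=> 0))).
Proof.
apply: sqint_slice_H2.
  move=> k; apply: measurable_slice_fun.
  apply: (measurable_generator (y := fun=> 0) (z := fun=> (fun=> 0) : realpow R 'I_d)).
    exact: measurable_cst.
  by move=> j; exact: measurable_cst.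
rewrite (H2_sqnorm_deterministic T P (fun t (_ : 'I_1) => g t 0 (fun=> 0))).
apply: le_lt_trans g_L2; rewrite le_eqVlt; apply/orP; left; apply/eqP.
by apply: eq_integral => t _; rewrite norm2_sqr big_ord1 real_normK// num_real.
Qed.

Section generator.
Context (Y : R -> Omega -> R) (Z : R -> Omega -> realpow R 'I_d).
Context (mY : measurable_fun (`[0, T] `*` setT) (fun p : R * Omega => Y p.1 p.2)).
Context (mZ : forall k, measurable_fun (`[0, T] `*` setT) (fun p : R * Omega => Z p.1 p.2 k)).
Context (sY : sqint mu (sl 0 T Y)) (sZ : forall k, sqint mu (slice 0 T Z k)).

Let G t w := g t (Y t w) (Z t w).

(** The Lipschitz condition, used against (0, 0), gives linear growth: |g(t, Y, Z)| is at most |g(t,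
    0, 0)| plus a multiple of |Y| + |Z|. *)
Lemma sqint_slice_generator : sqint mu (sl 0 T G).
Proof.
have mG : measurable_fun setT (sl 0 T G).
  apply: measurable_slice_fun.
  exact: (measurable_generator mY mZ).
split => //.
pose H p := `|sl 0 T (fun t _ => g t 0 (fun=> 0)) p| +
  (Lg * `|sl 0 T Y p| + Lg * \sum_k `|slice 0 T Z k p|).
have [mH Hoo] : sqint mu H.
  apply: sqintD; first exact: sqint_abs.
  by apply: sqintD; apply: sqintZ; [|apply: sqint_sum => k]; exact: sqint_abs.
apply: le_lt_trans Hoo; apply: ae_ge0_le_integral => //.
- by move=> p _; rewrite lee_fin sqr_ge0.
- by apply/measurable_EFinP; exact: measurable_funX mG.
- by move=> p _; rewrite lee_fin sqr_ge0.
- by apply/measurable_EFinP; exact: measurable_funX.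
apply: filterS g_lip_mu => p gp _; rewrite lee_fin.
rewrite -(real_normK (num_real (sl 0 T G p))) /H /slice.
case: ifPn => [pT|_]; last first.
  by rewrite normr0 expr0n/= sqr_ge0.
rewrite lerXn2r ?nnegrE//.
  by rewrite addr_ge0// addr_ge0// mulr_ge0// ?sumr_ge0// ltW.
have := gp pT (Y p.1 p.2) 0 (Z p.1 p.2) (fun=> 0).
rewrite subr0 (_ : (fun k => Z p.1 p.2 k - 0) = Z p.1 p.2); last first.
  by apply/funext => k; rewrite subr0.
rewrite /G => h; rewrite -[g p.1 _ _](subrK (g p.1 0 (fun=> 0))).
rewrite (le_trans (ler_normD _ _))// addrC lerD2l (le_trans h)// mulrDr lerD2l.
by rewrite ler_wpM2l ?norm2_le_sum// ltW.
Qed.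

(** Integrability of the paths is what allows the real-valued integrals over [a, T] and [b, T] to be
    subtracted. It follows by multiplying a square-integrable path with the indicator of (0, T]. *)
Lemma integrable_generator : {ae P, forall w,
  lebesgue_measure.-integrable `]0, T] (EFin \o G ^~ w)}.
Proof.
apply: filterS (sqint_section sqint_slice_generator) => w sw.
have [msw _] := sw.
pose I : R -> R := \1_(`]0, T]%classic : set R).
have sI : sqint lebesgue_measure I.
  split; first exact: measurable_indic.
  rewrite (_ : integral _ _ _ = \int[lebesgue_measure]_t (I t)%:E)%E; last first.
    by apply: eq_integral => t _; rewrite /I indicE; case: (_ \in _); rewrite ?expr1n ?expr0n.
  rewrite integral_indic// setIT.
  rewrite [X in (X < _)%E](_ : _ = lebesgue_measure (`]0, T]%classic : set R))//.
  by rewrite lebesgue_measure_itv/=; case: ifP => _; rewrite ?ltry.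
apply: (iffRL (@integrable_mkcond _ _ _ lebesgue_measure _ (EFin \o G ^~ w)
  (measurable_itv `]0, T]))).
have := sqint_mul sw sI; congr (integrable _ _ _); apply/funext => t.
rewrite patchE /I/= indicE /slice/= mem_setE in_itv/=.
by case: ifP => _; rewrite ?mulr1 ?mulr0.
Qed.

(** The equations at a and b are subtracted, outside one null set for all a and b. The equation at T
    gives the terminal value. *)
Lemma bsde_increment xi M :
  {ae P, forall w, forall t, t \in `[0, T] -> Y t w = xi w
    + \int[lebesgue_measure]_(s in `[t, T]) g s (Y s w) (Z s w) - (M T w - M t w)} ->
  {ae P, forall w, [/\ lebesgue_measure.-integrable `]0, T] (EFin \o G ^~ w),
    Y T w = xi w & forall a b, 0 <= a -> a <= b -> b <= T ->
    Y a w - Y b w = \int[lebesgue_measure]_(s in `]a, b]) G s w - (M b w - M a w)]}.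
Proof.
move=> eqY; apply: filterS2 eqY integrable_generator => w eqY iG.
have iGa a : 0 <= a -> lebesgue_measure.-integrable `]a, T] (EFin \o G ^~ w).
  move=> a0; apply: integrableS iG => //.
  by apply: subset_itvr; rewrite bnd_simp.
have {}eqY a : 0 <= a -> a <= T -> Y a w =
    xi w + \int[lebesgue_measure]_(s in `]a, T]) G s w - (M T w - M a w).
  move=> a0 aT; rewrite eqY; last by rewrite in_itv/= a0.
  by rewrite -Rintegral_itv_obnd_cbnd//; exact: iGa.
split => //.
  by rewrite eqY ?(ltW T_gt0)// set_itvoc0 Rintegral_set0 subrr addr0 subr0.
move=> a b a0 ab bT; rewrite !eqY//; [|exact: le_trans ab|exact: le_trans bT].
rewrite -(@Rintegral_itvB _ (G ^~ w) (BRight a) (BRight T) b (iGa a a0)) ?bnd_simp//.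
ring.
Qed.

End generator.

Let bsde_solution_data xi Y Z : bsde_solution P T B g xi Y Z ->
  [/\ forall t, 0 <= t <= T -> measurable_wrt (F t) (Y t),
      sqint mu (sl 0 T Y), sqint mu (sl 0 T (fun t w => g t (Y t w) (Z t w)))
    & exists2 M, L2_ito T P B Z M & {ae P, forall w,
        [/\ lebesgue_measure.-integrable `]0, T] (EFin \o (fun s => g s (Y s w) (Z s w))),
            Y T w = xi w & forall a b, 0 <= a -> a <= b -> b <= T -> Y a w - Y b w =
              \int[lebesgue_measure]_(s in `]a, b]) g s (Y s w) (Z s w) - (M b w - M a w)]}].
Proof.
move=> [[pY foY] [pZ foZ] _ [M itoM eqY]].
have mY := predictable_measurable T_gt0 P_complete B_bm (ord0 : 'I_1) pY.
have mZ k := predictable_measurable T_gt0 P_complete B_bm k pZ.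
have sY : sqint mu (sl 0 T Y).
  by apply: sqint_slice_H2 foY _ => k; apply: measurable_slice_fun.
have sZ k : sqint mu (slice 0 T Z k).
  by apply: sqint_slice_H2 foZ _ => j; exact: measurable_slice_fun.
split => //.
- by move=> t tT; have := predictable_adapted (ord0 : 'I_1) tT pY.
- exact: sqint_slice_generator.
- exists M; first exact: (ito_integral_L2_ito T_gt0 P_complete B_bm sZ itoM).
  exact: bsde_increment.
Qed.

Lemma bsde_unique xi Y1 Z1 Y2 Z2 :
  bsde_solution P T B g xi Y1 Z1 -> bsde_solution P T B g xi Y2 Z2 ->
  {ae mu, forall p : R * Omega, p.1 \in `[0, T] ->
     Y1 p.1 p.2 = Y2 p.1 p.2 /\ Z1 p.1 p.2 = Z2 p.1 p.2}.
Proof.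
move=> /bsde_solution_data[aY1 sY1 sG1 [M1 ito1 eq1]].
move=> /bsde_solution_data[aY2 sY2 sG2 [M2 ito2 eq2]].
pose y t w := Y1 t w - Y2 t w.
(* Written in the shape that [L2_ito_lin] produces. *)
pose z t w : realpow R 'I_d := fun k => -1 * Z2 t w k + Z1 t w k.
pose gamma t w := g t (Y1 t w) (Z1 t w) - g t (Y2 t w) (Z2 t w).
have sliceB (f1 f2 : R -> Omega -> R) : sl 0 T (fun t w => f1 t w - f2 t w) =
    fun p => sl 0 T f1 p - sl 0 T f2 p.
  by apply/funext => p; rewrite /slice; case: ifP => // _; rewrite subrr.
have ito := L2_ito_lin T_gt0 P_complete B_bm (-1) ito2 ito1.
have sy : sqint mu (sl 0 T y) by rewrite sliceB; exact: sqintB.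
have sgamma : sqint mu (sl 0 T gamma) by rewrite sliceB; exact: sqintB.
have ay t : 0 <= t <= T -> measurable_wrt (F t) (y t).
  by move=> tT; apply: measurable_wrtB; [exact: aY1|exact: aY2].
(* K = 2 Lg^2 comes from (a + b)^2 <= 2 (a^2 + b^2) applied to the Lipschitz bound. *)
have K0 : 0 <= 2 * Lg ^+ 2 by rewrite mulr_ge0// sqr_ge0.
have gamma_le : {ae mu, forall p : R * Omega, 0 < p.1 <= T ->
    gamma p.1 p.2 ^+ 2 <= 2 * Lg ^+ 2 * (y p.1 p.2 ^+ 2 + \sum_k z p.1 p.2 k ^+ 2)}.
  apply: filterS g_lip_mu => p gp /gp gpT.
  rewrite -norm2_sqr -(real_normK (num_real (gamma p.1 p.2))).
  have := gpT (Y1 p.1 p.2) (Y2 p.1 p.2) (Z1 p.1 p.2) (Z2 p.1 p.2).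
  rewrite (_ : (fun k => Z1 p.1 p.2 k - Z2 p.1 p.2 k) = z p.1 p.2); last first.
    by apply/funext => k; rewrite /z mulN1r addrC.
  rewrite -/(y p.1 p.2) -/(gamma p.1 p.2) -(real_normK (num_real (y p.1 p.2))).
  move: `|gamma p.1 p.2| `|y p.1 p.2| (norm2 (z p.1 p.2)) (normr_ge0 (gamma p.1 p.2))
    => c a b c0 cab.
  have : c ^+ 2 <= (Lg * (a + b)) ^+ 2 by rewrite lerXn2r// nnegrE// (le_trans c0).
  move=> /le_trans; apply.
  have -> : 2 * Lg ^+ 2 * (a ^+ 2 + b ^+ 2) = (Lg * (a + b)) ^+ 2 + (Lg * (a - b)) ^+ 2.
    by ring.
  by rewrite lerDl sqr_ge0.
have equation a b : 0 <= a -> a <= b -> b <= T -> {ae P, forall w,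
    y a w - y b w = \int[lebesgue_measure]_(s in `]a, b]) gamma s w -
      ((-1 * M2 b w + M1 b w) - (-1 * M2 a w + M1 a w))}.
  move=> a0 ab bT; apply: filterS2 eq1 eq2 => w [i1 _ e1] [i2 _ e2].
  have sub : `]a, b] `<=` `]0, T]%classic by apply: subset_itv; rewrite bnd_simp.
  rewrite /gamma RintegralB//; [|exact: integrableS i1|exact: integrableS i2].
  have := e1 _ _ a0 ab bT; have := e2 _ _ a0 ab bT; rewrite /y.
  move: (Rintegral _ _ _) (Rintegral _ _ _) => I2 I1 h2 h1.
  have -> : Y1 a w - Y2 a w - (Y1 b w - Y2 b w) =
      (Y1 a w - Y1 b w) - (Y2 a w - Y2 b w) by ring.
  by rewrite h1 h2; ring.
have yT : {ae P, forall w, y T w = 0}.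
  by apply: filterS2 eq1 eq2 => w [_ e1 _] [_ e2 _]; rewrite /y e1 e2 subrr.
apply: filterS (backward_uniqueness T_gt0 P_complete B_bm K0 ay sy sgamma ito gamma_le
  equation yT) => p h pT; have [yp zp] := h pT; split; first exact: subr0_eq.
by apply/funext => k; have := zp k; rewrite mulN1r addrC => /subr0_eq.
Qed.

End bsde_uniqueness.

(** * The law of the state *)

Section hermite_functions.
Context (R : realType).

(** Differentiating p(y) exp(- y^2 / 2) replaces p by p' - y p. Measurability of [hermite] is
    deduced from this form. *)
Lemma derive1n_gaussian n : exists p : {poly R},
  derive1n n (fun y : R => expR (- (y ^+ 2 / 2))) = fun y => p.[y] * expR (- (y ^+ 2 / 2)).
Proof.
elim: n => [|n [p ih]].
  by exists 1; apply/funext => y; rewrite hornerC mul1r.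
exists (p^`() - 'X * p); rewrite derive1nS ih; apply/funext => y; rewrite derive1E.
have h : is_derive y 1 (fun x : R => - (x ^+ 2 / 2)) (- y).
  by apply: is_derive_eq; rewrite ?scaler0 ?add0r /GRing.scale/=; field.
have he := is_derive1_comp (is_derive_expR _) h.
transitivity ('D_1 (horner p * (expR \o (fun x : R => - (x ^+ 2 / 2)))) y) => //.
rewrite (@derive_val _ _ _ _ _ _ _ (is_deriveM (is_derive_poly p y) he)) /comp.
by rewrite hornerD hornerN hornerM hornerX /GRing.scale/=; ring.
Qed.

Lemma measurable_hermite n : measurable_fun setT (@hermite R n).
Proof.
have mexp : measurable_fun setT (fun y : R => expR (y ^+ 2 / 2)).
  apply: measurableT_comp; first exact: measurable_expR.
  by apply: measurable_funM => //; exact: measurable_funX.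
have mexpN : measurable_fun setT (fun y : R => expR (- (y ^+ 2 / 2))).
  apply: measurableT_comp; first exact: measurable_expR.
  by apply: measurableT_comp => //; apply: measurable_funM => //; exact: measurable_funX.
have [p pE] := derive1n_gaussian n.
rewrite /hermite pE; apply: measurable_funM; first exact: measurable_funM.
apply: measurable_funM => //; apply: continuous_measurable_fun.
exact: continuous_horner.
Qed.

End hermite_functions.

Section restricted_law.
Context d1 d2 (S : measurableType d1) (S' : measurableType d2) (R : realType).
Context (m : {measure set S -> \bar R}) (D : set S) (mD : measurable D).
Context (X : S -> S') (mX : measurable_fun setT X).

Lemma restricted_law : (m D < +oo)%E ->
  exists nu : {finite_measure set S' -> \bar R},
    (forall A, nu A = m (X @^-1` A `&` D)) /\
    forall A (f : S' -> \bar R), measurable A -> measurable_fun setT f ->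
      (forall x, (0 <= f x)%E) ->
      (\int[nu]_(x in A) f x <= \int[m]_(x in D) f (X x))%E.
Proof.
move=> Doo; pose r : {measure set S -> \bar R} := mrestr m mD.
pose law := measure_function_pushforward__canonical__measure_function_Measure r mX.
have fin_law : fin_num_fun law.
  apply: lty_fin_num_fun.
  by rewrite /law /= /pushforward/= /mrestr preimage_setT setTI.
pose nu : {finite_measure set S' -> \bar R} :=
  HB.pack (Measure.sort law) (Measure.class law)
    (Measure_isFinite.Build _ _ _ law fin_law).
exists nu; split=> [//|A f mA mf f0].
apply: (@le_trans _ _ (\int[nu]_x f x)%E).
  exact: ge0_subset_integral.
rewrite ge0_integral_pushforward// preimage_setT.
have mfX : measurable_fun setT (f \o X) by exact: measurableT_comp.
rewrite -(setUv D) ge0_integral_setU//=; last 3 first.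
- exact: measurableC.
- by rewrite setUv.
- by apply/disj_setPCl.
rewrite [X in (_ + X)%E](_ : _ = 0%E) ?adde0.
  apply: ge0_le_measure_integral => // A' mA'.
  by rewrite /= /mrestr le_measure// inE//; exact: measurableI.
apply: null_set_integral => //.
- exact: measurableC.
- exact: measurable_funTS.
- by rewrite /= /mrestr setICl measure0.
Qed.

End restricted_law.

Section state_law.
Context (R : realType) (T : R) (T_gt0 : 0 < T) (d : nat).
Context (dO : measure_display) (Omega : measurableType dO).
Context (P : probability Omega R) (P_complete : measure_is_complete P).
Context (B : R -> Omega -> realpow R 'I_d) (B_bm : brownian_motion P T B).
Context (h : nat -> R -> realpow R 'I_d).
Context (W : nat -> R -> Omega -> R).
Context (W_ito : forall i, ito_integral P T B (fun t _ => h i t) (W i)).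

Notation mu := (lebesgue_measure \x P)%E.

(** The W^i are jointly measurable only off a null set, and only on [0, T]. Setting the state
    coordinates to 0 elsewhere yields a map measurable everywhere, along which a measure can be
    pushed forward. *)
Lemma chaos_process_version : exists X : R * Omega -> R * realpow R multiindex,
  [/\ measurable_fun setT X, forall p, (X p).1 = p.1 &
    {ae mu, forall p : R * Omega, p.1 \in `[0, T] -> X p = (p.1, chaos_process W p.1 p.2)}].
Proof.
have [N [mN N0 mW]] := ito_family_measurable P_complete B_bm W_ito.
pose D : set (R * Omega) := `[0, T] `*` ~` N.
have mD : measurable D by apply: measurableX => //; exact: measurableC.
pose V p : realpow R multiindex :=
  fun a => ((fun p : R * Omega => chaos_process W p.1 p.2 a) \_ D) p.
exists (fun p => (p.1, V p)); split => //.
  apply: measurable_fun_pair => //; apply: measurable_realpow => a.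
  apply/(measurable_restrictT _ mD); apply: measurable_prod => i _.
  by apply: (measurableT_comp (measurable_hermite _)); exact: mW.
have aeN : {ae P, forall w, ~ N w} by exists N; split => // w /= /contrapT.
apply: filterS (ae_snd aeN) => p nN pT; congr pair; apply/funext => a.
by rewrite /V patchE mem_set.
Qed.


(** The measure is fixed before phi and v, so that u and v can share it. Where v represents phi, the
    integral of |v|^2 is controlled by that of |phi|^2 under dt x P. *)
Lemma state_law : exists nu : {finite_measure set (R * realpow R multiindex)%type -> \bar R},
  nu (~` (`[0, T] `*` setT)) = 0%E /\
  forall n (phi : R -> Omega -> realpow R 'I_n) (v : R * realpow R multiindex -> realpow R 'I_n),
    (forall k, sqint mu (slice 0 T phi k)) -> measurable_fun setT v ->
    {ae mu, forall p : R * Omega, p.1 \in `[0, T] ->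
       phi p.1 p.2 = v (p.1, chaos_process W p.1 p.2)} ->
    (\int[nu]_(x in `[0%R, T] `*` setT) ((norm2 (v x) ^+ 2)%R)%:E < +oo)%E.
Proof.
have [X [mX X1 XE]] := chaos_process_version.
(* Half-open, to coincide with the support of [slice]. *)
pose I : set (R * Omega) := `]0, T] `*` setT.
have mI : measurable I by exact: measurableX.
have Ioo : (mu I < +oo)%E.
  rewrite product_measure1E// [X in (_ * X)%E]probability_setT mule1.
  rewrite [X in (X < _)%E](_ : _ = lebesgue_measure (`]0, T]%classic : set R))//.
  by rewrite lebesgue_measure_itv/=; case: ifP => _; rewrite ?ltry.
have [nu [nuE nu_le]] := @restricted_law _ _ _ _ _ mu I mI X mX Ioo.
exists nu; split.
  rewrite nuE (_ : _ `&` I = set0) ?measure0//; apply/seteqP; split=> // p [/=].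
  move=> nXp [p0T _]; apply: nXp; split=> //=; rewrite X1.
  by move: p0T; rewrite /= !in_itv/= => /andP[/ltW -> ->].
move=> n phi v sphi mv phiE.
have mnorm : measurable_fun setT (fun x => (norm2 (v x) ^+ 2)%:E).
  apply/measurable_EFinP.
  apply: (eq_measurable_fun (fun x => \sum_k v x k ^+ 2)) => [x _|]; first by rewrite norm2_sqr.
  apply: measurable_sum => k; apply: measurable_funX.
  exact: (measurableT_comp (measurable_coord k) mv).
apply: le_lt_trans (nu_le _ _ _ mnorm _) _; first exact: measurableX.
  by move=> x; rewrite lee_fin sqr_ge0.
have m2 k : measurable_fun setT (fun p => (slice 0 T phi k p ^+ 2)%:E).
  by have [ms _] := sphi k; apply/measurable_EFinP; exact: measurable_funX.
apply: (@le_lt_trans _ _ (\int[mu]_p (\sum_k (slice 0 T phi k p ^+ 2)%:E))%E); last first.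
  rewrite ge0_integral_sum//; last by move=> k p _; rewrite lee_fin sqr_ge0.
  by apply: lte_sum_pinfty => k _; case: (sphi k).
rewrite integral_mkcond; apply: ae_ge0_le_integral => //.
- by move=> p _; rewrite patchE; case: ifP => // _; rewrite lee_fin sqr_ge0.
- apply/(measurable_restrictT _ mI); apply: measurable_funTS.
  exact: (measurableT_comp mnorm mX).
- by move=> p _; apply: sume_ge0 => k _; rewrite lee_fin sqr_ge0.
- by apply: emeasurable_sum => k; exact: m2.
apply: filterS2 XE phiE => p Xp vp _; rewrite patchE; case: ifPn => [|_]; last first.
  by apply: sume_ge0 => k _; rewrite lee_fin sqr_ge0.
rewrite inE => -[/= p0T _].
have pT : p.1 \in `[0, T] by move: p0T; rewrite !in_itv/= => /andP[/ltW -> ->].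
rewrite (Xp pT) -(vp pT) norm2_sqr sumEFin lee_fin; apply: ler_sum => k _.
by move: p0T; rewrite /slice in_itv/= => ->.
Qed.

End state_law.

Section markov_representation.
Context (R : realType) (T : R) (T_gt0 : 0 < T) (d : nat).
Context (dO : measure_display) (Omega : measurableType dO).
Context (P : probability Omega R) (P_complete : measure_is_complete P).
Context (B : R -> Omega -> realpow R 'I_d) (B_bm : brownian_motion P T B).
Context (h : nat -> R -> realpow R 'I_d) (h_basis : orthonormal_basis T h).
Context (W : nat -> R -> Omega -> R).
Context (W_ito : forall i, ito_integral P T B (fun t _ => h i t) (W i)).

Notation mu := (lebesgue_measure \x P)%E.

Lemma predictable_state_fun n (phi : R -> Omega -> realpow R 'I_n) :
  predictable T (augmented_filtration P B) phi ->
  exists2 v : R * realpow R multiindex -> realpow R 'I_n, measurable_fun setT v &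
    {ae mu, forall p : R * Omega, p.1 \in `[0, T] ->
      phi p.1 p.2 = v (p.1, chaos_process W p.1 p.2)}.
Proof.
move=> pphi.
have /choice[v hv] k : exists v : R * realpow R multiindex -> R, measurable_fun setT v /\
    {ae mu, forall p : R * Omega, p.1 \in `[0, T] ->
      phi p.1 p.2 k = v (p.1, chaos_process W p.1 p.2)}.
  have [|v mv ev] := @state_fun R T dO Omega P W (fun p => phi p.1 p.2 k).
    move=> U mU; have mUk : measurable [set x : realpow R 'I_n | U (x k)].
      by have := measurable_coord k measurableT mU; rewrite setTI.
    apply: (state_set_predictable T_gt0 P_complete B_bm h_basis W_ito).
    exact: (pphi _ mUk).
  by exists v.
exists (fun x => (fun k => v k x)).
  by apply: measurable_realpow => k; case: (hv k).
have : {ae mu, forall p : R * Omega, forall k, p.1 \in `[0, T] ->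
    phi p.1 p.2 k = v k (p.1, chaos_process W p.1 p.2)}.
  by apply: filter_forall => k; case: (hv k).
by apply: filterS => p hp pT; apply/funext => k; exact: hp.
Qed.

End markov_representation.

Theorem theorem3p6 (R : realType) (T : R) (T_gt0 : 0 < T) (d : nat)
    (dO : measure_display) (Omega : measurableType dO)
    (P : probability Omega R) (P_complete : measure_is_complete P)
    (B : R -> Omega -> realpow R 'I_d) (B_bm : brownian_motion P T B)
    (h : nat -> R -> realpow R 'I_d) (h_basis : orthonormal_basis T h)
    (W : nat -> R -> Omega -> R)
    (W_ito : forall i, ito_integral P T B (fun t _ => h i t) (W i))
    (g : R -> R -> realpow R 'I_d -> R)
    (g_meas : measurable_fun (`[0, T] `*` setT)
       (fun p : R * (R * realpow R 'I_d) => g p.1 p.2.1 p.2.2))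
    (g_L2 : (\int[lebesgue_measure]_(t in `[0%R, T])
               ((`|g t 0%R (fun=> 0%R)| ^+ 2)%R)%:E < +oo)%E)
    (Lg : R) (Lg_gt0 : 0 < Lg)
    (g_lip : {ae lebesgue_measure, forall t, t \in `[0, T] ->
       forall (y1 y2 : R) (z1 z2 : realpow R 'I_d),
         `|g t y1 z1 - g t y2 z2| <=
         Lg * (`|y1 - y2| + norm2 (fun k => z1 k - z2 k))})
    (xi : Omega -> R)
    (xi_meas : measurable_wrt (augmented_filtration P B T) xi)
    (xi_L2 : (\int[P]_w ((xi w ^+ 2)%R)%:E < +oo)%E) :
  exists (u : R * realpow R multiindex -> R)
         (v : R * realpow R multiindex -> realpow R 'I_d),
    [/\ measurable_fun (`[0, T] `*` setT) u,
        measurable_fun (`[0, T] `*` setT) v,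
        forall (Y : R -> Omega -> R) (Z : R -> Omega -> realpow R 'I_d),
          bsde_solution P T B g xi Y Z ->
          {ae (lebesgue_measure \x P)%E, forall p, p.1 \in `[0, T] ->
             Y p.1 p.2 = u (p.1, chaos_process W p.1 p.2)} /\
          {ae (lebesgue_measure \x P)%E, forall p, p.1 \in `[0, T] ->
             Z p.1 p.2 = v (p.1, chaos_process W p.1 p.2)}
      & exists nu : {finite_measure set (R * realpow R multiindex)%type -> \bar R},
          [/\ nu (~` (`[0, T] `*` setT)) = 0%E,
              (\int[nu]_(p in `[0%R, T] `*` setT) ((u p ^+ 2)%R)%:E < +oo)%E
            & (\int[nu]_(p in `[0%R, T] `*` setT)
                 ((norm2 (v p) ^+ 2)%R)%:E < +oo)%E]].
Proof.
have [nu [nu0 nu_fin]] := state_law P_complete B_bm W_ito.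
(* Existence of a solution is not assumed: [u = v = 0] will do when there is none. *)
have [[[Y Z] sol]|nosol] := pselect (exists YZ : (R -> Omega -> R) *
    (R -> Omega -> realpow R 'I_d), bsde_solution P T B g xi YZ.1 YZ.2); last first.
  exists (fun=> 0), (fun=> (fun=> 0)); split => //.
    by move=> Y Z sol; case: nosol; exists (Y, Z).
  exists nu; split => //; rewrite integral0_eq// => x _; first by rewrite expr0n.
  by rewrite norm2_sqr big1// => k _; rewrite expr0n.
have [[pY foY] [pZ foZ] _ _] := sol.
have [u mu hu] := predictable_state_fun T_gt0 P_complete B_bm h_basis W_ito pY.
have [v mv hv] := predictable_state_fun T_gt0 P_complete B_bm h_basis W_ito pZ.
(* Y was represented as a process in R^1, so its only coordinate is taken. *)
exists (fun x => u x ord0), v; split.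
- by apply: measurable_funTS; apply: (measurableT_comp (measurable_coord ord0) mu).
- exact: measurable_funTS.
(* The pair comes from one solution; any other solution agrees with it almost everywhere. *)
- move=> Y' Z' sol'.
  have uniq := bsde_unique T_gt0 P_complete B_bm g_meas g_L2 Lg_gt0 g_lip sol' sol.
  split.
    by apply: filterS2 uniq hu => p yz yu pT; have [-> _] := yz pT; rewrite -(yu pT).
  by apply: filterS2 uniq hv => p yz zv pT; have [_ ->] := yz pT; exact: zv.
- have slice_sqint n (phi : R -> Omega -> realpow R 'I_n) :
      predictable T (augmented_filtration P B) phi -> (H2_sqnorm P T phi < +oo)%E ->
      forall k, sqint (lebesgue_measure \x P)%E (slice 0 T phi k).
    move=> pphi; apply: sqint_slice_H2 => k; apply: measurable_slice_fun.
    exact: (predictable_measurable T_gt0 P_complete B_bm k pphi).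
  exists nu; split => //; last exact: nu_fin (slice_sqint _ _ pZ foZ) mv hv.
  have := nu_fin _ _ _ (slice_sqint _ _ pY foY) mu hu.
  by under eq_integral do rewrite norm2_sqr big_ord1.
Qed.
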